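(* Let $K=\mathbb{R}$ or $\mathbb{C}$ and let $G$ be one of the following groups: $SL_N(K)$, $GL_N(K)$, $O_N(\mathbb{R})$ ($N\ge 3$), $SO_N(\mathbb{R})$ ($N\ge 3$), $U_N$, $SU_2$, $Sp_{2N}(\mathbb{R})$. Let $S=S_{g,b}$ be an oriented surface of genus $g$ with $b\ge 1$ boundary components (so that its fundamental group is free), and let $f\in \mathrm{Mod}(S)$. Then $f$ acts on the $G$-character variety $\mathfrak{X}(S,G)$ of $S$, and the algebraic entropy of this action equals the spectral radius of $f$: $$\mathrm{e}_{\mathrm{alg}}(f)=\rho(f).$$
   Context: **Mapping class group.** $\mathrm{Mod}(S)=\pi_0(\mathrm{Diff}^+(S))$, where $\mathrm{Diff}^+(S)$ is the group of orientation-preserving diffeomorphisms of $S$ that are the identity on the boundary. Let $\pi=\pi_1(S,p_0)$, a free group. Choosing $p_0$ on the boundary of $S$, each $f\in\mathrm{Mod}(S)$ is identified with an element of $\mathrm{Aut}(\pi)$. $f^{\circ n}$ denotes the $n$-th iterate. **Spectral radius.** Let $\mathcal{S}$ be a finite generating set of $\pi$, and for $w\in\pi$ let $|w|_{\mathcal{S},red}$ be its cyclically reduced word length with respect to $\mathcal{S}$, i.e. the minimum of the $\mathcal{S}$-word lengths of the conjugates of $w$ (for a free generating set, the length of the cyclically reduced form of $w$). Then $$\rho(f)=\sup_{\alpha\in\pi}\ \limsup_{n\to\infty}\frac1n\log\big(|f^{\circ n}\alpha|_{\mathcal{S},red}\big)$$ (with $\log 0=-\infty$). This does not depend on $\mathcal{S}$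 or on the base point. **Character variety.** $G$ is regarded as a linear reductive algebraic group over its field of definition $F$ ($F=\mathbb{R}$ or $\mathbb{C}$; the compact groups are real algebraic groups), with a fixed faithful linear representation. The $G$-representation variety is $\mathfrak{R}=\mathrm{Hom}(\pi,G)\cong G^{r}$, where $r$ is the rank of $\pi$; $G$ acts on it by componentwise conjugation. The $G$-character variety is the categorical quotient $\mathfrak{X}=\mathfrak{X}(S,G)=\mathfrak{R}/\!/G=\mathrm{Spec}(F[\mathfrak{R}]^G)$, an affine variety. **Action.** $f\in\mathrm{Aut}(\pi)$ acts on $\mathfrak{R}$ by $f(\phi)(\alpha)=\phi(f(\alpha))$ for $\phi\in\mathfrak{R}$, $\alpha\in\pi$. This descends to an action of $\mathrm{Out}(\pi)$, and hence of $\mathrm{Mod}(S)$, on $\mathfrak{X}$ by algebraic automorphisms. $\mathrm{e}_{\mathrm{alg}}(f)$ is the algebraic entropy of the automorphism of $\mathfrak{X}$ induced by $f$. **Algebraic entropy.** The degree of a morphism $\mathbb{A}^N\to\mathbb{A}^M$ is the maximal degree of its coordinate polynomials. For a subvariety $V\subset\mathbb{A}^N$ and a morphism $h:\mathbb{A}^N\to\mathbb{A}^M$, put $\deg(h;V)=\min\{\deg(g) : g:\mathbb{A}^N\to\mathbb{A}^M \text{ a morphism with } g|_V=h|_V\}$. For $h:\mathbb{A}^N\to\mathbb{A}^N$ put $\mathrm{e}_{\mathrm{alg}}(h;V)=\limsup_{n\to\infty}\frac1n\log\deg(h^{\circ n};V)$. For an affine variety $V$ and a morphism $f:V\to V$,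 choose an affine (closed) embedding $\iota:V\to\mathbb{A}^N$ and a morphism $g:\mathbb{A}^N\to\mathbb{A}^N$ with $g(\iota(V))=\iota(V)$ and $g\circ\iota=\iota\circ f$, and define $\mathrm{e}_{\mathrm{alg}}(f)=\mathrm{e}_{\mathrm{alg}}(g;\iota(V))$; this is independent of the choices.
   Formalization: For SL_N(K), GL_N(K) and U_N the formal theorem requires N ≥ 2: for N = 1 the claim fails, since SL_1 is trivial and GL_1, U_1 see only homology (a pseudo-Anosov f acting trivially on homology has entropy 0 but positive spectral radius). *)

(* Defs.v *)
From HB Require Import structures.
From mathcomp Require Import all_boot all_order all_algebra generic_quotient.
From mathcomp Require Import complex ring lra.
From mathcomp Require Import all_classical all_reals all_analysis.
(* The notations of mpoly clash with those of mathcomp-analysis. *)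
From mathcomp Require Import -(notations) mpoly.
Set Implicit Arguments.
Unset Strict Implicit.
Unset Printing Implicit Defensive.

Import Order.TTheory GRing.Theory Num.Theory.
Import numFieldTopology.Exports numFieldNormedType.Exports.

Local Open Scope classical_set_scope.
Local Open Scope ring_scope.


Lemma within_comp {A U T : topologicalType} (B : set A) (C : set U)
    (h : A -> U) (g : U -> T) :
    {within B, continuous h} -> {homo h : x / B x >-> C x} ->
    {within C, continuous g} -> {within B, continuous (fun x => g (h x))}.
Proof.
move=> /subspace_continuousP ch hBC /subspace_continuousP cg.
apply/subspace_continuousP => x Bx W /(cg _ (hBC _ Bx)) gW.
move: (ch _ Bx _ gW); apply: (@filterS _ (nbhs x)) => y hW By.
by apply: hW => //; exact: hBC.
Qed.

Lemma within_if {A T : topologicalType} (B C D : set A) (b : A -> bool)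
    (f g : A -> T) : closed C -> closed D -> B = C `|` D ->
    {in C, forall x, b x} -> {in D, forall x, b x -> f x = g x} ->
    {within C, continuous f} -> {within D, continuous g} ->
    {within B, continuous (fun x => if b x then f x else g x)}.
Proof.
move=> cC cD -> bC fg cf cg; apply: withinU_continuous => //.
- by apply: subspace_eq_continuous cf => x /bC bx /=; rewrite /from_subspace bx.
- apply: subspace_eq_continuous cg => x /fg xfg /=; rewrite /from_subspace.
  by case: ifP => // /xfg.
Qed.

(* Only the values of a loop on [0, 1] matter: loops that agree there are
   homotopic. *)
Record loop (R : realType) (T : topologicalType) (p : T) := Loop {
  loop_fun :> R -> T;
  loop_continuous : {within `[0, 1], continuous loop_fun};
  loop_start : loop_fun 0 = p;
  loop_end : loop_fun 1 = p }.

Definition homotopic (R : realType) (T : topologicalType) (p : T)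
    (c d : loop R p) : Prop :=
  exists H : R * R -> T,
    [/\ {within `[0, 1] `*` `[0, 1], continuous H},
        forall t : R, t \in `[0, 1] -> H (0, t) = c t,
        forall t : R, t \in `[0, 1] -> H (1, t) = d t &
        forall s : R, s \in `[0, 1] -> H (s, 0) = p /\ H (s, 1) = p].

Section LoopHomotopy.
Context {R : realType} {T : topologicalType} (p : T).
Implicit Types c d e : loop R p.

Local Notation I01 := (`[0, 1]%classic : set R).

Lemma homotopic_eqfun c d : {in `[0, 1], c =1 d} -> homotopic c d.
Proof.
move=> cd; exists (fun z => c z.2); split=> //=.
- apply: (@within_comp _ _ _ _ I01 snd c).
  + by apply: continuous_subspaceT => z; exact: cvg_snd.
  + by move=> z [].
  + exact: loop_continuous.
- by move=> s _; rewrite loop_start loop_end.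
Qed.

Lemma homotopic_refl c : homotopic c c.
Proof. exact: homotopic_eqfun. Qed.

Lemma homotopic_sym c d : homotopic c d -> homotopic d c.
Proof.
move=> [H [cH H0 H1 Hp]]; exists (fun z : R * R => H (1 - z.1, z.2)); split=> /=.
- apply: (@within_comp _ _ _ _ (I01 `*` I01) (fun z : R * R => (1 - z.1, z.2)) H) => //.
  + apply: continuous_subspaceT => z.
    apply: (@cvg_pair _ _ _ _ (nbhs (1 - z.1)) (nbhs z.2)); last exact: cvg_snd.
    by apply: cvgB; [exact: cvg_cst | exact: cvg_fst].
  + move=> z [/=]; rewrite !in_itv/= => /andP[? ?] ?; split => //=.
    by rewrite ?in_itv/=; lra.
- by move=> t t01; rewrite subr0 H1.
- by move=> t t01; rewrite subrr H0.
- by move=> s; rewrite in_itv/= => s01; apply: Hp; rewrite ?in_itv/=; lra.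
Qed.

Lemma closed_I01 (a b : R) : closed `[a, b]%classic.
Proof. exact: itv_closed. Qed.

Lemma closed_rect (A B : set R) : closed A -> closed B -> closed (A `*` B).
Proof.
move=> cA cB; apply: (@closedI _ (fst @^-1` A) (snd @^-1` B)).
- by apply: preimage_closed cA => z _; exact: cvg_fst.
- by apply: preimage_closed cB => z _; exact: cvg_snd.
Qed.

Lemma I01_split : I01 = `[0, 2^-1] `|` `[2^-1, 1].
Proof.
apply/seteqP; split=> t /=; rewrite !in_itv/=.
  by move=> ?; case: (leP t 2^-1) => ?; [left | right]; lra.
by case=> ?; lra.
Qed.

Lemma rect_splitl : I01 `*` I01 = `[0, 2^-1] `*` I01 `|` `[2^-1, 1] `*` I01.
Proof.
apply/seteqP; split=> [z [z1 z2]|z [] [z1 z2]].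
- have [z1'|z1'] : (`[0, 2^-1] `|` `[2^-1, 1]) z.1 by rewrite -I01_split.
    by left.
  by right.
- by split=> //; rewrite I01_split; left.
- by split=> //; rewrite I01_split; right.
Qed.

Lemma rect_splitr : I01 `*` I01 = I01 `*` `[0, 2^-1] `|` I01 `*` `[2^-1, 1].
Proof.
apply/seteqP; split=> [z [z1 z2]|z [] [z1 z2]].
- have [z2'|z2'] : (`[0, 2^-1] `|` `[2^-1, 1]) z.2 by rewrite -I01_split.
    by left.
  by right.
- by split=> //; rewrite I01_split; left.
- by split=> //; rewrite I01_split; right.
Qed.

Lemma homotopic_trans c d e : homotopic c d -> homotopic d e -> homotopic c e.
Proof.
move=> [H [cH H0 H1 Hp]] [K [cK K0 K1 Kp]].
exists (fun z => if z.1 <= 2^-1 then H (2 * z.1, z.2)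
                 else K (2 * z.1 - 1, z.2)); split=> /=.
- apply: (@within_if _ _ (I01 `*` I01) (`[0, 2^-1] `*` I01) (`[2^-1, 1] `*` I01)
    (fun z : R * R => z.1 <= 2^-1) (fun z : R * R => H (2 * z.1, z.2))
    (fun z : R * R => K (2 * z.1 - 1, z.2))).
  + by apply: closed_rect; exact: closed_I01.
  + by apply: closed_rect; exact: closed_I01.
  + exact: rect_splitl.
  + by move=> z; rewrite inE /= in_itv/= => -[/andP[]].
  + move=> z; rewrite inE /= !in_itv/= => -[z1 z2] z3.
    have -> : z.1 = 2^-1 by lra.
    by rewrite divff// subrr H1 ?in_itv// K0 ?in_itv.
  + apply: (@within_comp _ _ _ _ (I01 `*` I01) (fun z : R * R => (2 * z.1, z.2)) H) => //.
      apply: continuous_subspaceT => z.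
      apply: (@cvg_pair _ _ _ _ (nbhs (2 * z.1)) (nbhs z.2)); last exact: cvg_snd.
      by apply: cvgM; [exact: cvg_cst | exact: cvg_fst].
    by move=> z [/=]; rewrite !in_itv/= => ? ?; split => //=; rewrite ?in_itv/=; lra.
  + apply: (@within_comp _ _ _ _ (I01 `*` I01) (fun z : R * R => (2 * z.1 - 1, z.2)) K) => //.
      apply: continuous_subspaceT => z.
      apply: (@cvg_pair _ _ _ _ (nbhs (2 * z.1 - 1)) (nbhs z.2)); last exact: cvg_snd.
      apply: cvgB; last exact: cvg_cst.
      by apply: cvgM; [exact: cvg_cst | exact: cvg_fst].
    by move=> z [/=]; rewrite !in_itv/= => ? ?; split => //=; rewrite ?in_itv/=; lra.
- by move=> t t01; rewrite invr_ge0 ler0n mulr0 H0.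
- move=> t t01; have /negbTE -> : ~~ (1 <= 2^-1 :> R) by lra.
  have -> : 2 * 1 - 1 = 1 :> R by lra.
  by rewrite K1.
- move=> s; rewrite in_itv/= => s01; case: ifP => s2.
    by apply: Hp; rewrite ?in_itv/=; lra.
  by apply: Kp; rewrite in_itv/=; move/negbT: s2; rewrite -ltNge; lra.
Qed.

Lemma const_continuous : {within I01, continuous (fun _ : R => p)}.
Proof. by apply: continuous_subspaceT => x; exact: cvg_cst. Qed.

Definition const_loop : loop R p := Loop const_continuous erefl erefl.

Section Concat.
Variables c d : loop R p.

Let concat_fun (t : R) := if t <= 2^-1 then c (2 * t) else d (2 * t - 1).

Lemma concat_continuous : {within I01, continuous concat_fun}.
Proof.
apply: (@within_if _ _ I01 `[0, 2^-1] `[2^-1, 1] (fun t : R => t <= 2^-1)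
  (fun t : R => c (2 * t)) (fun t : R => d (2 * t - 1))).
- exact: closed_I01.
- exact: closed_I01.
- exact: I01_split.
- by move=> t; rewrite inE/= in_itv/= => /andP[].
- move=> t; rewrite inE/= in_itv/= => ? ?; have -> : t = 2^-1 by lra.
  by rewrite divff// subrr loop_start loop_end.
- apply: (@within_comp _ _ _ _ I01 (fun t : R => 2 * t) c).
  + apply: continuous_subspaceT => t.
    by apply: cvgM; [exact: cvg_cst | exact: cvg_id].
  + by move=> t /=; rewrite !in_itv/=; lra.
  + exact: loop_continuous.
- apply: (@within_comp _ _ _ _ I01 (fun t : R => 2 * t - 1) d).
  + apply: continuous_subspaceT => t.
    apply: cvgB; last exact: cvg_cst.
    by apply: cvgM; [exact: cvg_cst | exact: cvg_id].
  + by move=> t /=; rewrite !in_itv/=; lra.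
  + exact: loop_continuous.
Qed.

Lemma concat_start : concat_fun 0 = p.
Proof. by rewrite /concat_fun invr_ge0 ler0n mulr0 loop_start. Qed.

Lemma concat_end : concat_fun 1 = p.
Proof.
rewrite /concat_fun; have /negbTE -> : ~~ (1 <= 2^-1 :> R) by lra.
have -> : 2 * 1 - 1 = 1 :> R by lra.
by rewrite loop_end.
Qed.

Definition concat_loop : loop R p :=
  Loop concat_continuous concat_start concat_end.

End Concat.

Section Reparam.
Variables (c : loop R p) (s : R -> R).
Hypotheses (cs : continuous s) (s01 : {homo s : t / I01 t}).
Hypotheses (s0 : c (s 0) = p) (s1 : c (s 1) = p).

Lemma reparam_continuous : {within I01, continuous (fun t : R => c (s t))}.
Proof.
apply: (@within_comp _ _ _ _ I01 s c) => //; last exact: loop_continuous.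
exact: continuous_subspaceT.
Qed.

Definition reparam_loop : loop R p := Loop reparam_continuous s0 s1.

End Reparam.

Lemma reparam_homotopic c s r (cs : continuous s) (cr : continuous r)
    (s01 : {homo s : t / I01 t}) (r01 : {homo r : t / I01 t}) s0 s1 r0 r1 :
  s 0 = r 0 -> s 1 = r 1 ->
  homotopic (@reparam_loop c s cs s01 s0 s1) (@reparam_loop c r cr r01 r0 r1).
Proof.
move=> sr0 sr1; exists (fun z => c ((1 - z.1) * s z.2 + z.1 * r z.2)); split=> /=.
- apply: (@within_comp _ _ _ _ I01
    (fun z : R * R => (1 - z.1) * s z.2 + z.1 * r z.2) c); last exact: loop_continuous.
  + apply: continuous_subspaceT => z.
    have k1 : (fun x : R * R => x.1) @ z --> z.1 by exact: cvg_fst.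
    have k2 : (fun x : R * R => x.2) @ z --> z.2 by exact: cvg_snd.
    apply: cvgD; apply: cvgM => //.
    * by apply: cvgB => //; exact: cvg_cst.
    * by apply: (@continuous_comp _ _ _ snd s) => //; exact: cs.
    * by apply: (@continuous_comp _ _ _ snd r) => //; exact: cr.
  + move=> [u t] [/= u01 /[dup] /s01 + /r01].
    move: u01; rewrite /= !in_itv/=; move: (s t) (r t) => a b.
    by nra.
- by move=> t _; rewrite subr0 mul1r mul0r addr0.
- by move=> t _; rewrite subrr mul1r mul0r add0r.
- move=> u _; rewrite -sr0 -sr1 -!mulrDl subrK !mul1r; split.
    exact: s0.
  exact: s1.
Qed.

Lemma homotopic_reparam c d e s r : continuous s -> continuous r ->
  {homo s : t / I01 t} -> {homo r : t / I01 t} ->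
  {in `[0, 1], forall t, c t = e (s t)} ->
  {in `[0, 1], forall t, d t = e (r t)} ->
  s 0 = r 0 -> s 1 = r 1 -> homotopic c d.
Proof.
move=> cs cr s01 r01 ce de sr0 sr1.
have i0 : (0 : R) \in `[0, 1] by rewrite in_itv/= lexx ler01.
have i1 : (1 : R) \in `[0, 1] by rewrite in_itv/= lexx ler01.
have s0 : e (s 0) = p by rewrite -ce// loop_start.
have s1 : e (s 1) = p by rewrite -ce// loop_end.
have r0 : e (r 0) = p by rewrite -de// loop_start.
have r1 : e (r 1) = p by rewrite -de// loop_end.
apply: (@homotopic_trans _ (reparam_loop cs s01 s0 s1)).
  exact: homotopic_eqfun.
apply: (@homotopic_trans _ (reparam_loop cr r01 r0 r1)).
  exact: reparam_homotopic.
by apply: homotopic_eqfun => t t01; rewrite /= de.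
Qed.

Lemma rev_cont : continuous (fun t : R => 1 - t).
Proof. by move=> t; apply: cvgB; [exact: cvg_cst | exact: cvg_id]. Qed.

Lemma rev01 : {homo (fun t : R => 1 - t) : t / I01 t}.
Proof. by move=> t; rewrite /= !in_itv/=; lra. Qed.

Lemma rev_start c : c (1 - 0) = p. Proof. by rewrite subr0 loop_end. Qed.
Lemma rev_end c : c (1 - 1) = p. Proof. by rewrite subrr loop_start. Qed.

Definition rev_loop c : loop R p :=
  reparam_loop rev_cont rev01 (rev_start c) (rev_end c).

Lemma concat_homotopic c c' d d' : homotopic c c' -> homotopic d d' ->
  homotopic (concat_loop c d) (concat_loop c' d').
Proof.
move=> [H [cH H0 H1 Hp]] [K [cK K0 K1 Kp]].
exists (fun z => if z.2 <= 2^-1 then H (z.1, 2 * z.2)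
                 else K (z.1, 2 * z.2 - 1)); split=> /=.
- apply: (@within_if _ _ (I01 `*` I01) (I01 `*` `[0, 2^-1]) (I01 `*` `[2^-1, 1])
    (fun z : R * R => z.2 <= 2^-1) (fun z : R * R => H (z.1, 2 * z.2))
    (fun z : R * R => K (z.1, 2 * z.2 - 1))).
  + by apply: closed_rect; exact: closed_I01.
  + by apply: closed_rect; exact: closed_I01.
  + exact: rect_splitr.
  + by move=> z; rewrite inE /= => -[_]; rewrite in_itv/= => /andP[].
  + move=> z; rewrite inE /= => -[z1]; rewrite in_itv/= => z2 z3.
    have -> : z.2 = 2^-1 by lra.
    by rewrite divff// subrr (Hp _ _).2// (Kp _ _).1.
  + apply: (@within_comp _ _ _ _ (I01 `*` I01) (fun z : R * R => (z.1, 2 * z.2)) H) => //.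
      apply: continuous_subspaceT => z.
      apply: (@cvg_pair _ _ _ _ (nbhs z.1) (nbhs (2 * z.2))); first exact: cvg_fst.
      by apply: cvgM; [exact: cvg_cst | exact: cvg_snd].
    by move=> z [/=]; rewrite !in_itv/= => ? ?; split => //=; rewrite ?in_itv/=; lra.
  + apply: (@within_comp _ _ _ _ (I01 `*` I01) (fun z : R * R => (z.1, 2 * z.2 - 1)) K) => //.
      apply: continuous_subspaceT => z.
      apply: (@cvg_pair _ _ _ _ (nbhs z.1) (nbhs (2 * z.2 - 1))); first exact: cvg_fst.
      apply: cvgB; last exact: cvg_cst.
      by apply: cvgM; [exact: cvg_cst | exact: cvg_snd].
    by move=> z [/=]; rewrite !in_itv/= => ? ?; split => //=; rewrite ?in_itv/=; lra.
- move=> t; rewrite in_itv/= => t01; case: ifPn => t2.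
    by rewrite H0// in_itv/=; lra.
  by rewrite K0// in_itv/=; move: t2; rewrite -ltNge; lra.
- move=> t; rewrite in_itv/= => t01; case: ifPn => t2.
    by rewrite H1// in_itv/=; lra.
  by rewrite K1// in_itv/=; move: t2; rewrite -ltNge; lra.
- move=> s s01; rewrite invr_ge0 ler0n mulr0; split; first exact: (Hp _ s01).1.
  have /negbTE -> : ~~ (1 <= 2^-1 :> R) by lra.
  have -> : 2 * 1 - 1 = 1 :> R by lra.
  exact: (Kp _ s01).2.
Qed.

Lemma rev_homotopic c c' : homotopic c c' -> homotopic (rev_loop c) (rev_loop c').
Proof.
move=> [H [cH H0 H1 Hp]]; exists (fun z : R * R => H (z.1, 1 - z.2)); split=> /=.
- apply: (@within_comp _ _ _ _ (I01 `*` I01) (fun z : R * R => (z.1, 1 - z.2)) H) => //.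
  + apply: continuous_subspaceT => z.
    apply: (@cvg_pair _ _ _ _ (nbhs z.1) (nbhs (1 - z.2))); first exact: cvg_fst.
    by apply: cvgB; [exact: cvg_cst | exact: cvg_snd].
  + by move=> z [/=]; rewrite !in_itv/= => ? ?; split => //=; rewrite ?in_itv/=; lra.
- by move=> t; rewrite in_itv/= => t01; rewrite H0// in_itv/=; lra.
- by move=> t; rewrite in_itv/= => t01; rewrite H1// in_itv/=; lra.
- by move=> s /Hp[]; rewrite subr0 subrr.
Qed.

Let cont_aff (a b : R) : continuous (fun t : R => a * t + b).
Proof.
move=> t; apply: cvgD; last exact: cvg_cst.
by apply: cvgM; [exact: cvg_cst | exact: cvg_id].
Qed.

Let cont_min (f g : R -> R) : continuous f -> continuous g ->
  continuous (fun t : R => Num.min (f t) (g t)).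
Proof. by move=> cf cg t; exact: (continuous_min (cf t) (cg t)). Qed.

Let cont_max (f g : R -> R) : continuous f -> continuous g ->
  continuous (fun t : R => Num.max (f t) (g t)).
Proof. by move=> cf cg t; exact: (continuous_max (cf t) (cg t)). Qed.

Lemma concatA c d e :
  homotopic (concat_loop c (concat_loop d e)) (concat_loop (concat_loop c d) e).
Proof.
apply: homotopic_sym.
apply: (@homotopic_reparam _ _ (concat_loop c (concat_loop d e))
  (fun t : R => Num.min (Num.min (2 * t + 0) (1 * t + 4^-1)) (2^-1 * t + 2^-1))
  (fun t : R => 1 * t + 0)).
- by apply: cont_min; [apply: cont_min|]; exact: cont_aff.
- exact: cont_aff.
- move=> t /=; rewrite !in_itv/= le_min ge_min le_min ge_min; lra.
- by move=> t /=; rewrite mul1r addr0.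
- move=> t; rewrite in_itv/= => t01.
  have [t1|t1] := leP t 4^-1.
    have -> : Num.min (Num.min (2 * t + 0) (1 * t + 4^-1)) (2^-1 * t + 2^-1) = 2 * t.
      by rewrite !minEle; do ![case: ifPn => //]; rewrite ?(mul1r, addr0)//; lra.
    by do ![case: ifPn]; rewrite -?ltNge => *; try (exfalso; lra); congr (c _); lra.
  have [t2|t2] := leP t 2^-1.
    have -> : Num.min (Num.min (2 * t + 0) (1 * t + 4^-1)) (2^-1 * t + 2^-1) = t + 4^-1.
      rewrite !minEle; do ![case: ifPn]; rewrite -?ltNge => *; lra.
    do ![case: ifPn]; rewrite -?ltNge => *; try (exfalso; lra); congr (d _); lra.
  have -> : Num.min (Num.min (2 * t + 0) (1 * t + 4^-1)) (2^-1 * t + 2^-1) = 2^-1 * t + 2^-1.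
    rewrite !minEle; do ![case: ifPn]; rewrite -?ltNge => *; lra.
  do ![case: ifPn]; rewrite -?ltNge => *; try (exfalso; lra); congr (e _); lra.
- by move=> t _; rewrite mul1r addr0.
- rewrite !minEle; do ![case: ifPn]; rewrite -?ltNge => *; lra.
- rewrite !minEle; do ![case: ifPn]; rewrite -?ltNge => *; lra.
Qed.

Lemma concat1 c : homotopic (concat_loop c const_loop) c.
Proof.
apply: (@homotopic_reparam _ _ c (fun t : R => Num.min (2 * t + 0) 1)
  (fun t : R => 1 * t + 0)).
- by apply: cont_min; [exact: cont_aff | move=> t; exact: cvg_cst].
- exact: cont_aff.
- by move=> t /=; rewrite !in_itv/= le_min ge_min; lra.
- by move=> t /=; rewrite mul1r addr0.
- move=> t; rewrite in_itv/= => t01; case: ifPn; rewrite -?ltNge => t2.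
    by congr (c _); rewrite minEle; case: ifPn; rewrite -?ltNge => *; lra.
  rewrite (_ : Num.min _ _ = 1) ?loop_end//.
  by rewrite minEle; case: ifPn; rewrite -?ltNge => *; lra.
- by move=> t _; rewrite mul1r addr0.
- rewrite !minEle; do ![case: ifPn]; rewrite -?ltNge => *; lra.
- rewrite !minEle; do ![case: ifPn]; rewrite -?ltNge => *; lra.
Qed.

Lemma concat1l c : homotopic (concat_loop const_loop c) c.
Proof.
apply: (@homotopic_reparam _ _ c (fun t : R => Num.max (2 * t + -1) 0)
  (fun t : R => 1 * t + 0)).
- by apply: cont_max; [exact: cont_aff | move=> t; exact: cvg_cst].
- exact: cont_aff.
- by move=> t /=; rewrite !in_itv/= le_max ge_max; lra.
- by move=> t /=; rewrite mul1r addr0.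
- move=> t; rewrite in_itv/= => t01; case: ifPn; rewrite -?ltNge => t2.
    rewrite (_ : Num.max _ _ = 0) ?loop_start//.
    by rewrite maxEle; case: ifPn; rewrite -?ltNge => *; lra.
  by congr (c _); rewrite maxEle; case: ifPn; rewrite -?ltNge => *; lra.
- by move=> t _; rewrite mul1r addr0.
- rewrite !maxEle; do ![case: ifPn]; rewrite -?ltNge => *; lra.
- rewrite !maxEle; do ![case: ifPn]; rewrite -?ltNge => *; lra.
Qed.

Lemma concatV c : homotopic (concat_loop c (rev_loop c)) const_loop.
Proof.
apply: (@homotopic_reparam _ _ c (fun t : R => Num.min (2 * t + 0) (-2 * t + 2))
  (fun t : R => 0 * t + 0)).
- by apply: cont_min; exact: cont_aff.
- exact: cont_aff.
- by move=> t /=; rewrite !in_itv/= le_min ge_min; lra.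
- by move=> t /=; rewrite mul0r addr0 !in_itv/= lexx ler01.
- move=> t; rewrite in_itv/= => t01; case: ifPn; rewrite -?ltNge => t2;
  by congr (c _); rewrite minEle; case: ifPn; rewrite -?ltNge => *; lra.
- by move=> t _; rewrite mul0r addr0 loop_start.
- rewrite !minEle; do ![case: ifPn]; rewrite -?ltNge => *; lra.
- rewrite !minEle; do ![case: ifPn]; rewrite -?ltNge => *; lra.
Qed.

Lemma concatVl c : homotopic (concat_loop (rev_loop c) c) const_loop.
Proof.
apply: (@homotopic_reparam _ _ c (fun t : R => Num.max (-2 * t + 1) (2 * t + -1))
  (fun t : R => 0 * t + 1)).
- by apply: cont_max; exact: cont_aff.
- exact: cont_aff.
- by move=> t /=; rewrite !in_itv/= le_max ge_max; lra.
- by move=> t /=; rewrite mul0r add0r !in_itv/= lexx ler01.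
- move=> t; rewrite in_itv/= => t01; case: ifPn; rewrite -?ltNge => t2;
  by congr (c _); rewrite maxEle; case: ifPn; rewrite -?ltNge => *; lra.
- by move=> t _; rewrite mul0r add0r loop_end.
- rewrite !maxEle; do ![case: ifPn]; rewrite -?ltNge => *; lra.
- rewrite !maxEle; do ![case: ifPn]; rewrite -?ltNge => *; lra.
Qed.

End LoopHomotopy.

HB.instance Definition _ (R : realType) (T : topologicalType) (p : T) :=
  gen_eqMixin (loop R p).
HB.instance Definition _ (R : realType) (T : topologicalType) (p : T) :=
  gen_choiceMixin (loop R p).

Section FundamentalGroup.
Context (R : realType) (T : topologicalType) (p : T).

Definition homotopicb (c d : loop R p) : bool := `[< homotopic c d >].

Lemma homotopicb_equiv : equiv_class_of homotopicb.
Proof.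
split=> [c|c d|d c e].
- exact/asboolP/homotopic_refl.
- by apply/asboolP/asboolP => /homotopic_sym.
- by move=> /asboolP cd /asboolP de; apply/asboolP/(homotopic_trans cd).
Qed.

Canonical homotopicb_equivRel := EquivRelPack homotopicb_equiv.

Definition pi1 := {eq_quot homotopicb}%qT.
HB.instance Definition _ := Choice.on pi1.
HB.instance Definition _ := Quotient.on pi1.
HB.instance Definition _ : EqQuotient _ homotopicb pi1 := EqQuotient.on pi1.

Definition pi1_class (c : loop R p) : pi1 := \pi_pi1%qT c.

Lemma pi1_classP c d : pi1_class c = pi1_class d <-> homotopic c d.
Proof. by rewrite /pi1_class; split=> [/eqmodP/asboolP//|?]; apply/eqmodP/asboolP. Qed.

Lemma repr_class c : homotopic (repr (pi1_class c)) c.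
Proof. by apply/pi1_classP; rewrite /pi1_class reprK. Qed.

Definition pi1_mul (a b : pi1) := pi1_class (concat_loop (repr a) (repr b)).
Definition pi1_inv (a : pi1) := pi1_class (rev_loop (repr a)).
Definition pi1_one := pi1_class (const_loop p).

Lemma pi1_mul_class c d :
  pi1_mul (pi1_class c) (pi1_class d) = pi1_class (concat_loop c d).
Proof. by apply/pi1_classP/concat_homotopic; exact: repr_class. Qed.

Lemma pi1_inv_class c : pi1_inv (pi1_class c) = pi1_class (rev_loop c).
Proof. by apply/pi1_classP/rev_homotopic; exact: repr_class. Qed.

Lemma pi1_ind (P : pi1 -> Prop) : (forall c, P (pi1_class c)) -> forall a, P a.
Proof. by move=> Pc a; rewrite -(reprK a); exact: Pc. Qed.

Lemma pi1_mulA : associative pi1_mul.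
Proof.
elim/pi1_ind => c; elim/pi1_ind => d; elim/pi1_ind => e.
by rewrite !pi1_mul_class; apply/pi1_classP/concatA.
Qed.

Lemma pi1_mul1 : right_id pi1_one pi1_mul.
Proof.
by elim/pi1_ind => c; rewrite pi1_mul_class; apply/pi1_classP/concat1.
Qed.

Lemma pi1_1mul : left_id pi1_one pi1_mul.
Proof.
by elim/pi1_ind => c; rewrite pi1_mul_class; apply/pi1_classP/concat1l.
Qed.

Lemma pi1_mulV : right_inverse pi1_one pi1_inv pi1_mul.
Proof.
elim/pi1_ind => c; rewrite pi1_inv_class pi1_mul_class.
exact/pi1_classP/concatV.
Qed.

Lemma pi1_Vmul : left_inverse pi1_one pi1_inv pi1_mul.
Proof.
elim/pi1_ind => c; rewrite pi1_inv_class pi1_mul_class.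
exact/pi1_classP/concatVl.
Qed.

HB.instance Definition _ := isGroup.Build pi1
  pi1_mulA pi1_1mul pi1_mul1 pi1_Vmul pi1_mulV.

Lemma pi1_mulE c d :
  (pi1_class c * pi1_class d)%g = pi1_class (concat_loop c d).
Proof. exact: pi1_mul_class. Qed.

End FundamentalGroup.

Section Pi1Functor.
Context (R : realType) (T : topologicalType) (p : T) (f : T -> T).
Hypotheses (cf : continuous f) (fp : f p = p).

Section Map.
Variable c : loop R p.
Lemma map_loop_continuous : {within `[0, 1], continuous (fun t : R => f (c t))}.
Proof.
apply: (@within_comp _ _ _ _ setT c f) => //; first exact: loop_continuous.
exact: continuous_subspaceT.
Qed.
Lemma map_loop_start : f (c 0) = p. Proof. by rewrite loop_start. Qed.
Lemma map_loop_end : f (c 1) = p. Proof. by rewrite loop_end. Qed.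
Definition map_loop := Loop map_loop_continuous map_loop_start map_loop_end.
End Map.

Lemma map_loop_homotopic c d : homotopic c d -> homotopic (map_loop c) (map_loop d).
Proof.
move=> [H [cH H0 H1 Hp]]; exists (fun z => f (H z)); split=> /=.
- apply: (@within_comp _ _ _ _ setT H f) => //.
  exact: continuous_subspaceT.
- by move=> t /H0 ->.
- by move=> t /H1 ->.
- by move=> s /Hp[-> ->].
Qed.

Definition pi1_map (a : pi1 R p) : pi1 R p := pi1_class (map_loop (repr a)).

Lemma pi1_map_class c : pi1_map (pi1_class c) = pi1_class (map_loop c).
Proof. by apply/pi1_classP/map_loop_homotopic; exact: repr_class. Qed.

Lemma pi1_mapM : {morph pi1_map : a b / (a * b)%g}.
Proof.
elim/pi1_ind => c; elim/pi1_ind => d.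
rewrite pi1_mulE !pi1_map_class pi1_mulE.
by apply/pi1_classP/homotopic_eqfun => t _ /=; case: ifP.
Qed.

HB.instance Definition _ := isMultiplicative.Build _ _ pi1_map pi1_mapM.

End Pi1Functor.

(* Smooth maps between Euclidean spaces, on open sets and then on arbitrary sets
   (by local extension), as needed for charts with values in a half-plane. *)
Section Smoothness.
Context {R : realType} {m n : nat}.
Implicit Types (A U : set 'rV[R]_m) (F E : 'rV[R]_m -> 'rV[R]_n).

Fixpoint Ck (k : nat) U F : Prop :=
  match k with
  | 0 => forall z, U z -> {for z, continuous F}
  | k.+1 => forall v, (forall z, U z -> derivable F z v) /\
                      Ck k U (fun z => 'D_v F z)
  end.

Definition smooth_extension A F z U E : Prop :=
  [/\ open U, U z, forall k, Ck k U E & forall w, A w -> U w -> E w = F w].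

Definition smooth_on A F : Prop :=
  forall z, A z -> exists U E, smooth_extension A F z U E.

End Smoothness.

(* On a relatively open subset of the half-plane the jacobian does not depend on
   the extension E, including at boundary points. *)
Definition oriented_smooth_on (R : realType) (n : nat) (A : set 'rV[R]_n)
    (F : 'rV[R]_n -> 'rV[R]_n) : Prop :=
  forall z, A z -> exists U E,
    smooth_extension A F z U E /\ 0 < \det (jacobian E z).

Definition half_plane (R : realType) : set 'rV[R]_2 :=
  [set z | 0 <= z 0 1].

(* Compact connected oriented smooth surfaces with boundary. The maps coord i and
   param i are only meaningful on chart_dom i and on its image; the orientation
   is carried by the atlas. *)
Record surface (R : realType) := Surface {
  carrier :> topologicalType;
  surface_hausdorff : hausdorff_space carrier;
  surface_compact : compact [set: carrier];
  surface_connected : connected [set: carrier];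
  chart : Type;
  chart_dom : chart -> set carrier;
  coord : chart -> carrier -> 'rV[R]_2;
  param : chart -> 'rV[R]_2 -> carrier;
  chart_dom_open : forall i, open (chart_dom i);
  chart_cover : forall p, exists i, chart_dom i p;
  coord_open : forall i, exists2 U : set 'rV[R]_2, open U &
    coord i @` chart_dom i = U `&` @half_plane R;
  coordK : forall i, {in chart_dom i, cancel (coord i) (param i)};
  coord_continuous : forall i, {within chart_dom i, continuous (coord i)};
  param_continuous : forall i,
    {within coord i @` chart_dom i, continuous (param i)};
  transition_smooth : forall i j,
    oriented_smooth_on (coord i @` (chart_dom i `&` chart_dom j))
      (coord j \o param i) }.

Arguments param {R s} i z.
Arguments coord {R s} i p.
Arguments chart_dom {R s} i.

Section MappingClassGroup.
Context {R : realType} (S : surface R).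

Definition boundary : set S :=
  [set p | exists2 i : chart S, chart_dom i p & coord i p 0 1 = 0].

Record diffeo := Diffeo {
  diffeo_fun :> S -> S;
  diffeo_inv : S -> S;
  diffeoK : cancel diffeo_fun diffeo_inv;
  diffeoKV : cancel diffeo_inv diffeo_fun;
  diffeo_continuous : continuous diffeo_fun;
  diffeo_inv_continuous : continuous diffeo_inv;
  diffeo_smooth : forall i j : chart S,
    oriented_smooth_on
      (coord i @` (chart_dom i `&` diffeo_fun @^-1` chart_dom j))
      (coord j \o diffeo_fun \o param i);
  diffeo_inv_smooth : forall i j : chart S,
    smooth_on (coord i @` (chart_dom i `&` diffeo_inv @^-1` chart_dom j))
      (coord j \o diffeo_inv \o param i);
  diffeo_boundary : forall p, boundary p -> diffeo_fun p = p }.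

(* Smooth isotopy through elements of Diff^+(S): the relation of lying in the same
   path component of Diff^+(S). Only H t with t in [0, 1] matters; the coordinates
   of [0, 1] x S are row vectors (t, z) in R^(1+2). *)
Definition isotopic (f g : diffeo) : Prop :=
  exists H : R -> diffeo,
    [/\ H 0 =1 f, H 1 =1 g,
        {within `[0, 1] `*` setT, continuous (fun z : R * S => H z.1 z.2)} &
        forall i j : chart S,
          smooth_on
            [set v : 'rV[R]_(1 + 2) | exists t p,
               [/\ t \in `[0, 1], chart_dom i p, chart_dom j (H t p) &
                   v = row_mx t%:M (coord i p)]]
            (fun v => coord j (H (lsubmx v 0 0) (param i (rsubmx v))))].

(* Elements of pi_0(Diff^+(S)). *)
Record mapping_class := MappingClass {
  mapping_class_set : set diffeo;
  mapping_classP : exists f, mapping_class_set = [set g | isotopic f g] }.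

Lemma diffeo_base (p : S) (bp : boundary p) (f : diffeo) : f p = p.
Proof. exact: diffeo_boundary. Qed.

Definition diffeo_pi1 (p : S) (bp : boundary p) (f : diffeo) :
    {multiplicative pi1 R p -> pi1 R p} :=
  pi1_map (@diffeo_continuous f) (diffeo_base bp f).

Lemma isotopic_pi1 (p : S) (bp : boundary p) (f g : diffeo) :
  isotopic f g -> diffeo_pi1 bp f =1 diffeo_pi1 bp g.
Proof.
move=> [H [H0 H1 cH _]]; elim/pi1_ind => c.
rewrite /diffeo_pi1 /= !pi1_map_class; apply/pi1_classP.
exists (fun z => H z.1 (c z.2)); split=> /=.
- have := @within_comp (R * R)%type (R * S)%type S
    (`[0, 1] `*` `[0, 1]) (`[0, 1] `*` setT)
    (fun z : R * R => (z.1, c z.2)) (fun z : R * S => H z.1 z.2).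
  apply=> //.
  + apply/subspace_continuousP => -[s t] /= [s01 t01].
    apply: (@cvg_pair _ _ _ _ (nbhs s) (nbhs (c t))).
      by apply: cvg_within_filter; exact: cvg_fst.
    have /subspace_continuousP/(_ _ t01) := @loop_continuous _ _ _ c.
    move=> ct W /ct cW.
    have h2 : (fun z : R * R => z.2) @ (s, t) --> t by exact: cvg_snd.
    move: (h2 _ cW).
    by apply: (@filterS _ (nbhs (s, t))) => -[s' t'] /= h [_]; exact: h.
  + by move=> z [].
- by move=> t _; exact: H0.
- by move=> t _; exact: H1.
- by move=> s _; rewrite loop_start loop_end; split; exact: diffeo_boundary.
Qed.

Definition mapping_class_pi1 (p : S) (bp : boundary p) (f : mapping_class) :
    {multiplicative pi1 R p -> pi1 R p} :=
  diffeo_pi1 bp (projT1 (cid (mapping_classP f))).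

Lemma mapping_class_pi1E (p : S) (bp : boundary p) (f : mapping_class) (h : diffeo) :
  mapping_class_set f h -> mapping_class_pi1 bp f =1 diffeo_pi1 bp h.
Proof.
rewrite /mapping_class_pi1; case: cid => g /= -> gh.
exact: isotopic_pi1.
Qed.

End MappingClassGroup.

(* (i, false) stands for x i and (i, true) for its inverse. *)
Section Words.
Context {gT : groupType} {I : finType}.
Implicit Types (x : I -> gT) (w : seq (I * bool)).

Definition letter x (l : I * bool) : gT := if l.2 then (x l.1)^-1%g else x l.1.

Definition word_eval x w : gT := (\prod_(l <- w) letter x l)%g.

Definition generates x : Prop := forall a, exists w, word_eval x w = a.

Definition reduced w : bool :=
  sorted (fun l l' : I * bool => ~~ ((l.1 == l'.1) && (l.2 != l'.2))) w.

Definition free_basis x : Prop :=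
  generates x /\ forall w, reduced w -> word_eval x w = 1%g -> w = [::].

End Words.

Definition boundary_components (R : realType) (S : surface R) (b : nat) : Prop :=
  exists c : 'I_b -> S,
    [/\ forall i, boundary (c i),
        forall i j, connected_component (@boundary R S) (c i) (c j) -> i = j &
        forall p, boundary p ->
          exists i, connected_component (@boundary R S) (c i) p].

(* For a compact connected oriented surface with nonempty boundary, the genus is
   determined by the Euler characteristic 2 - 2g - b, equivalently by the rank
   2g + b - 1 of its (free) fundamental group. *)
Definition surface_of_type (R : realType) (S : surface R) (g b : nat) : Prop :=
  boundary_components S b /\
  forall p : S, exists x : 'I_(2 * g + b).-1 -> pi1 R p, free_basis x.

(* The least element of P (and 0 if P is empty). *)
Definition least (P : set nat) : nat :=
  xget 0%N [set n | P n /\ forall m, P m -> (n <= m)%N].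

Definition cyclic_length (gT : groupType) (I : finType) (x : I -> gT) (a : gT) : nat :=
  least [set n | exists w c, size w = n /\ word_eval x w = (a ^ c)%g].

Local Open Scope ereal_scope.

(* limsup (1/n) log (u n), with log 0 = -oo; the junk factor 1/0 = 0 at n = 0 is
   irrelevant. *)
Definition growth_rate (R : realType) (u : nat -> nat) : \bar R :=
  limn_esup (fun n => (n%:R^-1)%:E * lne (u n)%:R%:E).

Definition spectral_radius (R : realType) (gT : groupType) (I : finType)
    (x : I -> gT) (f : gT -> gT) : \bar R :=
  ereal_sup [set growth_rate R (fun n => cyclic_length x (iter n f a))
            | a in [set: gT]].

Local Close Scope ereal_scope.

Section AffineSpace.
Context {F : fieldType}.

Definition poly_map (M N : nat) : Type := 'I_N -> mpoly.mpoly M F.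

Definition poly_map_fun {M N} (g : poly_map M N) (v : 'I_M -> F) : 'I_N -> F :=
  fun i => mpoly.meval v (g i).

Definition poly_degree {M N} (g : poly_map M N) : nat :=
  (\max_(i < N) (mpoly.msize (g i)).-1)%N.

(* deg(h; V): the least degree of a polynomial map that agrees with h on V. *)
Definition degree_on {M N} (h : ('I_M -> F) -> ('I_N -> F)) (V : set ('I_M -> F)) : nat :=
  least [set d | exists g : poly_map M N,
    poly_degree g = d /\ {in V, poly_map_fun g =1 h}].

Definition alg_entropy_on (R : realType) {N} (g : poly_map N N)
    (V : set ('I_N -> F)) : \bar R :=
  growth_rate R (fun n => degree_on (iter n (poly_map_fun g)) V).

End AffineSpace.

(* The affine variety with coordinate algebra A, in terms of its F-points. This
   loses nothing when the elements of A are separated by the F-points, as holds for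
   the algebras char_ring below, whose elements are functions on a set each point
   of which gives an F-point. *)
Section AffineVariety.
Context {F : fieldType} (A : comAlgType F).

Definition spec_point := {lrmorphism A -> F^o}.

(* u generates A, i.e. affine_embedding u is a closed embedding in A^N. *)
Definition algebra_generators N (u : 'I_N -> A) : Prop :=
  forall a, exists p : mpoly.mpoly N F, a = mpoly.mmap (in_alg A) u p.

Definition affine_embedding {N} (u : 'I_N -> A) (z : spec_point) : 'I_N -> F :=
  fun i => z (u i).

Definition spec_map (f : {lrmorphism A -> A}) (z : spec_point) : spec_point :=
  z \o f.

Definition extends_along {N} (u : 'I_N -> A) (f : {lrmorphism A -> A})
    (g : poly_map N N) : Prop :=
  poly_map_fun g @` range (affine_embedding u) = range (affine_embedding u) /\
  forall z, poly_map_fun g (affine_embedding u z) =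
            affine_embedding u (spec_map f z).

End AffineVariety.


Record matrix_group (F : fieldType) (n : nat) := MatrixGroup {
  mxgroup_set : set 'M[F]_n;
  mxgroup_unit : forall A, mxgroup_set A -> A \in unitmx;
  mxgroup1 : mxgroup_set 1%:M;
  mxgroupM : forall A B, mxgroup_set A -> mxgroup_set B -> mxgroup_set (A *m B);
  mxgroupV : forall A, mxgroup_set A -> mxgroup_set (invmx A) }.

Record representation (gT : groupType) (F : fieldType) (n : nat)
    (G : matrix_group F n) := Representation {
  rep_fun :> gT -> 'M[F]_n;
  rep_in : forall a, mxgroup_set G (rep_fun a);
  repM : forall a b, rep_fun (a * b)%g = rep_fun a *m rep_fun b }.

Section CharacterVariety.
Context {gT : groupType} {F : fieldType} {n : nat} (G : matrix_group F n).

Local Notation Rep := (representation gT G).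

Definition trivial_rep : Rep :=
  @Representation gT F n G (fun _ => 1%:M) (fun _ => mxgroup1 G)
    (fun _ _ => esym (mulmx1 _)).

HB.instance Definition _ := gen_eqMixin Rep.
HB.instance Definition _ := gen_choiceMixin Rep.
HB.instance Definition _ := isPointed.Build Rep trivial_rep.

(* The F-algebra of functions on Hom(gT, G) generated by the matrix coefficients.
   The coefficients of phi a^-1 being included, it contains det^-1; for gT free of
   rank r it is the algebra F[G^r] of regular functions on G^r (for all the groups
   considered here the F-points of G are Zariski dense). *)
Inductive regular : (Rep -> F) -> Prop :=
| regular_const c : regular (fun=> c)
| regular_coef a i j : regular (fun phi : Rep => phi a i j)
| regular_add u v : regular u -> regular v -> regular (fun phi => u phi + v phi)
| regular_mul u v : regular u -> regular v -> regular (fun phi => u phi * v phi).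

Definition conjugate (phi psi : Rep) : Prop :=
  exists2 A, mxgroup_set G A & forall a, psi a = A *m phi a *m invmx A.

Definition conj_invariant (u : Rep -> F) : Prop :=
  forall phi psi, conjugate phi psi -> u psi = u phi.

Definition invariant_regular : {pred Rep -> F} :=
  fun u => `[< regular u /\ conj_invariant u >].

(* F[Hom(gT, G)]^G, the coordinate algebra of the character variety. *)
Record char_ring := CharRing {
  char_fun :> Rep -> F;
  char_funP : char_fun \in invariant_regular }.

HB.instance Definition _ := [isSub for char_fun].
HB.instance Definition _ := [Choice of char_ring by <:].

Lemma invariant_regular_subring : subring_closed invariant_regular.
Proof.
split.
- by apply/asboolP; split=> //; exact: regular_const.
- move=> u v /asboolP[ru iu] /asboolP[rv iv]; apply/asboolP; split; last first.
    by move=> phi psi e; rewrite /= !fctE (iu _ _ e) (iv _ _ e).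
  have -> : u - v = (fun phi => u phi + -1 * v phi).
    by apply/funext => phi; rewrite mulN1r.
  by apply: regular_add => //; apply: regular_mul => //; exact: regular_const.
- move=> u v /asboolP[ru iu] /asboolP[rv iv]; apply/asboolP; split.
    exact: regular_mul.
  by move=> phi psi e; rewrite /= !fctE (iu _ _ e) (iv _ _ e).
Qed.

HB.instance Definition _ := GRing.isSubringClosed.Build _ invariant_regular
  invariant_regular_subring.
HB.instance Definition _ := [SubChoice_isSubComNzRing of char_ring by <:].

Lemma char_scale_subproof (c : F) (u : char_ring) :
  (fun phi => c * u phi) \in invariant_regular.
Proof.
case: u => u /= /asboolP[ru iu]; apply/asboolP; split.
  by apply: regular_mul => //; exact: regular_const.
by move=> phi psi e /=; rewrite (iu _ _ e).
Qed.

Definition char_scale (c : F) (u : char_ring) : char_ring :=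
  CharRing (char_scale_subproof c u).

Lemma char_scaleA a b u : char_scale a (char_scale b u) = char_scale (a * b) u.
Proof. by apply/val_inj/funext => phi /=; rewrite mulrA. Qed.
Lemma char_scale1 : left_id 1 char_scale.
Proof. by move=> u; apply/val_inj/funext => phi /=; rewrite mul1r. Qed.
Lemma char_scaleDr : right_distributive char_scale +%R.
Proof. by move=> a u v; apply/val_inj/funext => phi /=; rewrite mulrDr. Qed.
Lemma char_scaleDl u : {morph char_scale^~ u : a b / a + b}.
Proof. by move=> a b; apply/val_inj/funext => phi /=; rewrite mulrDl. Qed.

HB.instance Definition _ := GRing.Zmodule_isLmodule.Build F char_ring
  char_scaleA char_scale1 char_scaleDr char_scaleDl.

Lemma char_scaleAl (a : F) (u v : char_ring) : a *: (u * v) = (a *: u) * v.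
Proof. by apply/val_inj/funext => phi /=; rewrite /char_scale /= mulrA. Qed.

HB.instance Definition _ := GRing.Lmodule_isLalgebra.Build F char_ring char_scaleAl.
HB.instance Definition _ := GRing.Lalgebra_isComAlgebra.Build F char_ring.

(* The action (f phi)(a) = phi (f a) and the algebra endomorphism it induces. *)
Section Action.
Variable f : {multiplicative gT -> gT}.

Lemma rep_actM (phi : Rep) a b : phi (f (a * b)%g) = phi (f a) *m phi (f b).
Proof. by rewrite gmulfM repM. Qed.

Definition rep_act (phi : Rep) : Rep :=
  @Representation gT F n G (phi \o f) (fun a => rep_in phi (f a)) (rep_actM phi).

Lemma char_pullback_subproof (u : char_ring) :
  (fun phi => u (rep_act phi)) \in invariant_regular.
Proof.
case: u => u /= /asboolP[ru iu]; apply/asboolP; split.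
  elim: ru => [c|a i j|v w _ rv _ rw|v w _ rv _ rw].
  - exact: regular_const.
  - exact: (regular_coef (f a)).
  - exact: regular_add.
  - exact: regular_mul.
move=> phi psi [A GA e]; apply: iu; exists A => // a; exact: e.
Qed.

Definition char_pullback (u : char_ring) : char_ring :=
  CharRing (char_pullback_subproof u).

Lemma char_pullback_zmod : zmod_morphism char_pullback.
Proof. by move=> u v; apply/val_inj/funext. Qed.
Lemma char_pullback_monoid : monoid_morphism char_pullback.
Proof. by split=> [|u v]; apply/val_inj/funext. Qed.
Lemma char_pullback_scale : scalable char_pullback.
Proof. by move=> c u; apply/val_inj/funext. Qed.

HB.instance Definition _ := GRing.isZmodMorphism.Build _ _ _ char_pullback_zmod.
HB.instance Definition _ := GRing.isMonoidMorphism.Build _ _ _ char_pullback_monoid.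
HB.instance Definition _ := GRing.isScalable.Build _ _ _ _ _ char_pullback_scale.

End Action.
End CharacterVariety.


Section LinearGroups.
Variables (F : fieldType) (n : nat).

Program Definition GL_group : matrix_group F n :=
  @MatrixGroup F n [set A | A \in unitmx] _ _ _ _.
Next Obligation. by []. Qed.
Next Obligation. exact: unitmx1. Qed.
Next Obligation. by move=> A B /= uA uB; rewrite unitmx_mul uA. Qed.
Next Obligation. by move=> A /= uA; rewrite unitmx_inv. Qed.

Program Definition SL_group : matrix_group F n :=
  @MatrixGroup F n [set A | \det A = 1] _ _ _ _.
Next Obligation. by move=> A /= dA; rewrite unitmxE dA unitr1. Qed.
Next Obligation. exact: det1. Qed.
Next Obligation. by move=> A B /= dA dB; rewrite det_mulmx dA dB mulr1. Qed.
Next Obligation. by move=> A /= dA; rewrite det_inv dA invr1. Qed.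

Program Definition O_group : matrix_group F n :=
  @MatrixGroup F n [set A | A *m A^T = 1%:M] _ _ _ _.
Next Obligation. by move=> A /= /mulmx1_unit[]. Qed.
Next Obligation. by rewrite /= trmx1 mulmx1. Qed.
Next Obligation.
move=> A B /= oA oB.
by rewrite trmx_mul mulmxA -(mulmxA A) oB mulmx1.
Qed.
Next Obligation.
move=> A /= oA; have [uA _] := mulmx1_unit oA.
have -> : invmx A = A^T by rewrite -[LHS]mulmx1 -oA mulKmx.
by rewrite trmxK mulmx1C.
Qed.

Program Definition SO_group : matrix_group F n :=
  @MatrixGroup F n [set A | A *m A^T = 1%:M /\ \det A = 1] _ _ _ _.
Next Obligation. by move=> A /= [/mulmx1_unit[]]. Qed.
Next Obligation. by split; [exact: (mxgroup1 O_group) | exact: det1]. Qed.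
Next Obligation.
move=> A B /= [oA dA] [oB dB]; split; first exact: (mxgroupM (m := O_group)).
by rewrite det_mulmx dA dB mulr1.
Qed.
Next Obligation.
move=> A /= [oA dA]; split; first exact: (mxgroupV (m := O_group)).
by rewrite det_inv dA invr1.
Qed.

Definition symplectic_form : 'M[F]_(n + n) := block_mx 0 1%:M (- 1%:M) 0.

Lemma symplectic_form_unit : symplectic_form \in unitmx.
Proof.
have : symplectic_form *m (- symplectic_form) = 1%:M.
  rewrite mulmxN mulmx_block !mul0mx !mulmx0 !mul1mx !mulmx1 !add0r !addr0.
  by rewrite opp_block_mx !opprK !oppr0 -scalar_mx_block.
by case/mulmx1_unit.
Qed.

Program Definition Sp_group : matrix_group F (n + n) :=
  @MatrixGroup F (n + n)
    [set A | A^T *m symplectic_form *m A = symplectic_form] _ _ _ _.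
Next Obligation.
move=> A /= sA; have := symplectic_form_unit.
by rewrite -sA unitmx_mul => /andP[].
Qed.
Next Obligation. by rewrite /= trmx1 mul1mx mulmx1. Qed.
Next Obligation.
move=> A B /= sA sB.
transitivity (B^T *m (A^T *m symplectic_form *m A) *m B).
  by rewrite trmx_mul !mulmxA.
by rewrite sA.
Qed.
Next Obligation.
move=> A /= sA; have uA : A \in unitmx.
  by have := symplectic_form_unit; rewrite -sA unitmx_mul => /andP[].
rewrite -[in LHS]sA trmx_inv mulmxA mulmxK// mulmxA mulVmx ?unitmx_tr//.
by rewrite mul1mx.
Qed.

End LinearGroups.

Section UnitaryGroups.
Variable R : realType.

(* U_N and SU_N as real algebraic groups, embedded in GL_2N(R) by
   A + iB |-> [A, -B; B, A]. *)
Definition realify n (Z : 'M[complex R]_n) : 'M[R]_(n + n) :=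
  block_mx (map_mx (@complex.Re R) Z) (- map_mx (@complex.Im R) Z)
           (map_mx (@complex.Im R) Z) (map_mx (@complex.Re R) Z).

Lemma realify1 n : realify (1%:M : 'M[complex R]_n) = 1%:M.
Proof.
rewrite /realify [RHS]scalar_mx_block; congr block_mx;
  apply/matrixP => i j; rewrite !mxE; case: (i == j); rewrite //= ?oppr0//.
Qed.

Lemma realifyM n (Z W : 'M[complex R]_n) : realify (Z *m W) = realify Z *m realify W.
Proof.
have ReM : map_mx (@complex.Re R) (Z *m W) =
    map_mx (@complex.Re R) Z *m map_mx (@complex.Re R) W -
    map_mx (@complex.Im R) Z *m map_mx (@complex.Im R) W.
  apply/matrixP => i j; rewrite !mxE raddf_sum -sumrB; apply: eq_bigr => k _.
  by rewrite !mxE; case: (Z i k) (W k j) => [a b] [c d].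
have ImM : map_mx (@complex.Im R) (Z *m W) =
    map_mx (@complex.Im R) Z *m map_mx (@complex.Re R) W +
    map_mx (@complex.Re R) Z *m map_mx (@complex.Im R) W.
  apply/matrixP => i j; rewrite !mxE raddf_sum -big_split; apply: eq_bigr => k _.
  by rewrite !mxE; case: (Z i k) (W k j) => [a b] [c d] /=; rewrite addrC.
rewrite /realify mulmx_block ReM ImM !mulNmx !mulmxN opprD.
congr block_mx; by rewrite addrC.
Qed.

Lemma realify_inv n (Z W : 'M[complex R]_n) : Z *m W = 1%:M ->
  realify Z \in unitmx /\ invmx (realify Z) = realify W.
Proof.
move=> ZW; have e : realify Z *m realify W = 1%:M by rewrite -realifyM ZW realify1.
have [uZ _] := mulmx1_unit e; split=> //.
by rewrite -[LHS]mulmx1 -e mulKmx.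
Qed.

Variable n : nat.

Program Definition U_group : matrix_group R (n + n) :=
  @MatrixGroup R (n + n) [set realify Z | Z in [set Z : 'M[complex R]_n | Z \is unitarymx]]
    _ _ _ _.
Next Obligation. by move=> _ [Z /unitarymxP/realify_inv[uZ _] <-]. Qed.
Next Obligation.
exists 1%:M; last exact: realify1.
by apply/unitarymxP; rewrite trmx1 map_mx1 mulmx1.
Qed.
Next Obligation.
move=> _ _ [Z uZ <-] [W uW <-]; exists (Z *m W); last exact: realifyM.
exact: mul_unitarymx.
Qed.
Next Obligation.
move=> _ [Z uZ <-]; exists (invmx Z).
  by rewrite /= invmx_unitary// trmxC_unitary.
by have [_ ->] := realify_inv (mulmxV (unitarymx_unit uZ)).
Qed.

Program Definition SU_group : matrix_group R (n + n) :=
  @MatrixGroup R (n + n) [set realify Z | Z in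
    [set Z : 'M[complex R]_n | Z \is unitarymx /\ \det Z = 1]] _ _ _ _.
Next Obligation. by move=> _ [Z [/unitarymxP/realify_inv[uZ _] _] <-]. Qed.
Next Obligation.
exists 1%:M; last exact: realify1.
by split; [apply/unitarymxP; rewrite trmx1 map_mx1 mulmx1 | exact: det1].
Qed.
Next Obligation.
move=> _ _ [Z [uZ dZ] <-] [W [uW dW] <-]; exists (Z *m W); last exact: realifyM.
by split; [exact: mul_unitarymx | rewrite det_mulmx dZ dW mulr1].
Qed.
Next Obligation.
move=> _ [Z [uZ dZ] <-]; exists (invmx Z).
  split; last by rewrite det_inv dZ invr1.
  by rewrite invmx_unitary// trmxC_unitary.
by have [_ ->] := realify_inv (mulmxV (unitarymx_unit uZ)).
Qed.

End UnitaryGroups.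

(* In rank one SL_1 is trivial and GL_1, U_1 are abelian; N >= 2 is required for
   these families. *)
Variant listed_group (R : realType) :
  forall (F : fieldType) (n : nat), matrix_group F n -> Prop :=
| listed_SL_real N of (1 < N)%N : listed_group R (SL_group R N)
| listed_SL_complex N of (1 < N)%N : listed_group R (SL_group (complex R) N)
| listed_GL_real N of (1 < N)%N : listed_group R (GL_group R N)
| listed_GL_complex N of (1 < N)%N : listed_group R (GL_group (complex R) N)
| listed_O N of (2 < N)%N : listed_group R (O_group R N)
| listed_SO N of (2 < N)%N : listed_group R (SO_group R N)
| listed_U N of (1 < N)%N : listed_group R (U_group R N)
| listed_SU2 : listed_group R (SU_group R 2)
| listed_Sp N of (0 < N)%N : listed_group R (Sp_group R N).

(* Main.v *)
(* Let pi be free on x, let |a| be the cyclic length of a, and embed Hom(pi, G) in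
   an affine space by the entries of the phi(x_i) and phi(x_i)^-1.

   Entropy <= spectral radius: among the conjugates of the tuple (f^n x_i) one has
   word lengths O(L_n), where L_n is the largest |f^n a| for a among the x_i and
   x_i x_j (Serre's lemma on the Cayley tree), so the pullback by f^n of an invariant
   function is induced by a polynomial of degree O(L_n). An invariant polynomial of
   degree d is a polynomial of degree <= d in finitely many fixed invariants. All
   the groups are stable under conjugate transposition, so this follows from
   Hilbert's argument with the Reynolds operator replaced by orthogonality for the
   Fischer form <p, q> = p(d) q-bar (0), whose adjoints respect invariance.

   Spectral radius <= entropy: SL_2, SU_2 and SO_3 contain representations of pi
   sending x_i^(+-1) to conjugates of diag(1/t, t)^(+-1) by generic rotations. The
   trace of the image of a has a pole of order exactly |a| at t = 0, since its leading
   coefficient is a product of pairings of eigenvectors, none of which vanishes on a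
   cyclically reduced word; a polynomial of degree d in the entries has a pole of
   order O(d). Hence tr phi(f^n a) has degree at least a multiple of |f^n a|. *)
Require Import Defs.
From HB Require Import structures.
From mathcomp Require Import all_boot all_order all_algebra.
From mathcomp Require Import complex ring lra zify.
From mathcomp Require Import all_classical all_reals all_analysis.
From mathcomp Require Import -(notations) mpoly.

Set Implicit Arguments.
Unset Strict Implicit.
Unset Printing Implicit Defensive.

Import Order.TTheory GRing.Theory Num.Theory.

Local Open Scope classical_set_scope.
Local Open Scope ring_scope.

(** * Multivariate polynomials: degree and substitution *)

(** Both inequalities compare degrees with lengths up to a fixed factor, which [(1/n) log] forgets.
    Finite generation of the invariants is therefore not enough: the degree must grow at most
    linearly on passing from matrix entries to generators of the character ring. Homogeneous
    generators of positive degree give this. An invariant function is at first only the restriction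
    of a non-invariant polynomial; it is lifted to an invariant one of no larger degree before
    Hilbert's argument applies.

    In the compact groups the parameter t cannot approach the pole: it runs over the unit circle.
    The order of the pole is therefore read off algebraically, from a polynomial identity on an
    infinite set. The same count, over the rationals, shows that cyclically reduced words are
    shortest in their conjugacy class, which ties the pole to the length defined through conjugates.
    In SO_3 the trace is the square of the SU_2 trace minus one, so families are allowed whose trace
    is an affine function of a power of the ping-pong trace. *)

Section Mpoly.
Context {n : nat} {K : comNzRingType}.
Implicit Types p q : mpoly n K.

Lemma mpoly_alg_ind (P : mpoly n K -> Prop) :
  (forall c, P (mpolyC n c)) -> (forall i, P (mpolyX K (mnm1 i))) ->
  (forall p q, P p -> P q -> P (p + q)) ->
  (forall p q, P p -> P q -> P (p * q)) -> forall p, P p.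
Proof.
move=> PC PX PD PM; elim/mpolyind => [|c m p _ _ Pp].
  by rewrite -(mpolyC0 n K); exact: PC.
apply: (PD) => //; rewrite -mul_mpolyC; apply: (PM) => //.
rewrite mpolyXE_id; apply: (big_ind P) => [| |i _].
- by rewrite -(mpolyC1 n K); exact: PC.
- exact: PM.
- elim: (m i) => [|k IH]; first by rewrite expr0 -(mpolyC1 n K); exact: PC.
  by rewrite exprS; exact: PM.
Qed.

(** Stated on coefficients, so that the zero polynomial satisfies every bound; [homogeneous] follows
    the same convention. *)
Definition deg_le (d : nat) p := forall m, mcoeff m p != 0 -> (mdeg m <= d)%N.

Definition homogeneous (d : nat) p := forall m, mcoeff m p != 0 -> mdeg m = d.

Lemma deg_leP d p : deg_le d p <-> ((msize p).-1 <= d)%N.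
Proof.
split=> [dp|dp m].
  rewrite msizeE; have [->|p0] := eqVneq p 0; first by rewrite msupp0 big_nil.
  rewrite -subn1 leq_subLR add1n; apply/bigmax_leqP_seq => m mp _.
  by rewrite ltnS dp// -mcoeff_msupp.
rewrite -mcoeff_msupp => /msize_mdeg_lt; lia.
Qed.

Lemma deg_leC d c : deg_le d (mpolyC n c).
Proof.
move=> m; rewrite mcoeffC; have [->|_] := eqVneq m mnm0; first by rewrite mdeg0.
by rewrite mulr0 eqxx.
Qed.

Lemma deg_leX i : deg_le 1 (mpolyX K (mnm1 i)).
Proof.
by move=> m; rewrite mcoeffX; have [<-|] := eqVneq (mnm1 i) m; rewrite ?mdeg1// eqxx.
Qed.

Lemma deg_leD d p q : deg_le d p -> deg_le d q -> deg_le d (p + q).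
Proof.
move=> dp dq m; rewrite mcoeffD; have [->|/dp//] := eqVneq (mcoeff m p) 0.
by rewrite add0r; exact: dq.
Qed.

Lemma deg_leZ d c p : deg_le d p -> deg_le d (c *: p).
Proof.
move=> dp m; rewrite mcoeffZ; have [->|/dp//] := eqVneq (mcoeff m p) 0.
by rewrite mulr0 eqxx.
Qed.

Lemma deg_leB d p q : deg_le d p -> deg_le d q -> deg_le d (p - q).
Proof. by move=> dp dq; rewrite -scaleN1r; apply: deg_leD => //; exact: deg_leZ. Qed.

Lemma mcoeffM_neq0 p q m : mcoeff m (p * q) != 0 -> exists m1 m2,
  [/\ mcoeff m1 p != 0, mcoeff m2 q != 0 & m = mnm_add m1 m2].
Proof.
rewrite -mcoeff_msupp => /msuppM_le/allpairsP[[m1 m2] /= [h1 h2 ->]].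
by exists m1, m2; rewrite -!mcoeff_msupp.
Qed.

Lemma deg_leM d e p q : deg_le d p -> deg_le e q -> deg_le (d + e) (p * q).
Proof.
move=> dp dq m /mcoeffM_neq0[m1 [m2 [/dp d1 /dq d2 ->]]].
by rewrite mdegD leq_add.
Qed.

Lemma homogeneousM d e p q :
  homogeneous d p -> homogeneous e q -> homogeneous (d + e) (p * q).
Proof.
move=> dp dq m /mcoeffM_neq0[m1 [m2 [/dp d1 /dq d2 ->]]].
by rewrite mdegD d1 d2.
Qed.

Lemma homogeneousD d p q :
  homogeneous d p -> homogeneous d q -> homogeneous d (p + q).
Proof.
move=> dp dq m; rewrite mcoeffD; have [->|/dp//] := eqVneq (mcoeff m p) 0.
by rewrite add0r; exact: dq.
Qed.

Lemma homogeneousZ d c p : homogeneous d p -> homogeneous d (c *: p).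
Proof.
move=> dp m; rewrite mcoeffZ; have [->|/dp//] := eqVneq (mcoeff m p) 0.
by rewrite mulr0 eqxx.
Qed.

Lemma homogeneous0 d : homogeneous d (0 : mpoly n K).
Proof. by move=> m; rewrite mcoeff0 eqxx. Qed.

Lemma deg_le_leq d e p : (d <= e)%N -> deg_le d p -> deg_le e p.
Proof. by move=> de dp m /dp h; exact: leq_trans de. Qed.

Lemma deg_leXn d p k : deg_le d p -> deg_le (d * k) (p ^+ k).
Proof.
move=> dp; elim: k => [|k IH]; first by rewrite expr0 -(mpolyC1 n K); exact: deg_leC.
by rewrite exprS mulnS; exact: deg_leM.
Qed.

Lemma homogeneousC c : homogeneous 0 (mpolyC n c).
Proof. by move=> m /(@deg_leC 0); rewrite leqn0 => /eqP. Qed.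

Lemma homogeneousXn d p k : homogeneous d p -> homogeneous (d * k) (p ^+ k).
Proof.
move=> dp; elim: k => [|k IH].
  by rewrite expr0 muln0 -(mpolyC1 n K); exact: homogeneousC.
by rewrite exprS mulnS; exact: homogeneousM.
Qed.

Lemma homogeneous_pihomog d p : homogeneous d (pihomog (@mdeg n) d p).
Proof.
move=> m; have /dhomogP h := pihomogP (@mdeg n) d p.
by rewrite -mcoeff_msupp => /h.
Qed.

Lemma mpoly_sum_pihomog p : exists k, p = \sum_(d < k) pihomog (@mdeg n) d p.
Proof. by exists (msize p); exact: pihomog_partitionE. Qed.

Lemma pihomog_sum_homogeneous (d k : nat) (u : nat -> mpoly n K) :
  (forall e, homogeneous e (u e)) ->
  pihomog (@mdeg n) d (\sum_(e < k) u e) = if (d < k)%N then u d else 0.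
Proof.
move=> hu; have dh e : u e \is ishomog1 e (@mdeg n).
  by apply/dhomogP => m; rewrite mcoeff_msupp => /hu.
rewrite raddf_sum /=; case: ifP => dk; last first.
  apply: big1 => e _; apply: (pihomog_ne0 (d := e)) (dh e).
  by apply/eqP => ed; move: dk; rewrite -ed ltn_ord.
rewrite (bigD1 (Ordinal dk))//= (pihomog_dE (dh d)) big1 ?addr0// => e ed.
by apply: (pihomog_ne0 (d := e)) (dh e).
Qed.

End Mpoly.

Arguments mpoly_alg_ind [n K].

Section Substitution.
Context {n k : nat} {K : comNzRingType}.
Variable h : 'I_n -> mpoly k K.
Implicit Types p q : mpoly n K.

Definition subst_mpoly p : mpoly k K := mmap (@mpolyC k K) h p.

Lemma substC c : subst_mpoly (mpolyC n c) = mpolyC k c.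
Proof. exact: mmapC. Qed.

Lemma substX i : subst_mpoly (mpolyX K (mnm1 i)) = h i.
Proof. by rewrite /subst_mpoly mmapX mmap1U. Qed.

Lemma substD p q : subst_mpoly (p + q) = subst_mpoly p + subst_mpoly q.
Proof. exact: mmapD. Qed.

Lemma substM p q : subst_mpoly (p * q) = subst_mpoly p * subst_mpoly q.
Proof. exact: rmorphM. Qed.

Lemma substZ c p : subst_mpoly (c *: p) = c *: subst_mpoly p.
Proof. by rewrite -!mul_mpolyC substM substC. Qed.

Lemma subst_sum (I : Type) (r : seq I) (P : pred I) (u : I -> mpoly n K) :
  subst_mpoly (\sum_(i <- r | P i) u i) = \sum_(i <- r | P i) subst_mpoly (u i).
Proof. exact: raddf_sum. Qed.

Lemma meval_subst v p :
  meval v (subst_mpoly p) = meval (fun i => meval v (h i)) p.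
Proof.
elim/mpoly_alg_ind: p => [c|i|p q IHp IHq|p q IHp IHq].
- by rewrite substC !mevalC.
- by rewrite substX mevalXU.
- by rewrite substD !mevalD IHp IHq.
- by rewrite substM !mevalM IHp IHq.
Qed.

Lemma deg_le_subst d e p :
  (forall i, deg_le e (h i)) -> deg_le d p -> deg_le (e * d) (subst_mpoly p).
Proof.
move=> he dp; rewrite [p]mpolyE subst_sum.
apply: big_ind => [||m].
- by rewrite -(mpolyC0 k K); exact: deg_leC.
- by move=> u v; exact: deg_leD.
have [->|pm] := eqVneq (mcoeff m p) 0.
  by rewrite scale0r -(mpolyC0 n K) substC => _; exact: deg_leC.
move=> _; rewrite substZ; apply: deg_leZ.
apply: (deg_le_leq (d := (e * mdeg m)%N)); first by rewrite leq_mul2l dp ?orbT.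
rewrite /subst_mpoly mmapX mdegE big_distrr /= /mmap1.
elim/big_rec2: _ => [|i a u _ IH]; first by rewrite -(mpolyC1 k K); exact: deg_leC.
by apply: deg_leM => //; exact: deg_leXn.
Qed.

Lemma homogeneous_subst d p :
  (forall i, homogeneous 1 (h i)) -> homogeneous d p -> homogeneous d (subst_mpoly p).
Proof.
move=> he dp; rewrite [p]mpolyE subst_sum.
apply: big_ind => [||m]; [exact: homogeneous0|by move=> u v; exact: homogeneousD|].
have [->|pm] := eqVneq (mcoeff m p) 0.
  by rewrite scale0r -(mpolyC0 n K) substC mpolyC0 => _; exact: homogeneous0.
move=> _; rewrite substZ; apply: homogeneousZ; rewrite -(dp _ pm).
rewrite /subst_mpoly mmapX mdegE /mmap1.
elim/big_rec2: _ => [|i a u _ IH]; first by rewrite -(mpolyC1 k K); exact: homogeneousC.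
by apply: homogeneousM => //; rewrite -[X in homogeneous X]mul1n; exact: homogeneousXn.
Qed.

End Substitution.

Lemma mmap_subst n k (K : comNzRingType) (A : comAlgType K) (u : 'I_k -> A)
    (h : 'I_n -> mpoly k K) (p : mpoly n K) :
  mmap (in_alg A) u (subst_mpoly h p) =
  mmap (in_alg A) (fun i => mmap (in_alg A) u (h i)) p.
Proof.
elim/mpoly_alg_ind: p => [c|i|p q IHp IHq|p q IHp IHq].
- by rewrite substC !mmapC.
- by rewrite substX mmapX mmap1U.
- by rewrite substD !mmapD IHp IHq.
- by rewrite substM !rmorphM /= IHp IHq.
Qed.

(** * The Fischer form *)

Section Fischer.
Context {n : nat} {K : numFieldType} (cj : {rmorphism K -> K}).
Hypotheses (cjK : involutive cj) (cj_ge0 : forall x, 0 <= x * cj x).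
Implicit Types p q a : mpoly n K.

(** The squared Fischer norm of the monomial with exponent m: in the monomial basis the form is
    diagonal with these weights. *)
Definition mfact (m : multinom n) : nat := (\prod_(i < n) (m i)`!)%N.

Lemma mfact_gt0 m : (0 < mfact m)%N.
Proof. by apply: prodn_gt0 => i; exact: fact_gt0. Qed.

Lemma mfactD1 i m : mfact (mnm_add m (mnm1 i)) = ((m i).+1 * mfact m)%N.
Proof.
rewrite /mfact (bigD1 i)//= [in RHS](bigD1 i)//= mnmDE mnm1E eqxx addn1 factS mulnA.
by congr muln; apply: eq_bigr => j ji; rewrite mnmDE mnm1E eq_sym (negbTE ji) addn0.
Qed.

Definition fischer p q : K :=
  \sum_(m <- msupp p) (mfact m)%:R * mcoeff m p * cj (mcoeff m q).

Lemma fischer_supp s p q : uniq s -> {subset msupp p <= s} ->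
  fischer p q = \sum_(m <- s) (mfact m)%:R * mcoeff m p * cj (mcoeff m q).
Proof.
move=> us ps; rewrite /fischer [in RHS](bigID (mem (msupp p))) /=.
rewrite -[in RHS]big_filter [X in _ = _ + X]big1 ?addr0; last first.
  by move=> m /memN_msupp_eq0 ->; rewrite mulr0 mul0r.
apply: perm_big; apply: uniq_perm; rewrite ?msupp_uniq ?filter_uniq// => m.
by rewrite mem_filter andb_idr//; exact: ps.
Qed.

Lemma fischerC p q : fischer p q = cj (fischer q p).
Proof.
have us := undup_uniq (msupp p ++ msupp q).
rewrite (fischer_supp q us) => [|m mp]; last by rewrite mem_undup mem_cat mp.
rewrite (fischer_supp p us) => [|m mp]; last by rewrite mem_undup mem_cat mp orbT.
rewrite rmorph_sum; apply: eq_bigr => m _.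
by rewrite !rmorphM /= cjK rmorph_nat mulrAC.
Qed.

Lemma fischerDr p q r : fischer p (q + r) = fischer p q + fischer p r.
Proof.
by rewrite -big_split; apply: eq_bigr => m _ /=; rewrite mcoeffD rmorphD mulrDr.
Qed.

Lemma fischerZr c p q : fischer p (c *: q) = cj c * fischer p q.
Proof.
rewrite big_distrr; apply: eq_bigr => m _ /=.
by rewrite mcoeffZ rmorphM /= mulrCA.
Qed.

Lemma fischerDl p q r : fischer (p + q) r = fischer p r + fischer q r.
Proof. by rewrite fischerC fischerDr rmorphD /= -!fischerC. Qed.

Lemma fischerZl c p q : fischer (c *: p) q = c * fischer p q.
Proof. by rewrite fischerC fischerZr rmorphM /= cjK -fischerC. Qed.

Lemma fischerBr p q r : fischer p (q - r) = fischer p q - fischer p r.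
Proof. by rewrite -scaleN1r fischerDr fischerZr rmorphN1 mulN1r. Qed.

Lemma fischer0r p : fischer p 0 = 0.
Proof. by have := fischerBr p 0 0; rewrite !subrr. Qed.

Lemma fischer0l p : fischer 0 p = 0.
Proof. by rewrite fischerC fischer0r rmorph0. Qed.

Lemma fischer_suml (I : Type) (r : seq I) (P : pred I) (u : I -> mpoly n K) q :
  fischer (\sum_(i <- r | P i) u i) q = \sum_(i <- r | P i) fischer (u i) q.
Proof.
by apply: (big_morph (fischer^~ q)) => [? ?|]; [exact: fischerDl|exact: fischer0l].
Qed.

Lemma fischerX m q : fischer (mpolyX K m) q = (mfact m)%:R * cj (mcoeff m q).
Proof. by rewrite /fischer msuppX big_seq1 mcoeffX eqxx mulr1. Qed.

Lemma mpoly_linear_ind (P : mpoly n K -> Prop) :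
  (forall m, P (mpolyX K m)) -> (forall c p, P p -> P (c *: p)) ->
  (forall p q, P p -> P q -> P (p + q)) -> forall p, P p.
Proof.
move=> PX PZ PD; elim/mpolyind => [|c m p _ _ Pp].
  by rewrite -(scale0r (mpolyX K mnm0)); apply: PZ.
by apply: PD => //; exact: PZ.
Qed.

Lemma fischer_eq0 p : fischer p p = 0 -> p = 0.
Proof.
move=> /eqP; rewrite /fischer big_seq psumr_eq0 => [/allP pp|m _]; last first.
  by rewrite -mulrA mulr_ge0 ?ler0n.
apply: msuppnil0; case e: (msupp p) => [//|m s]; have mp: m \in msupp p by rewrite e inE eqxx.
have := pp _ mp; rewrite mp /= !mulf_eq0 pnatr_eq0 eqn0Ngt mfact_gt0 /=.
rewrite fmorph_eq0 orbb => /eqP m0; move: mp; rewrite mcoeff_msupp m0 eqxx//.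
Qed.

Lemma fischer_inj p q : (forall r, fischer r p = fischer r q) -> p = q.
Proof.
move=> pq; apply/eqP; rewrite -subr_eq0; apply/eqP/fischer_eq0.
by rewrite fischerBr pq subrr.
Qed.

(** The weights are made for this: (m + e_i)! = (m_i + 1) m! matches the factor produced by
    differentiation. *)
Lemma fischer_mulX i p q :
  fischer (mpolyX K (mnm1 i) * p) q = fischer p (mderiv i q).
Proof.
elim/mpoly_linear_ind: p => [m|c p IH|p r IHp IHr].
- rewrite -mpolyXD addmC !fischerX mfactD1 mcoeff_mderiv rmorphMn /= natrM -[cj _ *+ _]mulr_natl.
  by rewrite -mulrA mulrCA.
- by rewrite -scalerAr !fischerZl IH.
- by rewrite mulrDr !fischerDl IHp IHr.
Qed.

Definition linear_subst (L : 'M[K]_n) p : mpoly n K :=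
  subst_mpoly (fun i => \sum_j L i j *: mpolyX K (mnm1 j)) p.

Definition adjmx (L : 'M[K]_n) : 'M[K]_n := map_mx cj L^T.

Lemma adjmxK : involutive adjmx.
Proof. by move=> L; apply/matrixP => i j; rewrite !mxE cjK. Qed.

Lemma meval_linear_subst L v p :
  meval v (linear_subst L p) = meval (fun i => \sum_j L i j * v j) p.
Proof.
rewrite /linear_subst meval_subst; apply: meval_eq => i.
by rewrite raddf_sum; apply: eq_bigr => j _ /=; rewrite mevalZ mevalXU.
Qed.

Lemma mderiv_linear_subst L i p : mderiv i (linear_subst L p) =
  \sum_j L j i *: linear_subst L (mderiv j p).
Proof.
rewrite /linear_subst; elim/mpoly_alg_ind: p => [c|k|p q IHp IHq|p q IHp IHq].
- rewrite substC mderivC big1// => j _.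
  by rewrite mderivC -(mpolyC0 n K) substC mpolyC0 scaler0.
- rewrite substX raddf_sum /= (bigD1 i)//= big1 ?addr0 => [|j ji]; last first.
    rewrite mderivZ mderivX mnm1E (negbTE ji) scale0r scaler0//.
  rewrite mderivZ mderivX mnm1E eqxx scale1r.
  rewrite (bigD1 k)//= big1 ?addr0 => [|j jk]; last first.
    by rewrite mderivX mnm1E eq_sym (negbTE jk) scale0r -(mpolyC0 n K) substC mpolyC0 scaler0.
  rewrite mderivX mnm1E eqxx scale1r.
  have sub1 j : mnm_sub (mnm1 j) (mnm1 j) = mnm0 :> multinom n.
    by apply/mnmP => l; rewrite mnmBE mnm0E subnn.
  by rewrite !sub1 mpolyX0 -(mpolyC1 n K) substC.
- rewrite substD !mderivD IHp IHq -big_split; apply: eq_bigr => j _ /=.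
  by rewrite mderivD substD scalerDr.
- rewrite substM mderivM IHp IHq big_distrl big_distrr -big_split.
  apply: eq_bigr => j _ /=.
  by rewrite mderivM substD !substM scalerDr -scalerAl -scalerAr.
Qed.

Lemma linear_substC L c : linear_subst L (mpolyC n c) = mpolyC n c.
Proof. exact: substC. Qed.

Lemma mcoeff0_linear_subst L p : mcoeff mnm0 (linear_subst L p) = mcoeff mnm0 p.
Proof.
elim/mpoly_alg_ind: p => [c|i|p q IHp IHq|p q IHp IHq].
- by rewrite linear_substC.
- rewrite /linear_subst substX raddf_sum mcoeffX mnm1_eq0 big1// => j _.
  by rewrite /= mcoeffZ mcoeffX mnm1_eq0 mulr0.
- by rewrite /linear_subst substD !mcoeffD IHp IHq.
- by rewrite /linear_subst substM !rmorphM /= IHp IHq.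
Qed.

(** A variable crosses the form as a derivative, where the chain rule [mderiv_linear_subst] brings
    out the entries of the adjoint of L. *)
Lemma fischer_linear_subst L p q :
  fischer (linear_subst L p) q = fischer p (linear_subst (adjmx L) q).
Proof.
pose P p := forall q, fischer (linear_subst L p) q = fischer p (linear_subst (adjmx L) q).
(* Induct on a multiplier a rather than on p: products then come for free, and the starting point p
   = 1 is a comparison of constant terms. *)
suff PM a : forall p, P p -> P (a * p).
  rewrite -[p]mulr1; apply: PM => r; rewrite -(mpolyC1 n K) linear_substC.
  by rewrite mpolyC1 -(mpolyX0 n K) !fischerX mcoeff0_linear_subst.
elim/mpoly_alg_ind: a => [c|i|a b IHa IHb|a b IHa IHb] r Pr s.
- rewrite [in RHS]mul_mpolyC /linear_subst substM substC mul_mpolyC.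
  by rewrite !fischerZl Pr.
- rewrite fischer_mulX /linear_subst substM substX mderiv_linear_subst.
  rewrite big_distrl fischer_suml /=.
  transitivity (\sum_j L i j * fischer r (linear_subst (adjmx L) (mderiv j s))).
    by apply: eq_bigr => j _; rewrite -scalerAl fischerZl fischer_mulX Pr.
  rewrite [in RHS]fischerC fischer_suml rmorph_sum; apply: eq_bigr => j _.
  by rewrite fischerZl rmorphM /= !mxE cjK -fischerC.
- rewrite mulrDl /linear_subst substD !fischerDl; congr (_ + _); [exact: IHa|exact: IHb].
- by rewrite -mulrA; apply: IHa; exact: IHb.
Qed.

(** The adjoint is the constant-coefficient differential operator obtained from a by conjugating
    coefficients and replacing variables by derivatives. *)
Lemma fischer_mul_adjoint a : exists T : mpoly n K -> mpoly n K,
  forall p q, fischer (p * a) q = fischer p (T q).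
Proof.
elim/mpoly_alg_ind: a => [c|i|a b [T hT] [U hU]|a b [T hT] [U hU]].
- exists (fun q => cj c *: q) => p q.
  by rewrite mulrC mul_mpolyC fischerZl fischerZr cjK.
- by exists (mderiv i) => p q; rewrite mulrC fischer_mulX.
- by exists (fun q => T q + U q) => p q; rewrite mulrDr fischerDl fischerDr hT hU.
- by exists (fun q => T (U q)) => p q; rewrite mulrA hU hT.
Qed.

(** Pairing with the monomial of exponent m detects its coefficient in [T q]. Written as a sum, the
    conclusion also says that [T q] vanishes when d > e. *)
Lemma homogeneous_adjoint a (T : mpoly n K -> mpoly n K) d e q :
  (forall p q, fischer (p * a) q = fischer p (T q)) ->
  homogeneous d a -> homogeneous e q ->
  forall m, mcoeff m (T q) != 0 -> (mdeg m + d)%N = e.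
Proof.
move=> hT ha hq m Tm.
have /eqP nz : fischer (mpolyX K m * a) q != 0.
  rewrite hT fischerX mulf_neq0//; first by rewrite pnatr_eq0 -lt0n mfact_gt0.
  by rewrite fmorph_eq0.
have [m' [mx mq]] : exists m', mcoeff m' (mpolyX K m * a) != 0 /\ mcoeff m' q != 0.
  apply: contrapT => /forallNP h; apply: nz.
  apply: big1 => m' _; have /not_andP[/negP/negPn/eqP ->|/negP/negPn/eqP ->] := h m'.
    by rewrite mulr0 mul0r.
  by rewrite rmorph0 mulr0.
rewrite -(hq _ mq); move/mcoeffM_neq0: mx => [k1 [k2 [k1e /ha k2d ->]]].
rewrite mdegD k2d; move: k1e; rewrite mcoeffX.
by have [->|] := eqVneq m k1; rewrite ?eqxx.
Qed.

Definition subspace (W : mpoly n K -> Prop) : Prop :=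
  W 0 /\ forall c p q, W p -> W q -> W (c *: p + q).

(** Gram-Schmidt along the list of monomials: killing the coefficient at m cuts W down to W' of
    codimension at most one, and e, the part of [w1] orthogonal to W', spans the missing
    direction. *)
Lemma fischer_projection (W : mpoly n K -> Prop) (ms : seq (multinom n)) :
  subspace W -> (forall p m, W p -> mcoeff m p != 0 -> m \in ms) ->
  forall p, exists2 w, W w & forall v, W v -> fischer v (p - w) = 0.
Proof.
elim: ms W => [|m ms IH] W [W0 WD] Wms p.
  exists 0 => // v Wv; suff -> : v = 0 by rewrite fischer0l.
  apply/mpolyP => m; rewrite mcoeff0; apply/eqP; apply/negPn/negP => vm.
  by have := Wms _ _ Wv vm.
pose W' q := W q /\ mcoeff m q = 0.
have W'D : subspace W'.
  split=> [|c q r [Wq q0] [Wr r0]]; split; rewrite ?mcoeff0//; first exact: WD.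
  by rewrite mcoeffD mcoeffZ q0 r0 mulr0 addr0.
have {}IH := IH W' W'D _; have W'ms q k : W' q -> mcoeff k q != 0 -> k \in ms.
  move=> [Wq q0] qk; have := Wms _ _ Wq qk; rewrite inE => /predU1P[km|//].
  by move: qk; rewrite km q0 eqxx.
have {W'ms}IH := IH W'ms.
have [w [Ww w0] wP] := IH p.
have [[w1 [Ww1 w1m]]|nw1] := pselect (exists w1, W w1 /\ mcoeff m w1 != 0); last first.
  exists w => // v Wv; apply: wP; split=> //; apply/eqP/negPn/negP => vm.
  by apply: nw1; exists v.
have [w2 [Ww2 w20] w2P] := IH w1.
pose e := w1 - w2.
have We : W e by rewrite /e addrC -scaleN1r; apply: WD.
have em : mcoeff m e = mcoeff m w1 by rewrite mcoeffB w20 subr0.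
have e0 : fischer e e != 0.
  by apply/eqP => /fischer_eq0 e0; move: w1m; rewrite -em e0 mcoeff0 eqxx.
(* The coefficient of p - w along e; [cj] appears because the form is conjugate-linear in its second
   argument. *)
pose a := cj (fischer e (p - w)) / fischer e e.
have aE : cj a * fischer e e = fischer e (p - w).
  by rewrite /a rmorphM /= cjK fmorphV /= -fischerC mulfVK.
exists (a *: e + w); first exact: WD.
move=> v Wv; pose c := mcoeff m v / mcoeff m w1.
have -> : v = c *: e + (v - c *: e) by rewrite addrC subrK.
have W'v : W' (v - c *: e).
  split; first by rewrite addrC -scaleNr; apply: WD.
  by rewrite mcoeffB mcoeffZ em /c mulfVK// subrr.
rewrite (_ : p - _ = p - w - a *: e); last by rewrite opprD addrA addrAC.
rewrite fischerDl fischerZl 2!(fischerBr _ (p - w)) !fischerZr.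
by rewrite (wP _ W'v) (w2P _ W'v) aE subrr !mulr0 subr0 addr0.
Qed.

End Fischer.

(** * Hilbert's finiteness theorem for self-adjoint sets of matrices *)

Lemma dickson (n : nat) (P : multinom n -> Prop) : exists s : seq (multinom n),
  {in s, forall m, P m} /\ forall m, P m -> exists2 k, k \in s & lem k m.
Proof.
suff H k : forall P : multinom n -> Prop, exists s : seq (multinom n),
    {in s, forall m, P m} /\
    forall m, P m -> exists2 l, l \in s & forall i : 'I_n, (i < k)%N -> (l i <= m i)%N.
  have [s [sP sm]] := H n P; exists s; split=> // m /sm[l ls lm].
  by exists l => //; apply/mnm_lepP => i; exact: lm.
elim: k => [|k IH] {}P.
  have [[m Pm]|nP] := pselect (exists m, P m); last first.
    by exists [::]; split=> // m Pm; case: nP; exists m.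
  exists [:: m]; split=> [l|l _]; first by rewrite inE => /eqP ->.
  by exists m; rewrite ?inE.
have [nk|kn] := leqP n k.
  have [s [sP sm]] := IH P; exists s; split=> // m /sm[l ls lm].
  by exists l => // i _; apply: lm; apply: leq_trans nk.
pose i0 := Ordinal kn.
have [s [sP sm]] := IH P.
(* An element of P whose coordinate at [i0] is at least B dominates a member of s in that coordinate
   too; the finitely many values below B are treated slice by slice with the induction
   hypothesis. *)
pose B := (\max_(l <- s) l i0)%N.
suff [t [tP tm]] : exists t : seq (multinom n), {in t, forall m, P m} /\
    forall m, P m -> (m i0 < B)%N -> exists2 l, l \in t &
      forall i : 'I_n, (i < k.+1)%N -> (l i <= m i)%N.
  exists (s ++ t); split=> [m|m Pm].
    by rewrite mem_cat => /orP[/sP|/tP].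
  have [mB|Bm] := ltnP (m i0) B.
    by have [l lt lm] := tm m Pm mB; exists l => //; rewrite mem_cat lt orbT.
  have [l ls lm] := sm m Pm; exists l; first by rewrite mem_cat ls.
  move=> i; rewrite ltnS leq_eqVlt => /predU1P[ik|/lm//].
  have -> : i = i0 by apply/val_inj.
  apply: leq_trans Bm; rewrite /B.
  by apply: (@leq_bigmax_seq _ _ xpredT (fun l : multinom n => l i0) l).
elim: B => [|B [t [tP tm]]]; first by exists [::].
have [u [uP um]] := IH (fun m => P m /\ m i0 = B).
exists (u ++ t); split=> [m|m Pm].
  by rewrite mem_cat => /orP[/uP[]|/tP].
rewrite ltnS leq_eqVlt => /predU1P[mB|mB]; last first.
  by have [l lt lm] := tm m Pm mB; exists l => //; rewrite mem_cat lt orbT.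
have [l lu lm] := um m (conj Pm mB); exists l; first by rewrite mem_cat lu.
move=> i; rewrite ltnS leq_eqVlt => /predU1P[ik|/lm//].
have -> : i = i0 by apply/val_inj.
by rewrite (uP _ lu).2 mB.
Qed.

(** * Ideals of polynomials and Hilbert's basis theorem *)

Section Ideal.
Context {n : nat} {K : fieldType}.
Implicit Types (B : mpoly n K -> Prop) (p q b c : mpoly n K).

Inductive ideal B : mpoly n K -> Prop :=
| ideal0 : ideal B 0
| ideal_cons c b p : B b -> ideal B p -> ideal B (c * b + p).

Lemma idealD B p q : ideal B p -> ideal B q -> ideal B (p + q).
Proof.
move=> Bp Bq; elim: Bp => [|c b r Bb _ IH]; first by rewrite add0r.
by rewrite -addrA; exact: ideal_cons.
Qed.

Lemma idealM B c p : ideal B p -> ideal B (c * p).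
Proof.
elim=> [|d b r Bb _ IH]; first by rewrite mulr0; exact: ideal0.
by rewrite mulrDr mulrA; exact: ideal_cons.
Qed.

Lemma idealB B p q : ideal B p -> ideal B q -> ideal B (p - q).
Proof. by move=> Bp Bq; rewrite -mulN1r; apply: idealD => //; exact: idealM. Qed.

Lemma ideal_gen B b : B b -> ideal B b.
Proof. by move=> Bb; rewrite -[b]mul1r -[_ * _]addr0; apply: ideal_cons => //; exact: ideal0. Qed.

Lemma ideal_sub B C p : (forall b, B b -> C b) -> ideal B p -> ideal C p.
Proof. by move=> BC; elim=> [|c b r /BC Cb _ IH]; [exact: ideal0|exact: ideal_cons]. Qed.

Lemma ideal_fin B p : ideal B p -> exists2 bs : seq (mpoly n K),
  {in bs, forall b, B b} & ideal (fun b => b \in bs) p.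
Proof.
elim=> [|c b r Bb _ [bs bsB rbs]]; first by exists [::] => //; exact: ideal0.
exists (b :: bs) => [d|]; first by rewrite inE => /predU1P[->|/bsB].
apply: ideal_cons; first by rewrite inE eqxx.
by apply: ideal_sub rbs => d; rewrite inE orbC => ->.
Qed.

Lemma ideal_seq (bs : seq (mpoly n K)) p : ideal (fun b => b \in bs) p ->
  exists c : 'I_(size bs) -> mpoly n K, p = \sum_i c i * bs`_i.
Proof.
elim=> [|c b r bbs _ [d ->]].
  by exists (fun=> 0); rewrite big1// => i _; rewrite mul0r.
have ib : (index b bs < size bs)%N by rewrite index_mem.
exists (fun i => d i + (if i == Ordinal ib then c else 0)).
under [RHS]eq_bigr do rewrite mulrDl.
rewrite big_split addrC /=; congr (_ + _).
rewrite (bigD1 (Ordinal ib))//= eqxx nth_index// big1 ?addr0// => i /negbTE ->.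
by rewrite mul0r.
Qed.

(** Groebner basis argument: Dickson's lemma selects finitely many leading monomials of the ideal,
    and division by elements realising them lowers the leading monomial. The basis is taken inside B
    itself, so that it inherits invariance and homogeneity. *)
Lemma hilbert_basis B : exists2 bs : seq (mpoly n K),
  {in bs, forall b, B b} & forall p, ideal B p -> ideal (fun b => b \in bs) p.
Proof.
pose P m := exists p, [/\ ideal B p, p != 0 & mlead p = m].
have [s [sP sm]] := dickson P.
have [bs bsB sbs] : exists2 bs : seq (mpoly n K), {in bs, forall b, B b} &
    {in s, forall m, exists p, [/\ ideal (fun b => b \in bs) p, p != 0 & mlead p = m]}.
  elim: {sm} s sP => [|m s IH] sP; first by exists [::].
  have [p [/ideal_fin[cs csB pcs] p0 pm]] : P m by apply: sP; rewrite inE eqxx.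
  have [|bs bsB sbs] := IH; first by move=> k ks; apply: sP; rewrite inE ks orbT.
  exists (cs ++ bs) => [b|k]; first by rewrite mem_cat => /orP[/csB|/bsB].
  rewrite inE => /predU1P[->|/sbs[q [qbs q0 qk]]].
    by exists p; split=> //; apply: ideal_sub pcs => b; rewrite mem_cat => ->.
  by exists q; split=> //; apply: ideal_sub qbs => b; rewrite mem_cat orbC => ->.
exists bs => //; elim/mleadrect => p IH Bp.
have [->|p0] := eqVneq p 0; first exact: ideal0.
have [|k ks kp] := sm (mlead p); first by exists p.
have [r [rbs r0 rk]] := sbs _ ks.
pose c : mpoly n K := (mcoeff (mlead p) p / mcoeff (mlead r) r) *: mpolyX K (mnm_sub (mlead p) k).
have lr : mcoeff (mlead r) r != 0 by rewrite mleadc_eq0.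
have lp : mcoeff (mlead p) p != 0 by rewrite mleadc_eq0.
have c0 : c != 0.
  apply/eqP => /(congr1 (mcoeff (mnm_sub (mlead p) k))).
  rewrite mcoeff0 mcoeffZ mcoeffX eqxx mulr1 => /eqP.
  by rewrite mulf_eq0 invr_eq0 (negbTE lr) (negbTE lp).
have cl : mlead c = mnm_sub (mlead p) k.
  by rewrite /c mleadZ ?mleadXm// mulf_neq0 ?invr_neq0.
have clr : mnm_add (mlead c) (mlead r) = mlead p by rewrite cl rk submK.
have crl : mlead (c * r) = mlead p by rewrite mleadM// clr.
pose q := p - c * r.
have qbs : ideal (fun b => b \in bs) q.
  have [->|q0] := eqVneq q 0; first exact: ideal0.
  have Bq : ideal B q by apply: idealB => //; apply: idealM; apply: ideal_sub rbs.
  apply: IH => //; rewrite lt_neqAle; apply/andP; split; last first.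
    by apply: le_trans (mleadB_le _ _) _; rewrite crl joinxx.
  apply/eqP => ql; move: q0; rewrite -mleadc_eq0 ql mcoeffB -{2}clr mleadcM.
  rewrite mcoeffZ cl mcoeffX eqxx mulr1 mulfVK// subrr eqxx//.
by rewrite -[p](subrK (c * r)) -/q; apply: idealD => //; exact: idealM.
Qed.

End Ideal.

Section InvariantGenerators.
Context {n : nat} {K : numFieldType} (cj : {rmorphism K -> K}).
Hypotheses (cjK : involutive cj) (cj_ge0 : forall x, 0 <= x * cj x).
Variable S : set 'M[K]_n.
Hypothesis S_adj : forall L, S L -> S (adjmx cj L).

Local Notation fischer := (fischer cj).

Definition subst_invariant (p : mpoly n K) := forall L, S L -> linear_subst L p = p.

Lemma subst_invariantD p q :
  subst_invariant p -> subst_invariant q -> subst_invariant (p + q).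
Proof.
by move=> ip iq L SL; rewrite /linear_subst substD; congr (_ + _); [exact: ip|exact: iq].
Qed.

Lemma subst_invariantM p q :
  subst_invariant p -> subst_invariant q -> subst_invariant (p * q).
Proof.
by move=> ip iq L SL; rewrite /linear_subst substM; congr (_ * _); [exact: ip|exact: iq].
Qed.

Lemma subst_invariantC c : subst_invariant (mpolyC n c).
Proof. by move=> L _; exact: substC. Qed.

Lemma subst_invariantZ c p : subst_invariant p -> subst_invariant (c *: p).
Proof. by rewrite -mul_mpolyC => ip; apply: subst_invariantM => //; exact: subst_invariantC. Qed.

Lemma subst_invariant0 : subst_invariant 0.
Proof. by rewrite -(mpolyC0 n K); exact: subst_invariantC. Qed.

Lemma subst_invariantB p q :
  subst_invariant p -> subst_invariant q -> subst_invariant (p - q).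
Proof.
by move=> ip iq; rewrite -scaleN1r; apply: subst_invariantD => //; exact: subst_invariantZ.
Qed.

Lemma subst_invariant_sum (I : Type) (r : seq I) (u : I -> mpoly n K) :
  (forall i, subst_invariant (u i)) -> subst_invariant (\sum_(i <- r) u i).
Proof.
move=> iu; apply: big_ind => //; [exact: subst_invariant0|exact: subst_invariantD].
Qed.

Lemma homogeneous_linear_subst L d (p : mpoly n K) :
  homogeneous d p -> homogeneous d (linear_subst L p).
Proof.
apply: homogeneous_subst => i; apply: big_ind => [||j _].
- exact: homogeneous0.
- exact: homogeneousD.
- apply: homogeneousZ => m; rewrite mcoeffX.
  by have [<-|] := eqVneq (mnm1 j) m; rewrite ?mdeg1 ?eqxx.
Qed.

(** Linear substitutions preserve degrees, so the homogeneous components of [linear_subst L p] are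
    the images of those of p. *)
Lemma subst_invariant_pihomog d p :
  subst_invariant p -> subst_invariant (pihomog (@mdeg n) d p).
Proof.
move=> ip L SL; have [k pk] := mpoly_sum_pihomog p.
have ipk : p = \sum_(e < k) linear_subst L (pihomog (@mdeg n) e p).
  by rewrite -[LHS](ip L SL) [in LHS]pk /linear_subst subst_sum.
have h1 e : homogeneous e (pihomog (@mdeg n) e p) by exact: homogeneous_pihomog.
have h2 e : homogeneous e (linear_subst L (pihomog (@mdeg n) e p)).
  exact: homogeneous_linear_subst.
have := pihomog_sum_homogeneous d k h1; rewrite -pk => E1.
have := pihomog_sum_homogeneous d k h2; rewrite -ipk => E2.
rewrite [RHS]E2; case: ifP E1 => // _ ->.
by rewrite /linear_subst -(mpolyC0 n K) substC.
Qed.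

(** The adjoint of L lies in S and fixes a, so its substitution commutes with multiplication by a;
    taking Fischer adjoints, T commutes with the substitution by L. *)
Lemma subst_invariant_adjoint a (T : mpoly n K -> mpoly n K) q :
  (forall p q, fischer (p * a) q = fischer p (T q)) ->
  subst_invariant a -> subst_invariant q -> subst_invariant (T q).
Proof.
move=> hT ia iq L SL; apply: (fischer_inj cj_ge0) => p.
have -> : L = adjmx cj (adjmx cj L) by rewrite adjmxK.
rewrite -fischer_linear_subst// -!hT.
rewrite -{1}(ia _ (S_adj SL)) /linear_subst -substM -/(linear_subst _ _).
by rewrite fischer_linear_subst// adjmxK// iq.
Qed.

Let generator (b : mpoly n K) := subst_invariant b /\ exists2 d, (0 < d)%N & homogeneous d b.

(* Replaces the Reynolds operator: an invariant orthogonal to all [c * b i] with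
   [c] invariant is killed by the adjoints of the multiplications by the [b i],
   since these adjoints preserve invariance; so it is orthogonal to the ideal. *)
Lemma invariant_combination k (b : 'I_k -> mpoly n K) (dg : 'I_k -> nat) d e :
  (forall i, subst_invariant (b i)) -> (forall i, homogeneous (dg i) (b i)) ->
  subst_invariant e -> homogeneous d e -> (exists g, e = \sum_i g i * b i) ->
  exists c : 'I_k -> mpoly n K, [/\ forall i, subst_invariant (c i),
    forall i m, mcoeff m (c i) != 0 -> (mdeg m + dg i)%N = d &
    e = \sum_i c i * b i].
Proof.
move=> ib hb ie he [g eg].
(* Only combinations graded in degree d are kept: W then involves finitely many monomials, and
   projection onto it is available. *)
pose W w := exists c : 'I_k -> mpoly n K, [/\ forall i, subst_invariant (c i),
    forall i m, mcoeff m (c i) != 0 -> (mdeg m + dg i)%N = d &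
    w = \sum_i c i * b i].
have Wh w : W w -> homogeneous d w.
  move=> [c [ic hc ->]]; apply: big_ind => [||i _ m]; [exact: homogeneous0|exact: homogeneousD|].
  by move/mcoeffM_neq0 => [m1 [m2 [/hc <- /hb <- ->]]]; rewrite mdegD.
have Wi w : W w -> subst_invariant w.
  by move=> [c [ic hc ->]]; apply: subst_invariant_sum => i; exact: subst_invariantM.
have WD : subspace W.
  split.
    exists (fun=> 0); split=> [i|i m|]; first exact: subst_invariant0.
      by rewrite mcoeff0 eqxx.
    by rewrite big1// => i _; rewrite mul0r.
  move=> a _ _ [c [ic hc ->]] [c' [ic' hc' ->]].
  exists (fun i => a *: c i + c' i); split=> [i|i m|].
  - by apply: subst_invariantD => //; exact: subst_invariantZ.
  - rewrite mcoeffD mcoeffZ; have [->|/hc//] := eqVneq (mcoeff m (c i)) 0.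
    by rewrite mulr0 add0r; exact: hc'.
  - rewrite scaler_sumr -big_split; apply: eq_bigr => i _ /=.
    by rewrite mulrDl scalerAl.
have [p m Wp|w Ww wP] := fischer_projection cjK cj_ge0
    (ms := [seq val m | m : bmultinom n d.+1]) WD _ e.
  move=> /(Wh _ Wp) md; have md1 : (mdeg m < d.+1)%N by rewrite md.
  by apply/mapP; exists (BMultinom md1) => //; rewrite mem_enum.
suff e0 : e - w = 0 by move/eqP: e0; rewrite subr_eq0 => /eqP ->.
apply: (fischer_eq0 cj_ge0).
have [c [_ _ wc]] := Ww.
rewrite {1}eg {1}wc -sumrB; rewrite fischer_suml// big1// => i _; rewrite -mulrBl.
have [T hT] := fischer_mul_adjoint cjK (b i).
suff T0 : T (e - w) = 0 by rewrite hT T0 fischer0r.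
have iew : subst_invariant (e - w) by apply: subst_invariantB => //; exact: Wi.
have hew : homogeneous d (e - w).
  by rewrite -scaleN1r; apply: homogeneousD => //; apply: homogeneousZ; exact: Wh.
apply: (fischer_eq0 cj_ge0); rewrite -hT; apply: wP.
(* The product [T (e - w) * b i] lies in W; its orthogonality to e - w reads <T (e - w), T (e - w)>
   = 0. *)
exists (fun j => if j == i then T (e - w) else 0); split=> [j|j m|].
- by case: ifP => _; [exact: subst_invariant_adjoint|exact: subst_invariant0].
- case: ifP => [/eqP ->|_]; last by rewrite mcoeff0 eqxx.
  exact: (homogeneous_adjoint hT (hb i) hew).
- by rewrite (bigD1 i)//= eqxx big1 ?addr0// => j /negbTE ->; rewrite mul0r.
Qed.

(** Hilbert's induction on the degree: the generators are a finite basis of the ideal of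
    positive-degree homogeneous invariants, and the coefficients of an invariant combination are
    invariants of smaller degree. The bound on Q is the part that the entropy needs. *)
Lemma invariant_generators : exists k (b : 'I_k -> mpoly n K),
  (forall i, subst_invariant (b i)) /\
  forall d p, subst_invariant p -> deg_le d p ->
    exists2 Q : mpoly k K, deg_le d Q & p = subst_mpoly b Q.
Proof.
have [bs bsB bsI] := hilbert_basis generator.
pose b (i : 'I_(size bs)) := bs`_i.
have ib i : subst_invariant (b i) by have [] := bsB _ (mem_nth 0 (ltn_ord i)).
have /choice[dg hdg] i : exists d, (0 < d)%N /\ homogeneous d (b i).
  by have [_ [d d0 hd]] := bsB _ (mem_nth 0 (ltn_ord i)); exists d.
have H d : forall e, subst_invariant e -> homogeneous d e ->
    exists2 Q : mpoly (size bs) K, deg_le d Q & e = subst_mpoly b Q.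
  elim/ltn_ind: d => -[|d] IH e ie he.
    exists (mpolyC _ (mcoeff mnm0 e)); first exact: deg_leC.
    rewrite substC; apply/mpolyP => m; rewrite mcoeffC.
    have [->|m0] := eqVneq m mnm0; first by rewrite mulr1.
    rewrite mulr0; apply/eqP/negPn/negP => /he/eqP.
    by rewrite mdeg_eq0 (negbTE m0).
  have eI : ideal generator e by apply: ideal_gen; split=> //; exists d.+1.
  have [c eg] := ideal_seq (bsI _ eI).
  have [|{c eg}c [ic hc ec]] := invariant_combination ib (fun i => (hdg i).2) ie he.
    by exists c.
  have /choice[Q hQ] i : exists Q : mpoly (size bs) K,
      deg_le (d.+1 - dg i) Q /\ c i = subst_mpoly b Q.
    have [||Q dQ cQ] := IH (d.+1 - dg i)%N _ (c i) (ic i).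
    - by have := (hdg i).1; lia.
    - by move=> m /hc <-; rewrite addnK.
    - by exists Q.
  exists (\sum_i Q i * mpolyX K (mnm1 i)).
    apply: big_ind => [||i _]; [by rewrite -(mpolyC0 _ K); exact: deg_leC|exact: deg_leD|].
    (* As [dg i > 0], trading [b i] for a variable of degree one does not raise the total degree. *)
    apply: (deg_le_leq (d := (d.+1 - dg i + 1)%N)); first by have := (hdg i).1; lia.
    by apply: deg_leM; [exact: (hQ i).1|exact: deg_leX].
  rewrite subst_sum ec; apply: eq_bigr => i _.
  by rewrite substM substX (hQ i).2.
exists (size bs), b; split=> // d p ip dp.
have [k pk] := mpoly_sum_pihomog p.
have /choice[Q hQ] (i : 'I_k) : exists Q : mpoly (size bs) K,
    deg_le d Q /\ pihomog (@mdeg n) i p = subst_mpoly b Q.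
  have [id|di] := leqP i d; last first.
    exists 0; split; first by rewrite -(mpolyC0 _ K); exact: deg_leC.
    rewrite -(mpolyC0 _ K) substC mpolyC0 pihomogE big_seq_cond big1// => m /andP[mp /eqP mi].
    by move: mp di; rewrite mcoeff_msupp -mi ltnNge => /dp ->.
  have [Q dQ pQ] := H i _ (subst_invariant_pihomog i ip) (@homogeneous_pihomog _ _ i p).
  by exists Q; split=> //; exact: deg_le_leq dQ.
exists (\sum_i Q i).
  apply: big_ind => [||i _]; [by rewrite -(mpolyC0 _ K); exact: deg_leC|exact: deg_leD|].
  exact: (hQ i).1.
by rewrite subst_sum [LHS]pk; apply: eq_bigr => i _; exact: (hQ i).2.
Qed.

End InvariantGenerators.

(** * Words in a free group *)

Section FreeWords.
Context {gT : groupType} {I : finType} (x : I -> gT).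
Local Open Scope group_scope.

Notation letter_t := (I * bool)%type.
Implicit Types (l : letter_t) (w u v p q : seq letter_t) (a b c : gT).

Definition linv l : letter_t := (l.1, ~~ l.2).

Definition winv w := rev (map linv w).

Definition follows l l' : bool := ~~ ((l.1 == l'.1) && (l.2 != l'.2)).

Lemma linvK : involutive linv.
Proof. by case=> i e; rewrite /linv /= negbK. Qed.

Lemma followsE l l' : follows l l' = (l' != linv l).
Proof.
case: l l' => [i e] [j e']; rewrite /follows /linv /= -pair_eqE /= /pair_eq /= eq_sym.
by case: e e' => [] [].
Qed.

Lemma follows_linvl l l' : follows (linv l) l' = (l' != l).
Proof. by rewrite followsE linvK. Qed.

Lemma reducedE w : reduced w = sorted follows w. Proof. by []. Qed.

Lemma size_winv w : size (winv w) = size w.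
Proof. by rewrite size_rev size_map. Qed.

Lemma winvK : involutive winv.
Proof.
move=> w; rewrite /winv map_rev revK -map_comp (eq_map (g := id)) ?map_id// => l /=.
by rewrite linvK.
Qed.

Lemma winv_cons l w : winv (l :: w) = rcons (winv w) (linv l).
Proof. by rewrite /winv /= rev_cons. Qed.

Lemma word_eval_nil : word_eval x [::] = 1.
Proof. by rewrite /word_eval big_nil. Qed.

Lemma word_eval_cons l w : word_eval x (l :: w) = letter x l * word_eval x w.
Proof. by rewrite /word_eval big_cons. Qed.

Lemma word_eval_cat u v : word_eval x (u ++ v) = word_eval x u * word_eval x v.
Proof. by rewrite /word_eval big_cat. Qed.

Lemma letter_linv l : letter x (linv l) = (letter x l)^-1.
Proof. by case: l => i []; rewrite /letter //= invgK. Qed.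

Lemma word_eval_winv w : word_eval x (winv w) = (word_eval x w)^-1.
Proof.
elim: w => [|l w IH]; first by rewrite word_eval_nil invg1.
rewrite winv_cons -cats1 word_eval_cat IH !word_eval_cons word_eval_nil mulg1.
by rewrite letter_linv invgM.
Qed.

Lemma word_eval_conj v w :
  word_eval x (winv v ++ w ++ v) = word_eval x w ^ word_eval x v.
Proof. by rewrite !word_eval_cat word_eval_winv /conjg. Qed.

Lemma not_reduced w : ~~ reduced w -> exists u l v, w = u ++ l :: linv l :: v.
Proof.
case: w => [//|l w]; rewrite reducedE /=.
elim: w l => [//|l' w IH] l /=; rewrite negb_and => /orP[|/IH[u [k [v ->]]]].
  by rewrite followsE negbK => /eqP ->; exists [::], l, w.
by exists (l :: u), k, v.
Qed.

Lemma cancel_word_eval u l v : word_eval x (u ++ l :: linv l :: v) = word_eval x (u ++ v).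
Proof. by rewrite !word_eval_cat !word_eval_cons letter_linv mulVKg. Qed.

Lemma exists_reduced w : exists w',
  [/\ reduced w', (size w' <= size w)%N & word_eval x w' = word_eval x w].
Proof.
have [n] := ubnP (size w); elim: n w => // n IH w; rewrite ltnS => wn.
have [rw|/not_reduced[u [l [v e]]]] := boolP (reduced w); first by exists w.
have [|w' [rw' sw' ew']] := IH (u ++ v).
  by apply: leq_trans wn; rewrite e !size_cat /=; lia.
exists w'; split=> //; last by rewrite ew' e cancel_word_eval.
by apply: leq_trans sw' _; rewrite e !size_cat /=; lia.
Qed.

Lemma reduced_cyclic_decomposition w : reduced w -> exists p q,
  w = p ++ q ++ winv p /\ cycle follows q.
Proof.
have [n] := ubnP (size w); elim: n w => // n IH w; rewrite ltnS => wn rw.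
have [cw|ncw] := boolP (cycle follows w); first by exists [::], w; rewrite cats0.
case: w => [//|l w] in wn rw ncw *.
move: ncw; rewrite /= rcons_path negb_and.
have -> /= : path follows l w by exact: rw.
rewrite followsE negbK => /eqP e.
case/lastP: w => [|w l'] in wn rw e *.
  by move: e; rewrite /= /linv; case: l {wn rw} => i [].
move: e; rewrite last_rcons => e.
have [p [q [-> cq]]] : exists p q, w = p ++ q ++ winv p /\ cycle follows q.
  apply: IH; first by apply: leq_trans wn; rewrite /= size_rcons.
  by move: rw; rewrite !reducedE /= rcons_path => /andP[/path_sorted].
exists (l :: p), q; split=> //.
by rewrite winv_cons -cats1 /= -!catA -[l']linvK -e cats1.
Qed.

Definition word_mx (K : comNzRingType) (d : nat) (Y : letter_t -> 'M[K]_d) w : 'M[K]_d :=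
  foldr (fun l A => (Y l *m A)%R) 1%:M%R w.

Section WordMatrix.
Local Open Scope ring_scope.
Context {K : comNzRingType} {d : nat} (Y : letter_t -> 'M[K]_d).

Lemma word_mx_cons l w : word_mx Y (l :: w) = Y l *m word_mx Y w.
Proof. by []. Qed.

Lemma word_mx_cat u v : word_mx Y (u ++ v) = word_mx Y u *m word_mx Y v.
Proof. by elim: u => [|l u IH] /=; rewrite ?mul1mx// IH mulmxA. Qed.

Hypothesis YV : forall l, Y l *m Y (linv l) = 1%:M.

Lemma word_mx_winv w : word_mx Y w *m word_mx Y (winv w) = 1%:M.
Proof.
elim: w => [|l w IH]; first by rewrite mulmx1.
rewrite winv_cons -cats1 word_mx_cat /= mulmx1 -mulmxA.
by rewrite [word_mx Y w *m _]mulmxA IH mul1mx YV.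
Qed.

Hypothesis freex : free_basis x.

Lemma word_mx1 w : word_eval x w = 1%g -> word_mx Y w = 1%:M.
Proof.
have [n] := ubnP (size w); elim: n w => // n IH w; rewrite ltnS => wn w1.
have [rw|/not_reduced[u [l [v e]]]] := boolP (reduced w); first by rewrite (freex.2 w).
have uv : word_mx Y (u ++ v) = 1%:M.
  apply: IH; first by apply: leq_trans wn; rewrite e !size_cat /=; lia.
  by rewrite -(cancel_word_eval u l v) -e.
by rewrite -uv e !word_mx_cat /= [Y l *m _]mulmxA YV mul1mx.
Qed.

Lemma word_mx_eval w w' : word_eval x w = word_eval x w' -> word_mx Y w = word_mx Y w'.
Proof.
move=> e; have : word_mx Y (w ++ winv w') = 1%:M.
  by apply: word_mx1; rewrite word_eval_cat word_eval_winv e mulgV.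
rewrite word_mx_cat => /(congr1 (mulmx^~ (word_mx Y w'))).
have wV : word_mx Y (winv w') *m word_mx Y w' = 1%:M.
  by rewrite -{2}[w']winvK word_mx_winv.
by rewrite -mulmxA wV mulmx1 mul1mx.
Qed.

(** Universal property of the free group: a word is chosen for each element, and [word_mx_eval]
    makes the choice irrelevant. *)
Lemma free_hom : exists phi : gT -> 'M[K]_d, forall w, phi (word_eval x w) = word_mx Y w.
Proof.
have /choice[W WP] a : exists w, word_eval x w = a by exact: freex.1.
by exists (fun a => word_mx Y (W a)) => w; apply: word_mx_eval.
Qed.

End WordMatrix.

End FreeWords.

(** * Poles of the ping-pong representation *)

Section Poles.
Context {K : numFieldType} (T : K -> Prop).
Hypotheses (T_inf : forall s : seq K, exists2 t, T t & t \notin s).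
Implicit Types (h : K -> K) (p q : {poly K}).

Lemma horner_inj p q : (forall t, T t -> p.[t] = q.[t]) -> p = q.
Proof.
move=> pq; apply/eqP; rewrite -subr_eq0; apply/negPn/negP => d0.
have [s [sT us sz]] : exists s : seq K,
    [/\ {in s, forall t, T t}, uniq s & size s = size (p - q)].
  elim: (size _) => [|m [s [sT us sz]]]; first by exists [::].
  have [t Tt ts] := T_inf s; exists (t :: s); split=> /=.
  - by move=> r; rewrite inE => /predU1P[->|/sT].
  - by rewrite ts.
  - by rewrite sz.
have : all (root (p - q)) s.
  by apply/allP => t /sT Tt; rewrite /root hornerD hornerN pq// subrr.
by move=> /(max_poly_roots d0)/(_ us); rewrite sz ltnn.
Qed.

(** The pole at 0 is read off from values on T, which may stay away from 0: when T is infinite,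
    [horner_inj] makes the polynomial unique. *)
Definition pole_le (d : nat) h := exists q, forall t, T t -> t ^+ d * h t = q.[t].

Definition pole_eq (d : nat) h :=
  exists2 q, q.[0] != 0 & forall t, T t -> t ^+ d * h t = q.[t].

Lemma eq_pole_le d h h' : (forall t, T t -> h t = h' t) -> pole_le d h -> pole_le d h'.
Proof. by move=> hh' [q qh]; exists q => t Tt; rewrite -hh'// qh. Qed.

Lemma pole_le_const c : pole_le 0 (fun=> c).
Proof. by exists c%:P => t _; rewrite hornerC mul1r. Qed.

Lemma pole_le_leq d e h : (d <= e)%N -> pole_le d h -> pole_le e h.
Proof.
move=> de [q qh]; exists ('X^(e - d) * q) => t Tt.
by rewrite hornerM hornerXn -qh// mulrA -exprD subnK.
Qed.

Lemma pole_leD d h h' : pole_le d h -> pole_le d h' -> pole_le d (fun t => h t + h' t).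
Proof.
by move=> [q qh] [q' qh']; exists (q + q') => t Tt; rewrite mulrDr hornerD qh ?qh'.
Qed.

Lemma pole_leM d e h h' :
  pole_le d h -> pole_le e h' -> pole_le (d + e) (fun t => h t * h' t).
Proof.
move=> [q qh] [q' qh']; exists (q * q') => t Tt.
by rewrite exprD mulrACA hornerM qh ?qh'.
Qed.

Lemma pole_leZ d c h : pole_le d h -> pole_le d (fun t => c * h t).
Proof. by move=> dh; rewrite -[d]add0n; apply: pole_leM => //; exact: pole_le_const. Qed.

Lemma pole_leXn d h k : pole_le d h -> pole_le (d * k) (fun t => h t ^+ k).
Proof.
move=> [q qh]; exists (q ^+ k) => t Tt.
by rewrite exprM -exprMn horner_exp qh.
Qed.

Lemma pole_eq_le d e h : pole_eq d h -> pole_le e h -> (d <= e)%N.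
Proof.
move=> [q q0 qh] [r rh]; rewrite leqNgt; apply/negP => ed; move/eqP: q0; apply.
have -> : q = 'X^(d - e) * r.
  apply: horner_inj => t Tt; rewrite -qh// hornerM hornerXn -rh//.
  by rewrite mulrA -exprD subnK// ltnW.
by rewrite hornerM hornerXn expr0n subn_eq0 leqNgt ed mul0r.
Qed.

Lemma pole_eqXn d h k : pole_eq d h -> pole_eq (d * k) (fun t => h t ^+ k).
Proof.
move=> [q q0 qh]; exists (q ^+ k); first by rewrite horner_exp expf_neq0.
by move=> t Tt; rewrite exprM -exprMn horner_exp qh.
Qed.

Lemma pole_eq_affine_le d e h a c k : a != 0 -> (0 < k)%N -> pole_eq d h ->
  pole_le e (fun t => c + a * h t ^+ k) -> (d <= e)%N.
Proof.
move=> a0 k0 dh eh; have : (d * k <= e)%N.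
  apply: pole_eq_le (pole_eqXn k dh) _.
  have := pole_leZ a^-1 (pole_leD eh (pole_le_leq (leq0n e) (pole_le_const (- c)))).
  by apply: eq_pole_le => t _; rewrite addrAC subrr add0r mulKf.
by apply: leq_trans; rewrite leq_pmulr.
Qed.

End Poles.

Section TwoByTwo.
Context {K : comNzRingType}.
Implicit Types a b c d : K.

Lemma ord2_cases (i : 'I_2) : i = 0 \/ i = 1.
Proof. by case: i => [[|[|//]] hi]; [left|right]; exact: val_inj. Qed.

Definition mx2 a b c d : 'M[K]_2 :=
  \matrix_(i, j) if i == 0 then if j == 0 then a else b else if j == 0 then c else d.

Lemma mx2_eta (A : 'M[K]_2) : A = mx2 (A 0 0) (A 0 1) (A 1 0) (A 1 1).
Proof.
by apply/matrixP => i j; rewrite mxE; case: (ord2_cases i) => ->; case: (ord2_cases j) => ->.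
Qed.

Lemma mx2M a b c d a' b' c' d' : mx2 a b c d *m mx2 a' b' c' d' =
  mx2 (a * a' + b * c') (a * b' + b * d') (c * a' + d * c') (c * b' + d * d').
Proof.
apply/matrixP => i j; rewrite !mxE !big_ord_recl big_ord0 !mxE addr0 /=.
by case: (ord2_cases i) => ->; case: (ord2_cases j) => ->.
Qed.

Lemma mx2_1 : 1%:M = mx2 1 0 0 1.
Proof.
apply/matrixP => i j; rewrite !mxE.
by case: (ord2_cases i) => ->; case: (ord2_cases j) => ->.
Qed.

Lemma mx2_tr a b c d : \tr (mx2 a b c d) = a + d.
Proof. by rewrite /mxtrace !big_ord_recl big_ord0 addr0 !mxE. Qed.

Lemma mx2_det a b c d : \det (mx2 a b c d) = a * d - b * c.
Proof.
rewrite (expand_det_row _ 0) !big_ord_recl big_ord0 addr0 /cofactor !mxE /=.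
by rewrite !det_mx11 !mxE /= expr0 expr1 mul1r mulN1r mulrN.
Qed.

End TwoByTwo.

Section PingPong.
Context {K : numFieldType} {I : finType}.
Implicit Types (l m : I * bool) (w s : seq (I * bool)) (t : K).

(* Conjugate of [diag(1/t, t)] by the matrix with columns [(1, k)] and [(- k, 1)]. *)
Definition hyperbolic (k t : K) : 'M[K]_2 :=
  mx2 ((t^-1 + k ^+ 2 * t) / (1 + k ^+ 2)) (k * (t^-1 - t) / (1 + k ^+ 2))
      (k * (t^-1 - t) / (1 + k ^+ 2)) ((k ^+ 2 * t^-1 + t) / (1 + k ^+ 2)).

(** Distinct nonnegative integers are generic enough: the pairings of eigenvectors are 1 + k k' or,
    up to sign, k - k', and in a reduced word the latter occurs only between distinct generators. *)
Definition slope l : K := (enum_rank l.1)%:R.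

Definition pingpong t l : 'M[K]_2 := hyperbolic (slope l) (if l.2 then t^-1 else t).

Lemma slope_denom l : 1 + slope l ^+ 2 != 0.
Proof. by rewrite /slope -natrX nat1r pnatr_eq0. Qed.

Lemma pingpong_linv t l : t != 0 -> pingpong t l *m pingpong t (linv l) = 1%:M.
Proof.
case: l => i e t0; have := slope_denom (i, e).
rewrite /pingpong /hyperbolic /linv /slope /= mx2M mx2_1; move: (_%:R) => k k0.
by case: e; rewrite /= ?invrK; congr mx2; field; rewrite t0 k0.
Qed.

Lemma pingpong_det t l : t != 0 -> \det (pingpong t l) = 1.
Proof.
move=> t0; rewrite /pingpong /hyperbolic mx2_det; have := slope_denom l.
move: (slope l) => k k0.
by case: (l.2); rewrite ?invrK; field; rewrite t0 k0.
Qed.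

(** Eigenvector of [pingpong t l] for the eigenvalue t^-1, the one with the pole. *)
Definition eigvec l : 'cV[K]_2 :=
  \col_i if l.2 then if i == 0 then - slope l else 1 else if i == 0 then 1 else slope l.

Definition eigdot l m : K := ((eigvec l)^T *m eigvec m) 0 0.

Lemma eigdot_neq0 l m : follows l m -> eigdot l m != 0.
Proof.
rewrite followsE /eigdot !mxE !big_ord_recl big_ord0 !mxE /= addr0.
case: l m => [i e] [j e']; rewrite /linv /slope /= -pair_eqE /= /pair_eq /=.
have ijN : i != j -> (enum_rank i)%:R - (enum_rank j)%:R != 0 :> K.
  apply: contraNneq => /eqP; rewrite subr_eq0 eqr_nat => /eqP h.
  by apply/eqP/enum_rank_inj/val_inj.
have pos : 1 + (enum_rank i)%:R * (enum_rank j)%:R != 0 :> K.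
  by rewrite -natrM nat1r pnatr_eq0.
case: e e' => [] []; rewrite /= ?andbT ?andbF ?mulrNN ?mul1r ?mulr1 ?[_ + 1]addrC => h //.
- by rewrite -oppr_eq0 opprD opprK ijN// eq_sym.
- by rewrite addrC ijN// eq_sym.
Qed.

Definition eigmx l : 'M[K]_2 := eigvec l *m (eigvec l)^T.

(** Spectral decomposition of [t *: pingpong t l]: the eigenvalues become 1 and t^2, and the
    projections onto the orthogonal eigenlines are v v^T / (1 + k^2). At t = 0 a matrix of rank one
    is left. *)
Definition pingpong_poly l : 'M[{poly K}]_2 :=
  (1 + slope l ^+ 2)^-1%:P *:
    (map_mx polyC (eigmx l) + 'X^2 *: map_mx polyC (eigmx (linv l))).

Local Notation ev t := (map_mx (horner_eval t)).

Lemma ev_pingpong_poly t l : t != 0 -> ev t (pingpong_poly l) = t *: pingpong t l.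
Proof.
move=> t0; apply/matrixP => i j.
rewrite !mxE !big_ord_recl !big_ord0 !mxE /horner_eval !hornerE /slope /= -/(slope l).
have := slope_denom l; move: (slope l) => k k0.
by case: l.2; case: (ord2_cases i) => ->; case: (ord2_cases j) => -> /=;
  rewrite ?invrK; field; rewrite ?t0 ?k0.
Qed.

Lemma word_mx_ev t w : t != 0 ->
  ev t (word_mx pingpong_poly w) = t ^+ size w *: word_mx (pingpong t) w.
Proof.
move=> t0; elim: w => [|l w IH]; first by rewrite /= map_mx1 scale1r.
by rewrite /= map_mxM /= IH ev_pingpong_poly// -scalemxAl -scalemxAr scalerA exprS.
Qed.

(** A product of rank-one matrices v v^T collapses to the pairings of consecutive vectors, which are
    non-zero because the word is reduced. *)
Lemma word_mx_ev0 l s : path follows l s -> exists2 c : K, c != 0 &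
  ev 0 (word_mx pingpong_poly (l :: s)) = c *: (eigvec l *m (eigvec (last l s))^T).
Proof.
have ev0 m : ev 0 (pingpong_poly m) = (1 + slope m ^+ 2)^-1 *: eigmx m.
  apply/matrixP => i j; rewrite !mxE !big_ord_recl !big_ord0 !mxE /horner_eval !hornerE /=.
  by rewrite expr0n /= !mul0r addr0 mulrA.
elim: s l => [|m s IH] l.
  exists (1 + slope l ^+ 2)^-1; first by rewrite invr_neq0 ?slope_denom.
  by rewrite /= mulmx1 ev0.
rewrite /= => /andP[lm /IH[c c0 e]]; exists ((1 + slope l ^+ 2)^-1 * eigdot l m * c).
  by rewrite !mulf_neq0 ?invr_neq0 ?slope_denom ?eigdot_neq0.
rewrite -/(word_mx _ (m :: s)) map_mxM /= e ev0 /eigmx -scalemxAl -scalemxAr scalerA.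
rewrite -mulmxA [(eigvec l)^T *m _]mulmxA.
have -> : (eigvec l)^T *m eigvec m = (eigdot l m)%:M.
  by apply/matrixP => i j; rewrite !ord1 [RHS]mxE eqxx mulr1n.
by rewrite mul_scalar_mx -scalemxAr scalerA mulrAC.
Qed.

Lemma pole_le_word_mx w i j :
  pole_le (fun t => t != 0) (size w) (fun t => word_mx (pingpong t) w i j).
Proof.
exists (word_mx pingpong_poly w i j) => t t0.
by have /matrixP/(_ i j) := word_mx_ev w t0; rewrite !mxE => <-.
Qed.

Lemma pole_le_trace w :
  pole_le (fun t => t != 0) (size w) (fun t => \tr (word_mx (pingpong t) w)).
Proof.
apply: eq_pole_le (pole_leD (pole_le_word_mx w 0 0) (pole_le_word_mx w 1 1)) => t _.
by rewrite /mxtrace !big_ord_recl big_ord0 addr0; congr (_ + word_mx _ _ _ _); apply/val_inj.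
Qed.

Lemma pole_eq_trace w : cycle follows w ->
  pole_eq (fun t => t != 0) (size w) (fun t => \tr (word_mx (pingpong t) w)).
Proof.
move=> cw; exists (\tr (word_mx pingpong_poly w)); last first.
  by move=> t t0; rewrite -mxtraceZ -word_mx_ev// -[RHS](trace_map_mx (horner_eval t)).
rewrite -[_.[_]](trace_map_mx (horner_eval 0)).
(* The empty word gives tr 1 = 2. Otherwise the trace closes the chain with the pairing of the last
   and first eigenvectors, where cyclic reducedness is needed. *)
case: w cw => [_|l s]; first by rewrite /= map_mx1 mxtrace1 pnatr_eq0.
rewrite /= rcons_path => /andP[/word_mx_ev0[c c0 /= ->] ls].
by rewrite mxtraceZ mxtrace_mulC trace_mx11 mulf_neq0//; exact: eigdot_neq0.
Qed.

End PingPong.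

(** * Cyclic length and simultaneous conjugation *)

Lemma leastP (P : set nat) : (exists n, P n) ->
  P (least P) /\ forall m, P m -> (least P <= m)%N.
Proof.
move=> [n Pn]; rewrite /least; case: xgetP => [m _ [Pm mmin]//|/= noP].
have exP : exists k, `[< P k >] by exists n; apply/asboolP.
have [k /asboolP Pk kmin] := ex_minnP exP.
by have [] := noP k; split=> // m Pm; apply: kmin; apply/asboolP.
Qed.

Section CyclicLength.
Context {gT : groupType} {I : finType} (x : I -> gT).
Hypothesis freex : free_basis x.
Local Open Scope group_scope.
Implicit Types (a b c : gT) (u v w : seq (I * bool)).

Lemma trace_word_mx_conj (K : comNzRingType) d (Y : I * bool -> 'M[K]_d) w w' c :
  (forall l, Y l *m Y (linv l) = 1%:M)%R ->
  word_eval x w' = word_eval x w ^ c ->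
  (\tr (word_mx Y w') = \tr (word_mx Y w))%R.
Proof.
move=> YV; have [v <-] := freex.1 c; rewrite -word_eval_conj => e.
rewrite (word_mx_eval YV freex e) !word_mx_cat mulmxA mxtrace_mulC mulmxA.
by rewrite word_mx_winv// mul1mx.
Qed.

Lemma exists_nonzero_notin (K : numFieldType) (s : seq K) : exists2 t : K, t != 0%R & t \notin s.
Proof.
pose r : seq K := [seq (i.+1)%:R%R | i <- iota 0 (size s).+1].
have ur : uniq r by rewrite map_inj_uniq ?iota_uniq// => i j /eqP; rewrite eqr_nat => /eqP[].
have /allPn[t tr ts] : ~~ all (mem s) r.
  apply/negP => /allP rs; have := uniq_leq_size ur rs.
  by rewrite size_map size_iota ltnn.
by exists t => //; move/mapP: tr => [i _ ->]; rewrite pnatr_eq0.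
Qed.

(** The pole order of the trace is a conjugacy invariant; it equals the size of a cyclically reduced
    word and is at most the size of any word. *)
Lemma cycle_size_le w w' c : cycle (@follows I) w ->
  word_eval x w' = word_eval x w ^ c -> (size w <= size w')%N.
Proof.
move=> cw e; have pw := @pole_eq_trace rat I w cw.
apply: (pole_eq_le (@exists_nonzero_notin _) pw).
apply: eq_pole_le (pole_le_trace w') => t t0.
by apply: (trace_word_mx_conj _ e) => l; exact: pingpong_linv.
Qed.

Lemma cyclic_length_cycle w a c : cycle (@follows I) w ->
  word_eval x w = a ^ c -> cyclic_length x a = size w.
Proof.
move=> cw e; have [|[w' [c' [sw' ew']]] min] := @leastP
    [set n | exists w c, size w = n /\ word_eval x w = a ^ c].
  by exists (size w), w, c.
apply/eqP; rewrite eqn_leq; apply/andP; split.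
  by apply: min; exists w, c.
rewrite /cyclic_length -sw'; apply: (@cycle_size_le _ _ (c^-1 * c')) => //.
by rewrite ew' e conjgM conjgK.
Qed.

Lemma cyclic_length_conj a c : cyclic_length x (a ^ c) = cyclic_length x a.
Proof.
rewrite /cyclic_length; congr least; apply/seteqP; split=> n [w [d [sw ew]]].
  by exists w, (c * d); split=> //; rewrite conjgM.
by exists w, (c^-1 * d); split=> //; rewrite conjgM conjgK.
Qed.

Lemma exists_cyclic_word a : exists w c,
  [/\ cycle (@follows I) w, word_eval x w = a ^ c & size w = cyclic_length x a].
Proof.
have [u <-] := freex.1 a; have [w [rw _ <-]] := exists_reduced x u.
have [p [q [-> cq]]] := reduced_cyclic_decomposition rw.
have e : word_eval x q = word_eval x (p ++ q ++ winv p) ^ word_eval x p.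
  by rewrite !word_eval_cat word_eval_winv conjgE !mulgA mulVg mul1g mulgVK.
by exists q, (word_eval x p); split=> //; rewrite (cyclic_length_cycle cq e).
Qed.

Definition length_le n a := exists2 w, (size w <= n)%N & word_eval x w = a.

Lemma length_le_conj_letter n a l : length_le n a -> length_le (n + 2) (a ^ letter x l).
Proof.
move=> [w sw <-]; exists (linv l :: w ++ [:: l]); first by rewrite /= size_cat addn2 /= addn1.
by rewrite word_eval_cons word_eval_cat word_eval_cons word_eval_nil mulg1 letter_linv.
Qed.

(* [a] moves the base point of the Cayley tree to distance
   [2 * size p + cyclic_length a], [size p] being the distance to its axis. *)
Lemma length_le_decomposition n a : length_le n a -> exists p q,
  [/\ word_eval x (p ++ q ++ winv p) = a, reduced (p ++ q ++ winv p),
      size q = cyclic_length x a & ((size p).*2 + cyclic_length x a <= n)%N].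
Proof.
move=> [u un <-]; have [w [rw wu <-]] := exists_reduced x u.
have [p [q [e cq]]] := reduced_cyclic_decomposition rw.
have sq : size q = cyclic_length x (word_eval x w).
  rewrite (@cyclic_length_cycle q _ (word_eval x p))// e.
  by rewrite !word_eval_cat word_eval_winv conjgE !mulgA mulVg mul1g mulgVK.
exists p, q; rewrite -e -sq; split=> //; apply: leq_trans un; apply: leq_trans wu.
by rewrite e !size_cat size_winv; lia.
Qed.

(** Two axes reached from the base point through different first edges: nothing cancels in the
    product, even cyclically, so its translation length is the sum of the word lengths. *)
Lemma cycle_join l m s s' :
  path (@follows I) l s -> path (@follows I) m s' ->
  last l s = linv l -> last m s' = linv m -> l != m ->
  cycle (@follows I) ((l :: s) ++ (m :: s')).
Proof.
move=> ps ps' ls ls' lm; rewrite /= rcons_path cat_path /= last_cat /= ps ps' ls ls'.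
by rewrite !follows_linvl [m == l]eq_sym lm.
Qed.

(* Serre's lemma for the action on the Cayley tree: if the [a j] and their
   pairwise products have small translation lengths, the axes of the [a j] are
   pairwise close, so some vertex is moved little by all the [a j]. *)
Lemma simultaneous_conjugation (J : finType) (a : J -> gT) (L : nat) :
  (forall j, cyclic_length x (a j) <= L)%N ->
  (forall i j, cyclic_length x (a i * a j) <= L)%N ->
  exists c, forall j, length_le (5 * L) (a j ^ c).
Proof.
move=> aL aaL.
(* For L = 0 all the [a j] are trivial; afterwards L >= 1 absorbs additive constants. *)
have [L0|L0] := posnP L.
  exists 1 => j; exists [::] => //; rewrite word_eval_nil.
  have [w [c [_ + sw]]] := exists_cyclic_word (a j).
  have /size0nil -> : size w = 0%N by have := aL j; rewrite -sw L0 leqn0 => /eqP.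
  by rewrite word_eval_nil => /esym/eqP; rewrite conjg_eq1 => /eqP ->; rewrite conj1g.
(* M bounds the distance from the vertex c to the axes of all the [a j]; a vertex with the least M
   is studied. *)
pose P M := exists c, forall j, length_le (cyclic_length x (a j) + M.*2) (a j ^ c).
have exP : exists M, `[< P M >].
  have /choice[w hw] j : exists w, word_eval x w = a j by exact: freex.1.
  exists (\sum_j size (w j))%N; apply/asboolP; exists 1 => j.
  rewrite conjg1; exists (w j) => //.
  rewrite (bigD1 j)//=; lia.
have [M /asboolP[c cM] Mmin] := ex_minnP exP.
suff ML : (M.*2 <= 4 * L)%N.
  exists c => j; have [w sw ew] := cM j; exists w => //.
  by apply: leq_trans sw _; have := aL j; lia.
have [M2|M2] := leqP M 1; first by lia.
have /choice[p /choice[q hpq]] j := length_le_decomposition (cM j).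
have pM j : (size (p j) <= M)%N.
  by have [_ _ _] := hpq j; rewrite cyclic_length_conj; lia.
(* By minimality some axis is at distance exactly M. *)
have [i iM] : exists i, size (p i) = M.
  apply: contrapT => /forallNP h.
  have : P M.-1.
    exists c => j; have [e _ sq _] := hpq j; exists (p j ++ q j ++ winv (p j)) => //.
    rewrite !size_cat size_winv sq cyclic_length_conj.
    by have := h j; have := pM j; lia.
  by move=> /asboolP/Mmin; lia.
case pi : (p i) => [|l s]; first by move: iM; rewrite pi /=; lia.
(* Otherwise every axis at distance at least M - 1 is reached through the edge l. A step along l
   brings these closer by one and leaves the others, at distance at most M - 2, within M - 1,
   against minimality. *)
have [j [jM [m [s' [pj lm]]]]] : exists j, (M.-1 <= size (p j))%N /\
    exists m s', p j = m :: s' /\ l != m.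
  apply: contrapT => /forallNP h.
  have : P M.-1.
    exists (c * letter x l) => j; rewrite conjgM.
    have [e _ sq _] := hpq j.
    have [jM|jM] := leqP M.-1 (size (p j)); last first.
      have : length_le (cyclic_length x (a j) + (size (p j)).*2) (a j ^ c).
        exists (p j ++ q j ++ winv (p j)) => //.
        by rewrite !size_cat size_winv sq cyclic_length_conj; lia.
      move=> /length_le_conj_letter - /(_ l)[w sw ew]; exists w => //.
      by apply: leq_trans sw _; lia.
    case pj : (p j) => [|m s']; first by move: jM; rewrite pj /=; lia.
    have lm : l = m.
      by apply/eqP/negPn/negP => lm; apply: (h j); split=> //; exists m, s'.
    exists (s' ++ q j ++ winv s').
      rewrite !size_cat size_winv sq cyclic_length_conj.
      by have := pM j; rewrite pj /=; lia.
    rewrite -e pj -lm winv_cons -cats1 !word_eval_cat !word_eval_cons word_eval_nil.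
    by rewrite letter_linv mulg1 conjgE !mulgA mulVg mul1g mulgVK.
  by move=> /asboolP/Mmin; lia.
have [ei ri sqi _] := hpq i; have [ej rj sqj _] := hpq j.
have cyc : cycle (@follows I) ((p i ++ q i ++ winv (p i)) ++ (p j ++ q j ++ winv (p j))).
  rewrite pi pj in ri rj *; apply: cycle_join => //.
  - by rewrite winv_cons -cats1 !last_cat.
  - by rewrite winv_cons -cats1 !last_cat.
have := aaL i j; rewrite (@cyclic_length_cycle _ _ c cyc); last first.
  by rewrite word_eval_cat ei ej conjMg.
(* The product has translation length at least 2 M + 2 (M - 1), and at most L, so 2 M <= 4 L with
   room to spare; the translation length of [a j] adds one more L. *)
rewrite !size_cat !size_winv iM.
by lia.
Qed.

End CyclicLength.

(** * Representations and the degree of invariant functions *)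

Lemma multiplicative1 (gT hT : groupType) (f : {multiplicative gT -> hT}) : f 1%g = 1%g.
Proof. by apply: (@mulgI _ (f 1%g)); rewrite -gmulfM !mulg1. Qed.

Lemma multiplicativeV (gT hT : groupType) (f : {multiplicative gT -> hT}) a :
  f a^-1%g = (f a)^-1%g.
Proof. by apply: (@mulgI _ (f a)); rewrite -gmulfM !mulgV multiplicative1. Qed.

Section RepresentationTheory.
Context {gT : groupType} {F : fieldType} {n : nat} {G : matrix_group F n}.
Implicit Types (phi psi : representation gT G) (a b c : gT).

Lemma rep_unit phi a : phi a \in unitmx.
Proof. exact: mxgroup_unit (rep_in phi a). Qed.

Lemma rep1 phi : phi 1%g = 1%:M.
Proof.
have := repM phi 1%g 1%g; rewrite mulg1 => /(congr1 (mulmx (invmx (phi 1%g)))).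
by rewrite mulVmx ?rep_unit// mulKmx ?rep_unit.
Qed.

Lemma repV phi a : phi a^-1%g = invmx (phi a).
Proof.
have /(congr1 (mulmx (invmx (phi a)))) := repM phi a a^-1%g.
by rewrite mulgV rep1 mulmx1 mulKmx ?rep_unit.
Qed.

Lemma rep_word (I : finType) (x : I -> gT) phi w :
  phi (word_eval x w) = word_mx (fun l => phi (letter x l)) w.
Proof.
elim: w => [|l w IH]; first by rewrite word_eval_nil rep1.
by rewrite word_eval_cons repM IH.
Qed.

Lemma conj_rep_subproof A phi (GA : mxgroup_set G A) a :
  mxgroup_set G (A *m phi a *m invmx A).
Proof. by apply: mxgroupM; [apply: mxgroupM => //; exact: rep_in|exact: mxgroupV]. Qed.

Lemma conj_repM A phi (GA : mxgroup_set G A) a b :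
  A *m phi (a * b)%g *m invmx A = (A *m phi a *m invmx A) *m (A *m phi b *m invmx A).
Proof. by rewrite repM !mulmxA mulmxKV// (mxgroup_unit GA). Qed.

Definition conj_rep A phi (GA : mxgroup_set G A) : representation gT G :=
  Representation (conj_rep_subproof phi GA) (conj_repM phi GA).

Lemma rep_ext phi psi : phi =1 psi -> phi = psi.
Proof.
case: phi psi => [f fG fM] [g gG gM] /= /funext e; move: fG fM; rewrite e => fG fM.
by congr Representation; exact: Prop_irrelevance.
Qed.

Lemma conj_invariantE (u : representation gT G -> F) A phi (GA : mxgroup_set G A) :
  conj_invariant u -> u (conj_rep phi GA) = u phi.
Proof. by apply; exists A. Qed.

Lemma char_ringP (u : char_ring G) : regular u /\ conj_invariant (gT := gT) u.
Proof. by case: u => u /= /asboolP. Qed.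

Lemma char_ring_ext (u v : @char_ring gT F n G) : (forall phi, u phi = v phi) -> u = v.
Proof. by move=> uv; apply/val_inj/funext. Qed.

Lemma mmap_char_ring N (u : 'I_N -> @char_ring gT F n G) (Q : mpoly N F) phi :
  mmap (in_alg (char_ring G)) u Q phi = meval (fun i => u i phi) Q.
Proof.
elim/mpoly_alg_ind: Q => [c|i|p q IHp IHq|p q IHp IHq].
- by rewrite mmapC mevalC /= mulr1.
- by rewrite mmapX mmap1U mevalXU.
- by rewrite mmapD mevalD -IHp -IHq.
- by rewrite rmorphM mevalM -IHp -IHq.
Qed.

Lemma regular_sum (J : Type) (r : seq J) (v : J -> representation gT G -> F) :
  (forall j, regular (v j)) -> regular (fun phi => \sum_(j <- r) v j phi).
Proof.
move=> rv; elim: r => [|j r IH].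
  by under eq_fun do rewrite big_nil; exact: regular_const.
by under eq_fun do rewrite big_cons; exact: regular_add.
Qed.

Lemma trace_char_subproof a :
  (fun phi : representation gT G => \tr (phi a)) \in @invariant_regular gT F n G.
Proof.
apply/asboolP; split; first by apply: regular_sum => i; exact: regular_coef.
move=> phi psi [A GA ->].
by rewrite mxtrace_mulC mulmxA mulVmx ?mul1mx// (mxgroup_unit GA).
Qed.

Definition trace_char a : char_ring G := CharRing (trace_char_subproof a).

End RepresentationTheory.

(** * Embedding of the representation variety by matrix entries *)

Section Coordinates.
Context {gT : groupType} {I : finType} (x : I -> gT) (F : fieldType) (n : nat).
Context (G : matrix_group F n).
Implicit Types (phi psi : representation gT G) (w : seq (I * bool)).

Definition coordinate : finType := ((I * bool) * ('I_n * 'I_n))%type.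

Local Notation M := #|{: coordinate}|.

Definition coordinates phi (m : 'I_M) : F :=
  let c := enum_val m in phi (letter x c.1) c.2.1 c.2.2.

Definition generic_mx (l : I * bool) : 'M[mpoly M F]_n :=
  \matrix_(i, j) mpolyX F (mnm1 (enum_rank ((l, (i, j)) : coordinate))).

Lemma meval_word_mx phi w i j :
  meval (coordinates phi) (word_mx generic_mx w i j) = phi (word_eval x w) i j.
Proof.
rewrite rep_word; have -> : word_mx (fun l => phi (letter x l)) w =
    map_mx (meval (coordinates phi)) (word_mx generic_mx w).
  elim: w => [|l w IH]; first by rewrite /= map_mx1.
  rewrite !word_mx_cons map_mxM -IH; congr (_ *m _).
  by apply/matrixP => r s; rewrite !mxE /= mevalXU /coordinates enum_rankK.
by rewrite mxE.
Qed.

Lemma deg_le_word_mx w i j : deg_le (size w) (word_mx generic_mx w i j).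
Proof.
elim: w i j => [|l w IH] i j.
  by rewrite /= mxE -(mpolyC_nat _ F); exact: deg_leC.
rewrite word_mx_cons mxE; apply: big_ind => [||k _].
- by rewrite -(mpolyC0 _ F); exact: deg_leC.
- by move=> *; exact: deg_leD.
- by rewrite mxE; apply: (@deg_leM _ _ 1 (size w)) => //; exact: deg_leX.
Qed.

Lemma regular_meval (p : mpoly M F) :
  regular (fun phi : representation gT G => meval (coordinates phi) p).
Proof.
elim/mpoly_alg_ind: p => [c|i|p q IHp IHq|p q IHp IHq].
- by under eq_fun do rewrite mevalC; exact: regular_const.
- by under eq_fun do rewrite mevalXU; exact: regular_coef.
- by under eq_fun do rewrite mevalD; exact: regular_add.
- by under eq_fun do rewrite mevalM; exact: regular_mul.
Qed.

Lemma regular_polynomial (u : representation gT G -> F) : generates x -> regular u ->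
  exists p : mpoly M F, forall phi, u phi = meval (coordinates phi) p.
Proof.
move=> gx; elim=> [c|a i j|v w _ [p hp] _ [q hq]|v w _ [p hp] _ [q hq]].
- by exists (mpolyC M c) => phi; rewrite mevalC.
- have [w <-] := gx a; exists (word_mx generic_mx w i j) => phi.
  by rewrite meval_word_mx.
- by exists (p + q) => phi; rewrite mevalD -hp -hq.
- by exists (p * q) => phi; rewrite mevalM -hp -hq.
Qed.

(** The Kronecker product of A with its transposed inverse, repeated over the letters. This shape is
    stable under adjoints, which is how closure of G under conjugate transposition passes to the
    coordinates. *)
Definition conj_mx (A : 'M[F]_n) : 'M[F]_M := \matrix_(m, m')
  let c := enum_val m in let c' := enum_val m' in
  (c.1 == c'.1)%:R * A c.2.1 c'.2.1 * invmx A c'.2.2 c.2.2.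

Lemma coordinates_conj A phi (GA : mxgroup_set G A) m :
  coordinates (conj_rep phi GA) m = \sum_m' conj_mx A m m' * coordinates phi m'.
Proof.
rewrite /coordinates /=; set c := enum_val m.
transitivity (\sum_(c' : coordinate) (c.1 == c'.1)%:R * A c.2.1 c'.2.1 *
    invmx A c'.2.2 c.2.2 * phi (letter x c'.1) c'.2.1 c'.2.2).
  rewrite -(pair_bigA _ (fun l ij => (c.1 == l)%:R * A c.2.1 ij.1 *
    invmx A ij.2 c.2.2 * phi (letter x l) ij.1 ij.2)) /=.
  rewrite (bigD1 c.1)//= [X in _ + X]big1 ?addr0 => [|l lc]; last first.
    by rewrite big1// => ij _; rewrite eq_sym (negbTE lc) !mul0r.
  rewrite -(pair_bigA _ (fun i j => (c.1 == c.1)%:R * A c.2.1 i *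
    invmx A j c.2.2 * phi (letter x c.1) i j)) /= mxE exchange_big /=.
  apply: eq_bigr => j _; rewrite mxE big_distrl; apply: eq_bigr => i _ /=.
  by rewrite eqxx mul1r mulrAC.
rewrite (reindex (fun m' : 'I_M => enum_val m')) /=; last first.
  by exists enum_rank => ? _; [exact: enum_valK|exact: enum_rankK].
by apply: eq_bigr => m' _; rewrite mxE.
Qed.

End Coordinates.

Arguments coordinate : clear implicits.

Section UpperBound.
Context {gT : groupType} {I : finType} (x : I -> gT) (F : numFieldType) (n : nat).
Context (G : matrix_group F n) (cj : {rmorphism F -> F}).
Hypotheses (cjK : involutive cj) (cj_ge0 : forall a, 0 <= a * cj a).
Hypothesis G_adj : forall A, mxgroup_set G A -> mxgroup_set G (map_mx cj A^T).

Implicit Types (phi psi : representation gT G).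

Local Notation M := #|{: coordinate I n}|.
Local Notation coord := (coordinates x (G := G)).

Let conj_set : set 'M[F]_M := [set conj_mx A | A in mxgroup_set G].

Lemma adjmx_conj_mx (A : 'M[F]_n) : adjmx cj (conj_mx A) = conj_mx (I := I) (map_mx cj A^T).
Proof.
apply/matrixP => m m'; rewrite !mxE !rmorphM rmorph_nat /= eq_sym.
by rewrite -map_invmx -trmx_inv !mxE.
Qed.

Lemma conj_set_adj L : conj_set L -> conj_set (adjmx cj L).
Proof.
by move=> [A GA <-]; exists (map_mx cj A^T); rewrite ?adjmx_conj_mx//; exact: G_adj.
Qed.

Lemma meval_coordinates_conj A phi (GA : mxgroup_set G A) (p : mpoly M F) :
  meval (coord (conj_rep phi GA)) p = meval (coord phi) (linear_subst (conj_mx A) p).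
Proof.
by rewrite meval_linear_subst; apply: meval_eq => m; exact: coordinates_conj.
Qed.

(* The lift of least Fischer norm is unique, hence invariant. *)
Lemma invariant_lift (u : representation gT G -> F) d (p : mpoly M F) :
  conj_invariant u -> deg_le d p -> (forall phi, u phi = meval (coord phi) p) ->
  exists q : mpoly M F, [/\ subst_invariant conj_set q, deg_le d q &
    forall phi, u phi = meval (coord phi) q].
Proof.
move=> iu dp up.
(* The ambiguity of the lift in degree at most d. *)
pose J q := deg_le d q /\ forall phi, meval (coord phi) q = 0.
have JD : subspace J.
  split; first by split=> [m|phi]; rewrite ?mcoeff0 ?eqxx// meval0.
  move=> c q r [dq q0] [dr r0]; split.
    by apply: deg_leD => //; exact: deg_leZ.
  by move=> phi; rewrite mevalD mevalZ q0 r0 mulr0 addr0.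
have Jsupp q m : J q -> mcoeff m q != 0 -> m \in [seq val m | m : bmultinom M d.+1].
  move=> [dq _] /dq md; have md1 : (mdeg m < d.+1)%N by rewrite ltnS.
  by apply/mapP; exists (BMultinom md1) => //; rewrite mem_enum.
have Jsubst L q : conj_set L -> J q -> J (linear_subst L q).
  move=> [A GA <-] [dq q0]; split; last by move=> phi; rewrite -(meval_coordinates_conj phi GA).
  rewrite -[d]mul1n; apply: deg_le_subst => // m.
  apply: big_ind => [||m' _]; last by apply: deg_leZ; exact: deg_leX.
    by rewrite -(mpolyC0 _ F); exact: deg_leC.
  by move=> *; exact: deg_leD.
have [w [dw w0] wP] := fischer_projection cjK cj_ge0 JD Jsupp p.
exists (p - w); split; last first.
- by move=> phi; rewrite mevalB w0 subr0.
- exact: deg_leB.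
move=> L SL; apply/eqP; rewrite -subr_eq0; apply/eqP/(fischer_eq0 cj_ge0).
have JL : J (linear_subst L (p - w) - (p - w)).
  split.
    apply: deg_leB; last exact: deg_leB.
    rewrite -[d]mul1n; apply: deg_le_subst => [m|]; last exact: deg_leB.
    apply: big_ind => [||m' _]; last by apply: deg_leZ; exact: deg_leX.
      by rewrite -(mpolyC0 _ F); exact: deg_leC.
    by move=> *; exact: deg_leD.
  move=> phi; have [A GA eL] := SL.
  rewrite mevalB -eL -(meval_coordinates_conj phi GA) !mevalB !w0 !subr0 -!up.
  by rewrite (conj_invariantE _ GA iu) subrr.
(* The difference lies in J, and both of its terms are orthogonal to J: p - w by projection, its
   image under L because the adjoint of L is again a conjugation and maps J to itself. *)
rewrite fischerBr// (wP _ JL) subr0.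
have -> : L = adjmx cj (adjmx cj L) by rewrite adjmxK.
rewrite -fischer_linear_subst//; apply: wP.
by rewrite adjmxK//; apply: Jsubst => //; exact: conj_set_adj.
Qed.

(** Lift v to an invariant polynomial, write that in the fixed invariants of [invariant_generators],
    and write these in terms of u. C is the largest degree in the last step, hence independent of
    v. *)
Lemma char_ring_degree N (u : 'I_N -> @char_ring gT F n G) : algebra_generators u ->
  exists C, forall (v : char_ring G) d (p : mpoly M F), deg_le d p ->
    (forall phi, v phi = meval (coord phi) p) ->
    exists2 Q : mpoly N F, deg_le (C * d) Q & v = mmap (in_alg (char_ring G)) u Q.
Proof.
move=> ugen.
have [k [b [ib bgen]]] := invariant_generators cjK cj_ge0 conj_set_adj.
have betaP i : (fun phi : representation gT G => meval (coord phi) (b i)) \in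
    @invariant_regular gT F n G.
  apply/asboolP; split; first exact: regular_meval.
  move=> phi psi [A GA e]; have -> : psi = conj_rep phi GA by apply: rep_ext => a; exact: e.
  by rewrite meval_coordinates_conj ib//; exists A.
pose beta i : char_ring G := CharRing (betaP i).
have /choice[P bP] i : exists P : mpoly N F, beta i = mmap (in_alg (char_ring G)) u P.
  exact: ugen.
exists (\max_i (msize (P i)).-1)%N => v d p dp vp.
have [q [iq dq vq]] := invariant_lift (char_ringP v).2 dp vp.
have [Q dQ qQ] := bgen _ _ iq dq.
exists (subst_mpoly P Q).
  apply: deg_le_subst => // i; apply/deg_leP.
  exact: (leq_bigmax_cond (F := fun i => (msize (P i)).-1)).
rewrite mmap_subst; apply: char_ring_ext => phi.
rewrite mmap_char_ring vq qQ meval_subst; apply: meval_eq => i.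
by rewrite -bP.
Qed.

(** An invariant v does not see inner automorphisms, so f may be followed by conjugation by c; each
    coordinate then becomes an entry of a word of length at most L. *)
Lemma pullback_degree (f : {multiplicative gT -> gT}) L c d
    (v : @char_ring gT F n G) (p : mpoly M F) :
  (forall i, length_le x L (f (x i) ^ c)%g) ->
  deg_le d p -> (forall phi, v phi = meval (coord phi) p) ->
  exists2 q : mpoly M F, deg_le (L * d) q &
    forall phi, char_pullback f v phi = meval (coord phi) q.
Proof.
move=> fL dp vp.
have /choice[W hW] l : exists w, (size w <= L)%N /\ word_eval x w = (f (letter x l) ^ c)%g.
  case: l => i e; have [w wL ew] := fL i; rewrite /letter /=; case: e; last by exists w.
  exists (winv w); rewrite size_winv; split=> //.
  by rewrite word_eval_winv ew -conjVg multiplicativeV.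
pose h (m : 'I_M) := let r := enum_val m in
  word_mx (generic_mx F n) (W r.1) r.2.1 r.2.2.
exists (subst_mpoly h p).
  apply: deg_le_subst => // m; apply: (deg_le_leq (hW _).1).
  exact: deg_le_word_mx.
move=> phi; rewrite meval_subst.
pose psi := conj_rep (rep_act f phi) (rep_in phi c^-1%g).
have -> : char_pullback f v phi = v psi.
  by rewrite (conj_invariantE _ _ (char_ringP v).2).
rewrite vp; apply: meval_eq => m; rewrite /h meval_word_mx (hW _).2 /coordinates /=.
by rewrite conjgE !repM mulmxA repV invmxK.
Qed.

End UpperBound.

(** * Lower bound for the degree of a trace *)

Section PolePolynomials.
Context {F : fieldType} {K : numFieldType} (iota : {rmorphism F -> K}) (T : K -> Prop).

Lemma pole_le_sum d (J : eqType) (r : seq J) (h : J -> K -> K) :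
  {in r, forall j, pole_le T d (h j)} -> pole_le T d (fun t => \sum_(j <- r) h j t).
Proof.
elim: r => [|j r IH] hr.
  apply: (pole_le_leq (leq0n d)).
  by under eq_fun do rewrite big_nil; exact: pole_le_const.
under eq_fun do rewrite big_cons.
by apply: pole_leD; [|apply: IH => k kr]; apply: hr; rewrite inE ?eqxx ?kr ?orbT.
Qed.

Lemma pole_le_prod (J : Type) (r : seq J) (d : J -> nat) (h : J -> K -> K) :
  (forall j, pole_le T (d j) (h j)) ->
  pole_le T (\sum_(j <- r) d j) (fun t => \prod_(j <- r) h j t).
Proof.
move=> hr; elim: r => [|j r IH].
  by rewrite big_nil; under eq_fun do rewrite big_nil; exact: pole_le_const.
rewrite big_cons; apply: eq_pole_le (pole_leM (hr j) IH) => t _.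
by rewrite big_cons.
Qed.

Lemma pole_le_meval M D d (v : K -> 'I_M -> F) (p : mpoly M F) :
  (forall m, pole_le T D (fun t => iota (v t m))) -> deg_le d p ->
  pole_le T (D * d) (fun t => iota (meval (v t) p)).
Proof.
move=> hv dp.
apply: (eq_pole_le (h := fun t => \sum_(m <- msupp p)
    iota (mcoeff m p) * \prod_i iota (v t i) ^+ m i)) => [t _|].
  rewrite mevalE rmorph_sum; apply: eq_bigr => m _ /=.
  by rewrite rmorphM rmorph_prod; congr (_ * _); apply: eq_bigr => i _; rewrite rmorphXn.
apply: pole_le_sum => m; rewrite mcoeff_msupp => /dp md; apply: pole_leZ.
apply: (pole_le_leq (d := (\sum_i D * m i)%N)); last first.
  by apply: pole_le_prod => i; exact: pole_leXn.
by rewrite -big_distrr /= -mdegE leq_mul2l md orbT.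
Qed.

End PolePolynomials.

(* In the applications [Psi t] is the ping-pong representation followed by a
   homomorphism from SL_2 or SU_2 to [G]. *)
Record trace_family (F : fieldType) (n : nat) (G : matrix_group F n) (I : finType)
    (K : numFieldType) (iota : {rmorphism F -> K}) (T : K -> Prop)
    (Psi : K -> I * bool -> 'M[F]_n) (D k : nat) (c alpha : K) : Prop := TraceFamily {
  family_infinite : forall s : seq K, exists2 t, T t & t \notin s;
  family_neq0 : forall t, T t -> t != 0;
  family_in : forall t l, T t -> mxgroup_set G (Psi t l);
  family_inv : forall t l, T t -> Psi t l *m Psi t (linv l) = 1%:M;
  family_pole : forall l i j, pole_le T D (fun t => iota (Psi t l i j));
  family_trace : forall t w, T t -> iota (\tr (word_mx (Psi t) w)) =
    c + alpha * \tr (word_mx (pingpong t) w) ^+ k;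
  family_scale : alpha != 0;
  family_exponent : (0 < k)%N }.

Section LowerBound.
Context {gT : groupType} {I : finType} (x : I -> gT) (F : fieldType) (n : nat).
Context (G : matrix_group F n).
Hypothesis freex : free_basis x.

Lemma free_representation (Y : I * bool -> 'M[F]_n) :
  (forall l, mxgroup_set G (Y l)) -> (forall l, Y l *m Y (linv l) = 1%:M) ->
  exists phi : representation gT G, forall w, phi (word_eval x w) = word_mx Y w.
Proof.
move=> GY YV; have [phi phiE] := free_hom YV freex.
have phiG a : mxgroup_set G (phi a).
  have [w <-] := freex.1 a; rewrite phiE.
  by elim: w => [|l w IH]; [exact: mxgroup1|exact: mxgroupM].
have phiM a b : phi (a * b)%g = phi a *m phi b.
  have [u <-] := freex.1 a; have [v <-] := freex.1 b.
  by rewrite -word_eval_cat !phiE word_mx_cat.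
by exists (Representation phiG phiM).
Qed.

(** Along the family the trace has a pole of order k times the cyclic length, while a polynomial of
    degree d in entries with poles of order at most D has a pole of order at most D d. *)
Lemma trace_degree (K : numFieldType) (iota : {rmorphism F -> K}) T
    (Psi : K -> I * bool -> 'M[F]_n) D k (c alpha : K) (a : gT) d (p : mpoly #|coordinate I n| F) :
  trace_family G iota T Psi D k c alpha -> deg_le d p ->
  (forall phi : representation gT G, \tr (phi a) = meval (coordinates x phi) p) ->
  (cyclic_length x a <= D * d)%N.
Proof.
move=> [Tinf T0 TG TV Tpole Ttr a0 k0] dp ap.
(* Off T the trivial representation serves as a dummy value. *)
have /choice[phi phiP] t : exists phi : representation gT G, T t ->
    forall w, phi (word_eval x w) = word_mx (Psi t) w.
  have [Tt|nTt] := pselect (T t); last by exists (trivial_rep G).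
  by have [phi h] := free_representation (fun l => TG t l Tt) (fun l => TV t l Tt); exists phi.
have [w [b [cw ew sw]]] := exists_cyclic_word freex a.
rewrite -sw.
have pw : pole_eq T (size w) (fun t => \tr (word_mx (pingpong t) w)).
  have [q q0 qh] := pole_eq_trace (K := K) cw.
  by exists q => // t /T0; exact: qh.
apply: (pole_eq_affine_le Tinf a0 k0 (c := c) pw).
apply: (eq_pole_le (h := fun t => iota (meval (coordinates x (phi t)) p))) => [t Tt|].
  rewrite -Ttr// -phiP// ew conjgE !repM mulmxA mxtrace_mulC mulmxA -repM.
  by rewrite mulgV rep1 mul1mx -ap.
apply: pole_le_meval dp => m; rewrite /coordinates.
set r := enum_val m; apply: eq_pole_le (Tpole r.1 r.2.1 r.2.2) => t Tt.
have := phiP t Tt [:: r.1]; rewrite word_eval_cons word_eval_nil mulg1 => ->.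
by rewrite word_mx_cons mulmx1.
Qed.

End LowerBound.

(** * The listed groups *)

(** Transfers families from SL to GL, from SO to O and from SU to U. *)
Lemma trace_family_sub (F : fieldType) n (G H : matrix_group F n) (I : finType)
    (K : numFieldType) (iota : {rmorphism F -> K}) T
    (Psi : K -> I * bool -> 'M[F]_n) D k (c alpha : K) :
  (forall A, mxgroup_set G A -> mxgroup_set H A) ->
  trace_family G iota T Psi D k c alpha -> trace_family H iota T Psi D k c alpha.
Proof. by move=> GH [Tinf T0 TG TV Tp Ttr a0 k0]; split=> // t l /TG h; exact: GH. Qed.

(** K may differ from F: for the compact groups F is real, while the parameter lies on the complex
    unit circle. *)
Definition has_trace_family (F : fieldType) n (G : matrix_group F n) :=
  forall I : finType, exists (K : numFieldType) (iota : {rmorphism F -> K}) T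
    (Psi : K -> I * bool -> 'M[F]_n) D k (c alpha : K),
    trace_family G iota T Psi D k c alpha.

Definition selfadjoint (F : numFieldType) n (G : matrix_group F n) :=
  exists cj : {rmorphism F -> F}, [/\ involutive cj, forall a, 0 <= a * cj a &
    forall A, mxgroup_set G A -> mxgroup_set G (map_mx cj A^T)].

Section PingPongEmbedding.
Context {F : fieldType} {K : numFieldType} {I : finType} {n : nat}.

Lemma word_mx_embedding (P : 'M[K]_2 -> Prop) (f : 'M[K]_2 -> 'M[F]_n) t
    (w : seq (I * bool)) :
  P 1%:M -> (forall A B, P A -> P B -> P (A *m B)) ->
  f 1%:M = 1%:M -> (forall A B, P A -> P B -> f (A *m B) = f A *m f B) ->
  (forall l : I * bool, P (pingpong t l)) ->
  P (word_mx (pingpong t) w) /\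
  word_mx (fun l => f (pingpong t l)) w = f (word_mx (pingpong t) w).
Proof.
move=> P1 PM f1 fM Pt; elim: w => [|l w [Pw IH]]; first by split.
by rewrite !word_mx_cons IH fM//; split=> //; exact: PM.
Qed.

Lemma pole_le_pingpong (T : K -> Prop) (l : I * bool) i j :
  (forall t, T t -> t != 0) -> pole_le T 1 (fun t => pingpong t l i j).
Proof.
move=> T0; have [q hq] := pole_le_word_mx (K := K) [:: l] i j; exists q => t /T0 /hq <-.
by rewrite word_mx_cons mulmx1.
Qed.

End PingPongEmbedding.

Lemma pole_le_cst (K : numFieldType) (T : K -> Prop) d c : pole_le T d (fun=> c).
Proof. by apply: (pole_le_leq (leq0n d)); exact: pole_le_const. Qed.

Lemma pole_le_block_mx (F : fieldType) (K : numFieldType) (iota : {rmorphism F -> K})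
    (T : K -> Prop) d m1 m2 n1 n2 (A : K -> 'M[F]_(m1, n1)) (B : K -> 'M[F]_(m1, n2))
    (C : K -> 'M[F]_(m2, n1)) (D : K -> 'M[F]_(m2, n2)) :
  (forall i j, pole_le T d (fun t => iota (A t i j))) ->
  (forall i j, pole_le T d (fun t => iota (B t i j))) ->
  (forall i j, pole_le T d (fun t => iota (C t i j))) ->
  (forall i j, pole_le T d (fun t => iota (D t i j))) ->
  forall i j, pole_le T d (fun t => iota (block_mx (A t) (B t) (C t) (D t) i j)).
Proof.
move=> hA hB hC hD i j.
case: (split_ordP i) => i' ->; case: (split_ordP j) => j' ->.
- by apply: eq_pole_le (hA i' j') => t _; rewrite block_mxEul.
- by apply: eq_pole_le (hB i' j') => t _; rewrite block_mxEur.
- by apply: eq_pole_le (hC i' j') => t _; rewrite block_mxEdl.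
- by apply: eq_pole_le (hD i' j') => t _; rewrite block_mxEdr.
Qed.

Section LinearFamilies.
Variable F : numFieldType.

Definition sl_embed N (A : 'M[F]_2) : 'M[F]_(2 + N) := block_mx A 0 0 1%:M.

Lemma has_trace_family_SL N : has_trace_family (SL_group F (2 + N)).
Proof.
move=> I; exists F, idfun, (fun t => t != 0), (fun t l => sl_embed N (pingpong t l)).
exists 1%N, 1%N, N%:R, 1.
have embM A B : sl_embed N (A *m B) = sl_embed N A *m sl_embed N B.
  by rewrite /sl_embed mulmx_block !mulmx0 !mul0mx !addr0 add0r mul1mx.
have emb1 : sl_embed N 1%:M = 1%:M by rewrite /sl_embed -scalar_mx_block.
split=> //.
- by move=> s; exact: exists_nonzero_notin.
- by move=> t l t0 /=; rewrite /sl_embed det_ublock pingpong_det// det1 mul1r.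
- by move=> t l t0; rewrite -embM pingpong_linv.
- move=> l; apply: (pole_le_block_mx (iota := idfun)) => i j; try exact: pole_le_cst.
  exact: pole_le_pingpong.
- move=> t w t0.
  have [] // := @word_mx_embedding F F I _ (fun=> True) (sl_embed N) t w.
  move=> _ ->.
  by rewrite /= /sl_embed mxtrace_block mxtrace1 addrC mul1r expr1.
Qed.

Lemma has_trace_family_GL N : has_trace_family (GL_group F (2 + N)).
Proof.
move=> I; have [K [iota [T [Psi [D [k [c [a h]]]]]]]] := has_trace_family_SL N I.
exists K, iota, T, Psi, D, k, c, a; apply: trace_family_sub h => A.
exact: mxgroup_unit.
Qed.

Definition sp_diag N (a e : F) : 'M[F]_N.+1 := diag_mx (\row_j if j == 0 then a else e).

(* [A] acts on the plane spanned by the first vectors of the two Lagrangians. *)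
Definition sp_embed N (A : 'M[F]_2) : 'M[F]_(N.+1 + N.+1) :=
  block_mx (sp_diag N (A 0 0) 1) (sp_diag N (A 0 1) 0)
           (sp_diag N (A 1 0) 0) (sp_diag N (A 1 1) 1).

Lemma sp_diagM N a e a' e' : sp_diag N a e *m sp_diag N a' e' = sp_diag N (a * a') (e * e').
Proof. by rewrite mulmx_diag; congr diag_mx; apply/rowP => j; rewrite !mxE; case: ifP. Qed.

Lemma sp_diagD N a e a' e' : sp_diag N a e + sp_diag N a' e' = sp_diag N (a + a') (e + e').
Proof. by rewrite -linearD; congr diag_mx; apply/rowP => j; rewrite !mxE; case: ifP. Qed.

Lemma sp_diagN N a e : - sp_diag N a e = sp_diag N (- a) (- e).
Proof. by rewrite -linearN; congr diag_mx; apply/rowP => j; rewrite !mxE; case: ifP. Qed.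

Lemma sp_diagT N a e : (sp_diag N a e)^T = sp_diag N a e.
Proof. exact: tr_diag_mx. Qed.

Lemma sp_diag1 N : sp_diag N 1 1 = 1%:M.
Proof. by rewrite -diag_const_mx; congr diag_mx; apply/rowP => j; rewrite !mxE; case: ifP. Qed.

Lemma sp_diag0 N : sp_diag N 0 0 = 0.
Proof. by rewrite -(linear0 diag_mx); congr diag_mx; apply/rowP => j; rewrite !mxE; case: ifP. Qed.

Lemma sp_embedM N A B : sp_embed N (A *m B) = sp_embed N A *m sp_embed N B.
Proof.
rewrite /sp_embed mulmx_block !sp_diagM !sp_diagD !(mulr0, mul0r, mulr1, addr0, add0r).
by rewrite !mxE !big_ord_recl !big_ord0 !addr0; congr block_mx; congr sp_diag;
  congr (_ + _ * _); congr (_ _ _); apply: val_inj.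
Qed.

Lemma sp_embed1 N : sp_embed N 1%:M = 1%:M.
Proof.
by rewrite /sp_embed !mxE /= mulr1n mulr0n sp_diag1 sp_diag0 -scalar_mx_block.
Qed.

Lemma sp_embed_in N A : \det A = 1 -> mxgroup_set (Sp_group F N.+1) (sp_embed N A).
Proof.
rewrite (mx2_eta A) mx2_det => dA.
rewrite /= /symplectic_form /sp_embed tr_block_mx !sp_diagT -sp_diag1 -sp_diag0 sp_diagN.
rewrite !mulmx_block !sp_diagM !sp_diagD !sp_diagM !sp_diagD !mxE /=.
move: (A 0 0) (A 0 1) (A 1 0) (A 1 1) dA => a b c d dA.
congr block_mx; congr sp_diag; try ring.
  by rewrite -[RHS]dA; ring.
by rewrite -[X in _ = - X]dA; ring.
Qed.

Lemma has_trace_family_Sp N : has_trace_family (Sp_group F N.+1).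
Proof.
move=> I; exists F, idfun, (fun t => t != 0), (fun t l => sp_embed N (pingpong t l)).
(* Each of the N remaining symplectic planes is fixed and adds 2 to the trace. *)
exists 1%N, 1%N, (N%:R *+ 2), 1.
split=> //.
- by move=> s; exact: exists_nonzero_notin.
- by move=> t l t0; apply: sp_embed_in; exact: pingpong_det.
- by move=> t l t0; rewrite -sp_embedM pingpong_linv// sp_embed1.
- have p l i j e r s : pole_le (fun t : F => t != 0) 1
      (fun t => idfun (sp_diag N (pingpong t l i j) e r s)).
    have [d pd] : exists d, forall a, sp_diag N a e r s = (if r == 0 then a else e) *+ d.
      by exists (r == s) => a; rewrite !mxE.
    apply: (eq_pole_le (h := fun t => d%:R * (if r == 0 then pingpong t l i j else e))).
      by move=> t _; rewrite /= pd mulr_natl.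
    apply: pole_leZ; case: (r == 0); [exact: pole_le_pingpong|exact: pole_le_cst].
  by move=> l; apply: (pole_le_block_mx (iota := idfun)); exact: p.
- move=> t w t0.
  have [] // := @word_mx_embedding F F I _ (fun=> True) (sp_embed N) t w.
  + exact: sp_embed1.
  + by move=> *; exact: sp_embedM.
  move=> _ ->.
  have trd a : \tr (sp_diag N a 1) = a + N%:R.
    rewrite mxtrace_diag big_ord_recl mxE; congr (_ + _).
    by under eq_bigr do rewrite mxE; rewrite sumr_const card_ord.
  rewrite /= /sp_embed mxtrace_block !trd mul1r expr1 [X in _ = _ + \tr X]mx2_eta mx2_tr.
  by rewrite mulr2n; ring.
Qed.

End LinearFamilies.

(** * Quaternions and the ping-pong matrices on the unit circle *)

Section UnitaryFamilies.
Variable R : realType.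
Local Notation C := (complex R).
Local Notation Re := (@complex.Re R).
Local Notation Im := (@complex.Im R).
Local Notation rc := (@real_complex_def R (Phant R)).

Lemma complex_eq (z w : C) : Re z = Re w -> Im z = Im w -> z = w.
Proof. by case: z w => [a b] [c d] /= -> ->. Qed.

(** The quaternion a + bi + cj + dk as a complex matrix; those of norm one form SU_2. *)
Definition quat (a b c d : R) : 'M[C]_2 :=
  mx2 (Complex a b) (Complex c d) (Complex (- c) d) (Complex a (- b)).

Definition is_quat (W : 'M[C]_2) := exists a b c d, W = quat a b c d.

Lemma quatM a b c d a' b' c' d' : quat a b c d *m quat a' b' c' d' =
  quat (a * a' - b * b' - c * c' - d * d') (a * b' + b * a' + c * d' - d * c')
       (a * c' - b * d' + c * a' + d * b') (a * d' + b * c' - c * b' + d * a').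
Proof. by rewrite mx2M; congr mx2; apply: complex_eq => /=; ring. Qed.

Lemma quat1 : 1%:M = quat 1 0 0 0.
Proof. by rewrite mx2_1; congr mx2; apply: complex_eq; rewrite /= ?oppr0. Qed.

Lemma is_quat1 : is_quat 1%:M. Proof. by exists 1, 0, 0, 0; exact: quat1. Qed.

Lemma is_quatM A B : is_quat A -> is_quat B -> is_quat (A *m B).
Proof. by move=> [a [b [c [d ->]]]] [a' [b' [c' [d' ->]]]]; rewrite quatM; do 4!eexists. Qed.

Lemma quat_det a b c d :
  \det (quat a b c d) = rc (a ^+ 2 + b ^+ 2 + c ^+ 2 + d ^+ 2).
Proof. by rewrite mx2_det; apply: complex_eq => /=; ring. Qed.

Definition unit_circle (z : C) : Prop := Re z ^+ 2 + Im z ^+ 2 = 1.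

Lemma unit_circle_neq0 z : unit_circle z -> z != 0.
Proof.
by apply: contraPneq => ->; rewrite /unit_circle /= expr0n addr0 => /esym/eqP; rewrite oner_eq0.
Qed.

Lemma unit_circleV z : unit_circle z -> z^-1 = Complex (Re z) (- Im z).
Proof.
move=> Tz; apply: (mulfI (unit_circle_neq0 Tz)); rewrite mulfV ?unit_circle_neq0//.
case: z Tz => [p q]; rewrite /unit_circle /= => pq.
by apply: complex_eq => /=; [rewrite -pq; ring|ring].
Qed.

Lemma exists_unit_circle_notin (s : seq C) : exists2 t, unit_circle t & t \notin s.
Proof.
(* Rational parametrisation of the circle; the real part determines m since m >= 0. *)
pose z (m : nat) : C := Complex ((1 - m%:R ^+ 2) / (1 + m%:R ^+ 2)) (2 * m%:R / (1 + m%:R ^+ 2)).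
have d0 m : 1 + m%:R ^+ 2 != 0 :> R by rewrite -natrX nat1r pnatr_eq0.
have zT m : unit_circle (z m) by rewrite /unit_circle /=; have := d0 m; move: (m%:R) => r r0; field.
have zI : injective z.
  move=> m k [e _]; have : (1 + m%:R ^+ 2 : R) = 1 + k%:R ^+ 2.
    have e' r : 1 + r ^+ 2 != 0 :> R -> (1 - r ^+ 2) / (1 + r ^+ 2) + 1 = 2 / (1 + r ^+ 2).
      by move=> r0; field.
    have := e' _ (d0 m); rewrite e e'// => /(mulfI _) h.
    by apply/esym/invr_inj/h; rewrite pnatr_eq0.
  by move/addrI/eqP; rewrite -!natrX eqr_nat eqn_exp2r// => /eqP.
pose r : seq C := [seq z i | i <- iota 0 (size s).+1].
have ur : uniq r by rewrite map_inj_uniq ?iota_uniq.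
have /allPn[t tr ts] : ~~ all (mem s) r.
  apply/negP => /allP rs; have := uniq_leq_size ur rs.
  by rewrite size_map size_iota ltnn.
by exists t => //; move/mapP: tr => [i _ ->].
Qed.

Variable I : finType.
Implicit Types (l : I * bool).

(** For |t| = 1 the matrix diag(1/t, t) lies in SU_2, and the conjugating matrix is a real rotation
    up to a scalar that cancels. *)
Lemma pingpong_quat t l : unit_circle t -> is_quat (pingpong t l).
Proof.
move=> Tt; have Vt := unit_circleV Tt.
suff H (k : R) z : unit_circle z -> 1 + k ^+ 2 != 0 -> is_quat (hyperbolic (rc k) z).
  have k0 : 1 + (enum_rank l.1)%:R ^+ 2 != 0 :> R by rewrite -natrX nat1r pnatr_eq0.
  rewrite /pingpong /slope.
  have -> : (enum_rank l.1)%:R = rc (enum_rank l.1)%:R :> C by rewrite rmorph_nat.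
  apply: H => //; case: ifP => _ //; rewrite Vt /unit_circle /= sqrrN; exact: Tt.
move=> {t l Tt Vt} Tz k0; rewrite /hyperbolic unit_circleV//.
have -> : 1 + rc k ^+ 2 = rc (1 + k ^+ 2) by rewrite rmorphD rmorph1 rmorphXn.
have -> : (rc (1 + k ^+ 2))^-1 = rc (1 + k ^+ 2)^-1 by rewrite fmorphV.
case: z Tz => p q _ /=.
exists p, (q * (k ^+ 2 - 1) / (1 + k ^+ 2)), 0, (- (2 * k * q) / (1 + k ^+ 2)).
rewrite -!rmorphXn /=; congr mx2; apply: complex_eq => /=; by field.
Qed.

(** Real and imaginary parts are not algebraic in t, but for a quaternion they are complex linear
    combinations of matrix entries, so they inherit the pole bound. *)
Lemma pole_le_quat (l : I * bool) :
  [/\ pole_le unit_circle 1 (fun t => rc (Re (pingpong t l 0 0))),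
      pole_le unit_circle 1 (fun t => rc (Im (pingpong t l 0 0))),
      pole_le unit_circle 1 (fun t => rc (Re (pingpong t l 0 1))) &
      pole_le unit_circle 1 (fun t => rc (Im (pingpong t l 0 1)))].
Proof.
have p i j c : pole_le unit_circle 1 (fun t => c * pingpong t l i j).
  by apply: pole_leZ; apply: pole_le_pingpong; exact: unit_circle_neq0.
have two : 2 != 0 :> R by rewrite pnatr_eq0.
split.
- apply: eq_pole_le (pole_leD (p 0 0 (rc 2^-1)) (p 1 1 (rc 2^-1))) => t /(pingpong_quat l).
  by move=> [a [b [c [d ->]]]]; rewrite /quat !mxE /=; apply: complex_eq => /=; field.
- apply: eq_pole_le (pole_leD (p 0 0 (Complex 0 (- 2^-1)))
    (p 1 1 (Complex 0 2^-1))) => t /(pingpong_quat l).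
  by move=> [a [b [c [d ->]]]]; rewrite /quat !mxE /=; apply: complex_eq => /=; field.
- apply: eq_pole_le (pole_leD (p 0 1 (rc 2^-1)) (p 1 0 (rc (- 2^-1)))) => t /(pingpong_quat l).
  by move=> [a [b [c [d ->]]]]; rewrite /quat !mxE /=; apply: complex_eq => /=; field.
- apply: eq_pole_le (pole_leD (p 0 1 (Complex 0 (- 2^-1)))
    (p 1 0 (Complex 0 (- 2^-1)))) => t /(pingpong_quat l).
  by move=> [a [b [c [d ->]]]]; rewrite /quat !mxE /=; apply: complex_eq => /=; field.
Qed.

Lemma word_pingpong_det t w : unit_circle t ->
  \det (word_mx (fun l : I * bool => pingpong t l) w) = 1.
Proof.
move=> Tt; elim: w => [|l w IH]; first by rewrite det1.
by rewrite word_mx_cons det_mulmx IH pingpong_det ?mulr1// unit_circle_neq0.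
Qed.

End UnitaryFamilies.

Section CompactFamilies.
Variable R : realType.
Local Notation C := (complex R).
Local Notation Re := (@complex.Re R).
Local Notation Im := (@complex.Im R).
Local Notation rc := (@real_complex_def R (Phant R)).

Definition su_embed N (W : 'M[C]_2) : 'M[C]_(2 + N) := block_mx W 0 0 1%:M.

Lemma su_embed_in N W : is_quat W -> \det W = 1 ->
  mxgroup_set (SU_group R (2 + N)) (realify (su_embed N W)).
Proof.
move=> [a [b [c [d ->]]]] dW; exists (su_embed N (quat a b c d)) => //.
split; last by rewrite /su_embed det_ublock dW det1 mul1r.
apply/unitarymxP; rewrite /su_embed tr_block_mx map_block_mx mulmx_block.
rewrite !trmx0 !map_mx0 !mulmx0 !mul0mx !addr0 add0r trmx1 map_mx1 mul1mx.
rewrite [RHS]scalar_mx_block; congr block_mx.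
have -> : map_mx Num.conj (quat a b c d)^T = quat a (- b) (- c) (- d).
  apply/matrixP => i j; rewrite !mxE.
  case: (ord2_cases i) => ->; case: (ord2_cases j) => -> /=; rewrite -[Num.conj _]/(conjc _) /=;
    by apply: complex_eq; rewrite /= ?opprK.
rewrite quatM quat1; move: dW; rewrite quat_det => -[dW].
by congr quat; rewrite -?dW; ring.
Qed.

Lemma has_trace_family_SU N : has_trace_family (SU_group R (2 + N)).
Proof.
move=> I; exists C, rc, (@unit_circle R), (fun t l => realify (su_embed N (pingpong t l))).
(* Realification gives twice the real part of the trace, and the trace of a quaternion is real. *)
exists 1%N, 1%N, (N%:R *+ 2), 2.
have embM A B : su_embed N (A *m B) = su_embed N A *m su_embed N B.
  by rewrite /su_embed mulmx_block !mulmx0 !mul0mx !addr0 add0r mul1mx.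
have emb1 : su_embed N 1%:M = 1%:M by rewrite /su_embed -scalar_mx_block.
split=> //.
- exact: exists_unit_circle_notin.
- exact: unit_circle_neq0.
- move=> t l Tt; apply: su_embed_in; first exact: pingpong_quat.
  by apply: pingpong_det; exact: unit_circle_neq0.
- move=> t l /unit_circle_neq0 t0.
  by rewrite -realifyM -embM pingpong_linv// emb1 realify1.
- move=> l; have [pa pb pc pd] := pole_le_quat R l.
  have pN (h : C -> R) : pole_le (@unit_circle R) 1 (fun t => rc (h t)) ->
      pole_le (@unit_circle R) 1 (fun t => rc (- h t)).
    move=> /(pole_leZ (- 1)); apply: eq_pole_le => t _.
    by rewrite mulN1r rmorphN.
  have pRe i j : pole_le (@unit_circle R) 1
      (fun t => rc (map_mx Re (su_embed N (pingpong t l)) i j)).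
    apply: (eq_pole_le (h := fun t => rc (block_mx (map_mx Re (pingpong t l))
      (map_mx Re 0) (map_mx Re 0) (map_mx Re 1%:M) i j))) => [t _|].
      by rewrite -map_block_mx.
    move: i j; apply: pole_le_block_mx => i j.
    + case: (ord2_cases i) => ->; case: (ord2_cases j) => ->.
      * by apply: eq_pole_le pa => t _; rewrite [in RHS]mxE.
      * by apply: eq_pole_le pc => t _; rewrite [in RHS]mxE.
      * apply: eq_pole_le (pN _ pc) => t /(pingpong_quat l)[a [b [c [d e]]]].
        by rewrite [in RHS]mxE /= e !mxE.
      * apply: eq_pole_le pa => t /(pingpong_quat l)[a [b [c [d e]]]].
        by rewrite [in RHS]mxE /= e !mxE.
    + exact: pole_le_cst.
    + exact: pole_le_cst.
    + exact: pole_le_cst.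
  have pIm i j : pole_le (@unit_circle R) 1
      (fun t => rc (map_mx Im (su_embed N (pingpong t l)) i j)).
    apply: (eq_pole_le (h := fun t => rc (block_mx (map_mx Im (pingpong t l))
      (map_mx Im 0) (map_mx Im 0) (map_mx Im 1%:M) i j))) => [t _|].
      by rewrite -map_block_mx.
    move: i j; apply: pole_le_block_mx => i j.
    + case: (ord2_cases i) => ->; case: (ord2_cases j) => ->.
      * by apply: eq_pole_le pb => t _; rewrite [in RHS]mxE.
      * by apply: eq_pole_le pd => t _; rewrite [in RHS]mxE.
      * apply: eq_pole_le pd => t /(pingpong_quat l)[a [b [c [d e]]]].
        by rewrite [in RHS]mxE /= e !mxE.
      * apply: eq_pole_le (pN _ pb) => t /(pingpong_quat l)[a [b [c [d e]]]].
        by rewrite [in RHS]mxE /= e !mxE.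
    + exact: pole_le_cst.
    + exact: pole_le_cst.
    + exact: pole_le_cst.
  apply: pole_le_block_mx => // i j.
  by apply: eq_pole_le (pN _ (pIm i j)) => t _; rewrite [in RHS]mxE.
- move=> t w Tt.
  have [] // := @word_mx_embedding R C I _ (@is_quat R)
    (fun W => realify (su_embed N W)) t w (is_quat1 R).
  + exact: is_quatM.
  + by rewrite emb1 realify1.
  + by move=> A B _ _; rewrite embM realifyM.
  + by move=> l; exact: pingpong_quat.
  move=> [a [b [c [d e]]]] ->.
  rewrite /realify mxtrace_block /su_embed !map_block_mx !mxtrace_block e expr1.
  have -> : \tr (map_mx Re (1%:M : 'M[C]_N)) = N%:R.
    by rewrite /mxtrace; under eq_bigr do rewrite !mxE eqxx; rewrite sumr_const card_ord.
  rewrite /quat mx2_tr /mxtrace !big_ord_recl big_ord0 !mxE /= addr0.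
  have -> : Complex a b + Complex a (- b) = rc (a + a) by apply: complex_eq; rewrite //= subrr.
  by rewrite !rmorphD rmorph_nat /=; ring.
Qed.

Definition mx3 (a b c d e f g h i : R) : 'M[R]_3 := \matrix_(r, s)
  nth 0 (nth [::] [:: [:: a; b; c]; [:: d; e; f]; [:: g; h; i]] r) s.

Lemma mx3M a b c d e f g h i a' b' c' d' e' f' g' h' i' :
  mx3 a b c d e f g h i *m mx3 a' b' c' d' e' f' g' h' i' =
  mx3 (a * a' + b * d' + c * g') (a * b' + b * e' + c * h') (a * c' + b * f' + c * i')
      (d * a' + e * d' + f * g') (d * b' + e * e' + f * h') (d * c' + e * f' + f * i')
      (g * a' + h * d' + i * g') (g * b' + h * e' + i * h') (g * c' + h * f' + i * i').
Proof.
apply/matrixP => r s; rewrite !mxE !big_ord_recl big_ord0 !mxE addr0 /= addrA.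
by case: r => [[|[|[|//]]] ?]; case: s => [[|[|[|//]]] ?].
Qed.

Lemma mx3T a b c d e f g h i :
  (mx3 a b c d e f g h i)^T = mx3 a d g b e h c f i.
Proof.
apply/matrixP => r s; rewrite !mxE.
by case: r => [[|[|[|//]]] ?]; case: s => [[|[|[|//]]] ?].
Qed.

Lemma mx3_1 : 1%:M = mx3 1 0 0 0 1 0 0 0 1.
Proof.
apply/matrixP => r s; rewrite !mxE.
by case: r => [[|[|[|//]]] ?]; case: s => [[|[|[|//]]] ?].
Qed.

Lemma mx3_tr a b c d e f g h i : \tr (mx3 a b c d e f g h i) = a + e + i.
Proof. by rewrite /mxtrace !big_ord_recl big_ord0 !mxE /= addr0 addrA. Qed.

Lemma mx3_det a b c d e f g h i : \det (mx3 a b c d e f g h i) =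
  a * (e * i - f * h) - b * (d * i - f * g) + c * (d * h - e * g).
Proof.
rewrite (expand_det_row _ 0) !big_ord_recl big_ord0 addr0 /cofactor.
rewrite !(expand_det_row _ 0) !big_ord_recl !big_ord0 !addr0 /cofactor !det_mx11 !mxE /=.
by rewrite /bump /= ; ring.
Qed.

(* Euler-Rodrigues formula for the double cover SU_2 -> SO_3. *)
Definition rotation (W : 'M[C]_2) : 'M[R]_3 :=
  let: (a, b, c, d) := (Re (W 0 0), Im (W 0 0), Re (W 0 1), Im (W 0 1)) in
  mx3 (a * a + b * b - c * c - d * d) (2 * (b * c - a * d)) (2 * (b * d + a * c))
      (2 * (b * c + a * d)) (a * a - b * b + c * c - d * d) (2 * (c * d - a * b))
      (2 * (b * d - a * c)) (2 * (c * d + a * b)) (a * a - b * b - c * c + d * d).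

Lemma rotation_quat a b c d : rotation (quat a b c d) =
  mx3 (a * a + b * b - c * c - d * d) (2 * (b * c - a * d)) (2 * (b * d + a * c))
      (2 * (b * c + a * d)) (a * a - b * b + c * c - d * d) (2 * (c * d - a * b))
      (2 * (b * d - a * c)) (2 * (c * d + a * b)) (a * a - b * b - c * c + d * d).
Proof. by rewrite /rotation /quat !mxE. Qed.

Lemma rotationM A B : is_quat A -> is_quat B ->
  rotation (A *m B) = rotation A *m rotation B.
Proof.
move=> [a [b [c [d ->]]]] [a' [b' [c' [d' ->]]]].
by rewrite quatM !rotation_quat mx3M; congr mx3; ring.
Qed.

Lemma rotation1 : rotation 1%:M = 1%:M.
Proof. by rewrite quat1 rotation_quat mx3_1; congr mx3; ring. Qed.

Lemma rotation_in W : is_quat W -> \det W = 1 ->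
  rotation W *m (rotation W)^T = 1%:M /\ \det (rotation W) = 1.
Proof.
move=> [a [b [c [d ->]]]]; rewrite quat_det => -[dW].
rewrite rotation_quat mx3T mx3M mx3_det; split.
  (* For a quaternion of squared norm s the product is s^2 times the identity and the determinant is
     s^3; here s = 1. *)
  rewrite mx3_1; have e : (a ^+ 2 + b ^+ 2 + c ^+ 2 + d ^+ 2) ^+ 2 = 1 by rewrite dW expr1n.
  by congr mx3; rewrite -?[in RHS]e; ring.
have e : (a ^+ 2 + b ^+ 2 + c ^+ 2 + d ^+ 2) ^+ 3 = 1 by rewrite dW expr1n.
by rewrite -[RHS]e; ring.
Qed.

Definition so_embed N (A : 'M[R]_3) : 'M[R]_(3 + N) := block_mx A 0 0 1%:M.

Lemma has_trace_family_SO N : has_trace_family (SO_group R (3 + N)).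
Proof.
move=> I; exists C, rc, (@unit_circle R), (fun t l => so_embed N (rotation (pingpong t l))).
(* The entries of [rotation] are quadratic, whence D = 2, and its trace is 4 a^2 - 1 = (tr W)^2 - 1
   on unit quaternions, whence k = 2 and the -1. *)
exists 2%N, 2%N, (N%:R - 1), 1.
have embM A B : so_embed N (A *m B) = so_embed N A *m so_embed N B.
  by rewrite /so_embed mulmx_block !mulmx0 !mul0mx !addr0 add0r mul1mx.
have emb1 : so_embed N 1%:M = 1%:M by rewrite /so_embed -scalar_mx_block.
split=> //.
- exact: exists_unit_circle_notin.
- exact: unit_circle_neq0.
- move=> t l Tt; have [||o d] := @rotation_in (pingpong t l).
  + exact: pingpong_quat.
  + by apply: pingpong_det; exact: unit_circle_neq0.
  split; last by rewrite /so_embed det_ublock d det1 mul1r.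
  have -> : (so_embed N (rotation (pingpong t l)))^T = so_embed N (rotation (pingpong t l))^T.
    by rewrite /so_embed tr_block_mx !trmx0 trmx1.
  by rewrite -embM o emb1.
- move=> t l Tt; have t0 := unit_circle_neq0 Tt.
  rewrite -embM -rotationM; [|exact: pingpong_quat|exact: pingpong_quat].
  by rewrite pingpong_linv// rotation1 emb1.
- move=> l; have [pa pb pc pd] := pole_le_quat R l.
  apply: pole_le_block_mx => i j; try exact: pole_le_cst.
  pose P (h : C -> R) := pole_le (@unit_circle R) 2 (fun t => rc (h t)).
  have pM (f g : C -> R) : pole_le (@unit_circle R) 1 (fun t => rc (f t)) ->
      pole_le (@unit_circle R) 1 (fun t => rc (g t)) -> P (fun t => f t * g t).
    by move=> hf hg; apply: eq_pole_le (pole_leM hf hg) => t _; rewrite rmorphM.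
  have pD (f g : C -> R) : P f -> P g -> P (fun t => f t + g t).
    by move=> hf hg; apply: eq_pole_le (pole_leD hf hg) => t _; rewrite rmorphD.
  have pZ c (f : C -> R) : P f -> P (fun t => c * f t).
    by move=> hf; apply: eq_pole_le (pole_leZ (rc c) hf) => t _; rewrite rmorphM.
  have pB (f g : C -> R) : P f -> P g -> P (fun t => f t - g t).
    move=> hf /(pZ (- 1)) hg; apply: eq_pole_le (pD _ _ hf hg) => t _.
    by rewrite mulN1r.
  have {}pole_rotation (h : C -> R) : P h ->
      (forall t, h t = rotation (pingpong t l) i j) ->
      pole_le (@unit_circle R) 2 (fun t => rc (rotation (pingpong t l) i j)).
    by move=> hh e; apply: eq_pole_le hh => t _; rewrite e.
  case: i pole_rotation => [[|[|[|//]]] hi]; case: j => [[|[|[|//]]] hj] pr.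
  + by apply: (pr _ (pB _ _ (pB _ _ (pD _ _ (pM _ _ pa pa) (pM _ _ pb pb))
      (pM _ _ pc pc))
      (pM _ _ pd pd))) => t; rewrite [in RHS]mxE.
  + by apply: (pr _ (pZ 2 _ (pB _ _ (pM _ _ pb pc) (pM _ _ pa pd)))) => t; rewrite [in RHS]mxE.
  + by apply: (pr _ (pZ 2 _ (pD _ _ (pM _ _ pb pd) (pM _ _ pa pc)))) => t; rewrite [in RHS]mxE.
  + by apply: (pr _ (pZ 2 _ (pD _ _ (pM _ _ pb pc) (pM _ _ pa pd)))) => t; rewrite [in RHS]mxE.
  + by apply: (pr _ (pB _ _ (pD _ _ (pB _ _ (pM _ _ pa pa) (pM _ _ pb pb))
      (pM _ _ pc pc))
      (pM _ _ pd pd))) => t; rewrite [in RHS]mxE.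
  + by apply: (pr _ (pZ 2 _ (pB _ _ (pM _ _ pc pd) (pM _ _ pa pb)))) => t; rewrite [in RHS]mxE.
  + by apply: (pr _ (pZ 2 _ (pB _ _ (pM _ _ pb pd) (pM _ _ pa pc)))) => t; rewrite [in RHS]mxE.
  + by apply: (pr _ (pZ 2 _ (pD _ _ (pM _ _ pc pd) (pM _ _ pa pb)))) => t; rewrite [in RHS]mxE.
  + by apply: (pr _ (pD _ _ (pB _ _ (pB _ _ (pM _ _ pa pa) (pM _ _ pb pb))
      (pM _ _ pc pc))
      (pM _ _ pd pd))) => t; rewrite [in RHS]mxE.
- move=> t w Tt.
  have [] // := @word_mx_embedding R C I _ (@is_quat R)
    (fun W => so_embed N (rotation W)) t w (is_quat1 R).
  + exact: is_quatM.
  + by rewrite rotation1 emb1.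
  + by move=> A B qA qB; rewrite rotationM// embM.
  + by move=> l; exact: pingpong_quat.
  move=> [a [b [c [d e]]]] ->.
  have := word_pingpong_det w Tt; rewrite e quat_det => -[dW].
  rewrite /so_embed mxtrace_block mxtrace1 rotation_quat mx3_tr mx2_tr.
  have -> : Complex a b + Complex a (- b) = rc (a + a) by apply: complex_eq; rewrite //= subrr.
  have -> : N%:R - 1 = rc (N%:R - 1) by rewrite rmorphB rmorph_nat rmorph1.
  by rewrite mul1r -rmorphXn -rmorphD; congr rc; lra.
Qed.

End CompactFamilies.

(** * Closure of the listed groups under adjoints *)

Section SelfAdjoint.
Variable R : realType.
Local Notation C := (complex R).

Lemma conjc_mul_ge0 (z : C) : 0 <= z * conjc z.
Proof. exact: mul_conjC_ge0. Qed.

Lemma selfadjoint_real n (G : matrix_group R n) :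
  (forall A, mxgroup_set G A -> mxgroup_set G A^T) -> selfadjoint G.
Proof.
move=> GT; exists idfun; split=> // [a|A GA]; first by rewrite -expr2 sqr_ge0.
by rewrite map_mx_id//; exact: GT.
Qed.

Lemma selfadjoint_complex n (G : matrix_group C n) :
  (forall A, mxgroup_set G A -> mxgroup_set G A^T) ->
  (forall A, mxgroup_set G A -> mxgroup_set G (map_mx conjc A)) -> selfadjoint G.
Proof.
move=> GT GJ; exists conjc; split=> [|a|A GA]; first exact: conjcK.
- exact: conjc_mul_ge0.
- by apply: GJ; exact: GT.
Qed.

Lemma SL_group_tr (F : fieldType) n (A : 'M[F]_n) :
  mxgroup_set (SL_group F n) A -> mxgroup_set (SL_group F n) A^T.
Proof. by rewrite /= det_tr. Qed.

Lemma GL_group_tr (F : fieldType) n (A : 'M[F]_n) :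
  mxgroup_set (GL_group F n) A -> mxgroup_set (GL_group F n) A^T.
Proof. by rewrite /= unitmx_tr. Qed.

Lemma O_group_tr (F : fieldType) n (A : 'M[F]_n) :
  mxgroup_set (O_group F n) A -> mxgroup_set (O_group F n) A^T.
Proof. by rewrite /= trmxK => /mulmx1C. Qed.

Lemma SO_group_tr (F : fieldType) n (A : 'M[F]_n) :
  mxgroup_set (SO_group F n) A -> mxgroup_set (SO_group F n) A^T.
Proof. by rewrite /= trmxK det_tr => -[/mulmx1C]. Qed.

(** The defining relation of A^-1, multiplied by J on both sides with J^2 = -1, becomes A^-1 J = J
    A^T, hence A J A^T = J. *)
Lemma Sp_group_tr (F : fieldType) n (A : 'M[F]_(n + n)) :
  mxgroup_set (Sp_group F n) A -> mxgroup_set (Sp_group F n) A^T.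
Proof.
move=> SA; have uA := mxgroup_unit SA; have := mxgroupV SA; rewrite /= trmxK trmx_inv.
set J := symplectic_form F n => e.
have JJ : J *m J = - 1%:M.
  rewrite /J /symplectic_form mulmx_block !mul0mx !mulmx0 !mul1mx !mulmx1 !add0r !addr0.
  by rewrite [in RHS]scalar_mx_block opp_block_mx !oppr0.
have uJ : J \in unitmx := symplectic_form_unit F n.
have {}e : J *m invmx A = A^T *m J.
  by rewrite -[in RHS]e !mulmxA mulmxV ?unitmx_tr// mul1mx.
have {}e : invmx A *m J = J *m A^T.
  have := congr1 (fun B => J *m B *m J) e.
  rewrite !mulmxA JJ -[J *m A^T *m J *m J]mulmxA JJ !mulNmx mulmxN mulmx1 mul1mx.
  exact: oppr_inj.
by rewrite -mulmxA -e mulmxA mulmxV// mul1mx.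
Qed.

Lemma realify_tr n (Z : 'M[C]_n) : (realify Z)^T = realify (map_mx conjc Z^T).
Proof.
rewrite /realify tr_block_mx; congr block_mx; apply/matrixP => i j; rewrite !mxE;
  by case: (Z j i) => a b //=; rewrite opprK.
Qed.

Lemma U_group_tr n (A : 'M[R]_(n + n)) :
  mxgroup_set (U_group R n) A -> mxgroup_set (U_group R n) A^T.
Proof.
by move=> [Z uZ <-]; rewrite realify_tr; exists (map_mx conjc Z^T) => //; rewrite /= trmxC_unitary.
Qed.

Lemma SU_group_tr n (A : 'M[R]_(n + n)) :
  mxgroup_set (SU_group R n) A -> mxgroup_set (SU_group R n) A^T.
Proof.
move=> [Z [uZ dZ] <-]; rewrite realify_tr; exists (map_mx conjc Z^T) => //.
by split; [rewrite trmxC_unitary|rewrite det_map_mx det_tr dZ rmorph1].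
Qed.

End SelfAdjoint.

(** * Growth rates *)

Section GrowthRate.
Variable R : realType.
Implicit Types (u v : nat -> nat) (c r : R) (rho : \bar R).

Lemma growth_term_le u n c : (0 < n)%N ->
  ((n%:R^-1)%:E * lne (u n)%:R%:E <= c%:E)%E = ((u n)%:R <= expR (c * n%:R) :> R).
Proof.
move=> n0; have n0' : 0 < n%:R :> R by rewrite ltr0n.
(* Here log 0 = -oo, which agrees with 0 <= exp. *)
have [u0|u0] := posnP (u n).
  rewrite u0 le0_lneNy// gt0_muleNy ?leNye ?lte_fin ?invr_gt0//.
  by rewrite expR_ge0.
have u0' : 0 < (u n)%:R :> R by rewrite ltr0n.
rewrite lne_EFin// -EFinM lee_fin mulrC ler_pdivrMr//.
by rewrite -[LHS]ler_expR lnK ?posrE.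
Qed.

Lemma growth_rate_le u c N :
  (forall n, (N <= n)%N -> (u n)%:R <= expR (c * n%:R) :> R) ->
  (growth_rate R u <= c%:E)%E.
Proof.
move=> h; rewrite /growth_rate /limn_esup /limf_esup.
pose A : set nat := [set n | (maxn N 1 <= n)%N].
apply: ge_ereal_inf; exists (ereal_sup [set ((n%:R^-1)%:E * lne (u n)%:R%:E)%E | n in A]).
  by exists A => //; exists (maxn N 1).
apply: ge_ereal_sup => _ [n + <-]; rewrite /A /= geq_max => /andP[Nn n0].
by rewrite growth_term_le//; exact: h.
Qed.

Lemma growth_rate_lt u c : (growth_rate R u < c%:E)%E ->
  exists N, forall n, (N <= n)%N -> (u n)%:R <= expR (c * n%:R) :> R.
Proof.
rewrite /growth_rate /limn_esup /limf_esup => /ereal_inf_lt[_ [A [N _ NA] <-] Ac].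
exists (maxn N 1) => n; rewrite geq_max => /andP[Nn n0].
rewrite -growth_term_le//; apply: le_trans (ltW Ac).
by apply: ereal_sup_ubound; exists n => //; exact: NA.
Qed.

Lemma ereal_between rho (s : \bar R) : (rho < s)%E -> exists c, (rho < c%:E < s)%E.
Proof.
case: rho s => [r| |] [s| |]//; rewrite ?lte_fin => rs.
- by exists ((r + s) / 2); rewrite !lte_fin; lra.
- by exists (r + 1); rewrite ltry lte_fin; lra.
- by exists (s - 1); rewrite ltNyr lte_fin; lra.
- by exists 0; rewrite ltNyr ltry.
Qed.

(** A constant factor is absorbed by any gap between exponents: for large n it is at most (c - d) n,
    hence at most exp ((c - d) n). *)
Lemma growth_rate_le_sum (J : finType) u (v : J -> nat -> nat) (K : nat) rho :
  (forall n, u n <= K * \sum_j v j n)%N ->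
  (forall j, growth_rate R (v j) <= rho)%E -> (growth_rate R u <= rho)%E.
Proof.
move=> uv vrho; rewrite leNgt; apply/negP => /ereal_between[c /andP[rc]].
apply/negP; rewrite -leNgt.
have [d /andP[rd]] := ereal_between rc; rewrite lte_fin => dc.
have /choice[N hN] j : exists N, forall n, (N <= n)%N -> (v j n)%:R <= expR (d * n%:R) :> R.
  by apply: growth_rate_lt; exact: le_lt_trans rd.
pose B : R := K%:R * #|J|%:R.
pose N0 := Num.bound (B / (c - d)).
apply: (@growth_rate_le _ _ (N0 + \sum_j N j)%N) => n Nn.
have Bn : B <= (c - d) * n%:R.
  rewrite mulrC -ler_pdivrMr ?subr_gt0//; apply: le_trans (_ : N0%:R <= _).
    apply/ltW; apply: le_lt_trans (archi_boundP _); first exact: lexx.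
    by rewrite divr_ge0 ?mulr_ge0 ?ler0n ?subr_ge0 ?ltW.
  by rewrite ler_nat; apply: leq_trans Nn; rewrite leq_addr.
apply: (@le_trans _ _ (B * expR (d * n%:R))).
  apply: (@le_trans _ _ (K%:R * \sum_j (v j n)%:R)); first by rewrite -natr_sum -natrM ler_nat.
  rewrite /B -mulrA ler_wpM2l ?ler0n// mulr_natl -sumr_const.
  apply: ler_sum => j _; apply: hN; apply: leq_trans Nn.
  by rewrite (bigD1 j)//=; lia.
rewrite (_ : c * _ = (c - d) * n%:R + d * n%:R); last by rewrite -mulrDl subrK.
rewrite expRD ler_wpM2r ?expR_ge0//; apply: le_trans Bn _.
by apply: le_trans (expR_ge1Dx _); rewrite lerDr.
Qed.

End GrowthRate.

(** * Algebraic entropy and spectral radius *)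

(** Substituting words for letters multiplies lengths by a constant; this exchanges the given
    generators for a free basis and back. *)
Lemma cyclic_length_compare (gT : groupType) (I J : finType) (x : I -> gT) (s : J -> gT) :
  generates x -> generates s ->
  exists K, forall a, (cyclic_length x a <= K * cyclic_length s a)%N.
Proof.
move=> gx gs; have /choice[W hW] l : exists w, word_eval x w = letter s l by exact: gx.
exists (\max_l size (W l))%N => a.
have [|[w [c [sw ew]]] _] := @leastP
    [set n | exists w c, size w = n /\ word_eval s w = (a ^ c)%g].
  by have [w ew] := gs a; exists (size w), w, 1%g; rewrite conjg1.
pose v := flatten [seq W l | l <- w].
have ev : word_eval x v = (a ^ c)%g.
  rewrite -ew /v; elim: (w) => [|l w' IH]; first by rewrite !word_eval_nil.
  by rewrite /= word_eval_cat hW IH word_eval_cons.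
have [|_ min] := @leastP [set n | exists w c, size w = n /\ word_eval x w = (a ^ c)%g].
  by exists (size v), v, c.
apply: (@leq_trans (size v)); first by apply: min; exists v, c.
rewrite [X in (_ <= _ * X)%N]/cyclic_length -sw /v.
elim: (w) => [|l w' IH] //=; rewrite size_cat mulnS leq_add//.
exact: (leq_bigmax_cond (F := fun l => size (W l))).
Qed.

Section EvaluationPoint.
Context {gT : groupType} {F : fieldType} {n : nat} {G : matrix_group F n}.
Variable phi : representation gT G.

Definition evaluation (v : char_ring G) : F^o := v phi.

Lemma evaluation_zmod : zmod_morphism evaluation. Proof. by []. Qed.
Lemma evaluation_monoid : monoid_morphism evaluation. Proof. by []. Qed.
Lemma evaluation_scale : scalable evaluation. Proof. by []. Qed.

HB.instance Definition _ := GRing.isZmodMorphism.Build _ _ _ evaluation_zmod.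
HB.instance Definition _ := GRing.isMonoidMorphism.Build _ _ _ evaluation_monoid.
HB.instance Definition _ := GRing.isScalable.Build _ _ _ _ _ evaluation_scale.

Definition evaluation_point : spec_point (char_ring G) := evaluation.

End EvaluationPoint.

Lemma spec_point_mmap (F : fieldType) (A : comAlgType F) N (u : 'I_N -> A)
    (z : spec_point A) (Q : mpoly N F) :
  z (mmap (in_alg A) u Q) = meval (affine_embedding u z) Q.
Proof.
elim/mpoly_alg_ind: Q => [c|i|p q IHp IHq|p q IHp IHq].
- by rewrite mmapC mevalC linearZ /= rmorph1 [LHS]mulr1.
- by rewrite mmapX mmap1U mevalXU.
- by rewrite mmapD mevalD raddfD /= IHp IHq.
- by rewrite !rmorphM /= IHp IHq.
Qed.

Section Dynamics.
Context {gT : groupType} {F : fieldType} {n : nat} {G : matrix_group F n}.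
Implicit Types (f g : {multiplicative gT -> gT}) (v : @char_ring gT F n G).

Lemma char_pullback_can f g : cancel f g ->
  cancel (char_pullback (G := G) f) (char_pullback g).
Proof.
move=> fg v; apply: char_ring_ext => phi /=; congr (v _).
by apply: rep_ext => a /=; rewrite fg.
Qed.

Lemma iter_multiplicative f k : exists fk : {multiplicative gT -> gT}, fk =1 iter k f.
Proof.
elim: k => [|k [fk fkE]]; first by exists idfun.
by exists (f \o fk) => a /=; rewrite fkE.
Qed.

Lemma iter_char_pullback f (fk : {multiplicative gT -> gT}) k v :
  fk =1 iter k f -> iter k (char_pullback f) v = char_pullback fk v.
Proof.
elim: k fk v => [|k IH] fk v fkE.
  apply: char_ring_ext => phi /=; congr (v _).
  by apply: rep_ext => a /=; rewrite fkE.
have [gk gkE] := iter_multiplicative f k.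
rewrite iterSr (IH _ _ gkE); apply: char_ring_ext => phi /=; congr (v _).
by apply: rep_ext => a /=; rewrite fkE gkE -iterSr.
Qed.

Lemma iter_extends_along f N (u : 'I_N -> char_ring G) (h : poly_map N N) k z :
  extends_along u (char_pullback f) h ->
  iter k (poly_map_fun h) (affine_embedding u z) =
  fun i => z (iter k (char_pullback f) (u i)).
Proof.
move=> [_ hE]; elim: k z => [//|k IH] z.
by rewrite iterSr hE IH.
Qed.

Lemma exists_extension f g N (u : 'I_N -> @char_ring gT F n G) :
  cancel f g -> cancel g f -> algebra_generators u ->
  exists h : poly_map N N, extends_along u (char_pullback f) h.
Proof.
move=> fg gf ugen.
have /choice[h hP] i : exists p : mpoly N F,
    char_pullback f (u i) = mmap (in_alg (char_ring G)) u p by exact: ugen.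
have hE z : poly_map_fun h (affine_embedding u z) =
    affine_embedding u (spec_map (char_pullback f) z).
  apply/funext => i; rewrite /poly_map_fun -spec_point_mmap -hP//.
exists h; split=> //; apply/seteqP; split=> [_ [_ [z _ <-] <-]|_ [z _ <-]].
  by rewrite hE; exists (spec_map (char_pullback f) z).
exists (affine_embedding u (spec_map (char_pullback g) z)); first by eexists.
rewrite hE; apply/funext => i; rewrite /affine_embedding /spec_map /=.
by rewrite char_pullback_can.
Qed.

Definition degree_witness N (u : 'I_N -> @char_ring gT F n G) f k (Q : poly_map N N) :=
  forall i, iter k (char_pullback f) (u i) = mmap (in_alg (char_ring G)) u (Q i).

(** Agreement on the F-points is an identity in [char_ring]: its elements are functions on
    representations, and evaluation at a representation is an F-point. *)
Lemma degree_on_iter f N (u : 'I_N -> @char_ring gT F n G) (h : poly_map N N) k :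
  extends_along u (char_pullback f) h ->
  degree_on (iter k (poly_map_fun h)) (range (affine_embedding u)) =
  least [set d | exists Q : poly_map N N, poly_degree Q = d /\ degree_witness u f k Q].
Proof.
move=> hf; congr least; apply/seteqP; split=> d [Q [dQ QE]]; exists Q; split=> //.
  move=> i; apply: char_ring_ext => phi.
  have := QE (affine_embedding u (evaluation_point phi)).
  rewrite (iter_extends_along _ _ hf) inE => /(_ (ex_intro2 _ _ _ I erefl)).
  by move=> /(congr1 (@^~ i)) e; rewrite mmap_char_ring; exact: (esym e).
move=> v; rewrite inE => -[z _ <-]; rewrite (iter_extends_along _ _ hf).
by apply/funext => i; rewrite /poly_map_fun -spec_point_mmap -QE.
Qed.

End Dynamics.

Section EntropyEqualsSpectralRadius.
Variable R : realType.
Context {gT : groupType} {I J : finType} (x : I -> gT) (s : J -> gT).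
Context (F : numFieldType) (n : nat) (G : matrix_group F n).
Hypotheses (freex : free_basis x) (gens : generates s).
Hypotheses (Gadj : selfadjoint G) (Gtr : has_trace_family G).
Variable f : {multiplicative gT -> gT}.
Variables (N : nat) (u : 'I_N -> @char_ring gT F n G).
Hypothesis ugen : algebra_generators u.

Let deg k := least [set d | exists Q : poly_map N N, poly_degree Q = d /\ degree_witness u f k Q].

Lemma exists_degree_witness k : exists d, exists Q : poly_map N N,
  poly_degree Q = d /\ degree_witness u f k Q.
Proof.
have /choice[Q hQ] i : exists p : mpoly N F, iter k (char_pullback f) (u i) =
    mmap (in_alg (char_ring G)) u p by exact: ugen.
by exists (poly_degree Q), Q.
Qed.

Lemma generator_polynomials : exists d (p : 'I_N -> mpoly #|coordinate I n| F),
  (forall i, deg_le d (p i)) /\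
  forall i (phi : representation gT G), u i phi = meval (coordinates x phi) (p i).
Proof.
have /choice[p hp] i := regular_polynomial freex.1 (char_ringP (u i)).1.
exists (\max_i (msize (p i)).-1)%N, p; split=> // i; apply/deg_leP.
exact: (leq_bigmax_cond (F := fun i => (msize (p i)).-1)).
Qed.

Definition test_element (j : I + I * I) : gT :=
  match j with inl i => x i | inr (i, i') => (x i * x i')%g end.

Lemma degree_upper_bound : exists K, forall k,
  (deg k <= K * \sum_j cyclic_length s (iter k f (test_element j)))%N.
Proof.
have [cj [cjK cj_ge0 G_adj]] := Gadj.
have [C hC] := char_ring_degree x cjK cj_ge0 G_adj ugen.
have [d [p [dp up]]] := generator_polynomials.
have [B hB] := cyclic_length_compare freex.1 gens.
(* B changes generators, 5 comes from Serre's lemma, d bounds the degrees of the generators u in the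
   entries, and C converts entries back to u. *)
exists (C * (5 * B * d))%N => k.
have [fk fkE] := iter_multiplicative f k.
(* A sum in place of the maximum, to match [growth_rate_le_sum]. *)
set L := (\sum_j _)%N.
have testL j : (cyclic_length x (iter k f (test_element j)) <= B * L)%N.
  by apply: leq_trans (hB _) _; rewrite leq_mul2l /L (bigD1 j)//= leq_addr orbT.
have [j|j j'|c hc] := @simultaneous_conjugation _ _ _ freex _ (fun i => fk (x i)) (B * L)%N.
- by rewrite fkE; exact: (testL (inl j)).
- by rewrite -gmulfM fkE; exact: (testL (inr (j, j'))).
have /choice[Q hQ] i : exists Q : mpoly N F, deg_le (C * (5 * (B * L) * d)) Q /\
    iter k (char_pullback f) (u i) = mmap (in_alg (char_ring G)) u Q.
  have [q dq qE] := pullback_degree hc (dp i) (up i).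
  have [Q dQ QE] := hC _ _ _ dq qE; exists Q; split=> //.
  by rewrite (iter_char_pullback _ fkE).
have [_] := leastP (exists_degree_witness k).
move=> /(_ (poly_degree Q)) degQ; apply: (@leq_trans (poly_degree Q)).
  by apply: degQ; exists Q; split=> // i; exact: (hQ i).2.
apply/bigmax_leqP => i _; apply: leq_trans (_ : (_ <= C * (5 * (B * L) * d))%N) _.
  exact/deg_leP/(hQ i).1.
by rewrite leq_eqVlt; apply/orP; left; apply/eqP; nia.
Qed.

Lemma degree_lower_bound a : exists K, forall k,
  (cyclic_length s (iter k f a) <= K * deg k)%N.
Proof.
have [K [iota [T [Psi [D [e [c [alpha h]]]]]]]] := Gtr I.
have [d [p [dp up]]] := generator_polynomials.
have [B hB] := cyclic_length_compare gens freex.1.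
have [P hP] := ugen (trace_char a).
exists (B * (D * (d * (msize P).-1)))%N => k.
have [fk fkE] := iter_multiplicative f k.
have [[Q [dQ hQ]] _] := leastP (exists_degree_witness k).
rewrite -/(deg k) in dQ.
apply: leq_trans (hB _) _; rewrite -!mulnA leq_mul2l; apply/orP; right.
(* The trace is P in u, the k-th pullback of u is Q in u, and u is p in the entries: the degrees
   multiply. *)
apply: leq_trans (trace_degree (d := (d * (deg k * (msize P).-1))%N)
  (p := subst_mpoly p (subst_mpoly Q P)) freex h _ _) _.
- apply: deg_le_subst => //; apply: deg_le_subst; last exact/deg_leP.
  move=> i; apply/deg_leP; rewrite -dQ.
  exact: (leq_bigmax_cond (F := fun i => (msize (Q i)).-1)).
- move=> phi; rewrite !meval_subst.
  transitivity (iter k (char_pullback f) (trace_char a) phi).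
    by rewrite (iter_char_pullback _ fkE) /= fkE.
  rewrite hP (iter_char_pullback _ fkE) /= mmap_char_ring; apply: meval_eq => i.
  transitivity (iter k (char_pullback f) (u i) phi).
    by rewrite (iter_char_pullback _ fkE).
  rewrite hQ mmap_char_ring; apply: meval_eq => j.
  exact: up.
- by rewrite !leq_mul2l [(_ * deg k)%N]mulnC leqnn !orbT.
Qed.

Lemma alg_entropy_spectral_radius (h : poly_map N N) :
  extends_along u (char_pullback f) h ->
  alg_entropy_on R h (range (affine_embedding u)) = spectral_radius R s f.
Proof.
move=> hf; rewrite /alg_entropy_on.
have -> : (fun k => degree_on (iter k (poly_map_fun h)) (range (affine_embedding u))) = deg.
  by apply/funext => k; exact: degree_on_iter.
apply/eqP; rewrite eq_le; apply/andP; split.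
  have [K hK] := degree_upper_bound.
  apply: (growth_rate_le_sum hK) => j.
  by apply: ereal_sup_ubound; exists (test_element j).
apply: ge_ereal_sup => _ [a _ <-].
have [K hK] := degree_lower_bound a.
apply: (growth_rate_le_sum (J := unit) (v := fun=> deg) (K := K)) => // k.
by rewrite big_const card_unit /= addn0.
Qed.

End EntropyEqualsSpectralRadius.

(** * The action of mapping classes on the fundamental group *)

Section MappingClassAction.
Context {R : realType} (S : surface R) (p : S) (bp : boundary p).

Lemma pi1_map_can (T : topologicalType) (q : T) (f g : T -> T) (cf : continuous f)
    (cg : continuous g) (fq : f q = q) (gq : g q = q) :
  cancel f g -> cancel (pi1_map (R := R) cf fq) (pi1_map cg gq).
Proof.
move=> fg; elim/pi1_ind => c; rewrite !pi1_map_class.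
by apply/pi1_classP/homotopic_eqfun => t _ /=; rewrite fg.
Qed.

Lemma mapping_class_pi1_inv (f : mapping_class S) :
  exists g : {multiplicative pi1 R p -> pi1 R p},
    cancel (mapping_class_pi1 bp f) g /\ cancel g (mapping_class_pi1 bp f).
Proof.
rewrite /mapping_class_pi1; move: (projT1 _) => d.
have dp : diffeo_inv d p = p by rewrite -{1}(diffeo_base bp d) diffeoK.
exists (pi1_map (R := R) (@diffeo_inv_continuous _ _ d) dp).
split; apply: pi1_map_can; [exact: diffeoK|exact: diffeoKV].
Qed.

End MappingClassAction.

(** The surface supplies a free basis of its fundamental group and the mapping class an invertible
    endomorphism; the rest concerns free groups. *)
Lemma alg_entropy_mapping_class (R : realType) (F : numFieldType) (n : nat) (G : matrix_group F n)
    (S : surface R) (g b : nat) (hS : surface_of_type S g b)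
    (f : mapping_class S) (p : S) (hp : boundary p)
    (m : nat) (s : 'I_m -> pi1 R p) (hs : generates s) :
  selfadjoint G -> has_trace_family G ->
  bijective (char_pullback (G := G) (mapping_class_pi1 hp f)) /\
  forall (N : nat) (u : 'I_N -> char_ring G), algebra_generators u ->
    (exists h : poly_map N N,
       extends_along u (char_pullback (mapping_class_pi1 hp f)) h) /\
    forall h : poly_map N N,
      extends_along u (char_pullback (mapping_class_pi1 hp f)) h ->
      alg_entropy_on R h (range (affine_embedding u)) =
      spectral_radius R s (mapping_class_pi1 hp f).
Proof.
move=> Gadj Gtr; have [e [fe ef]] := mapping_class_pi1_inv hp f.
split; first by exists (char_pullback e); exact: char_pullback_can.
move=> N u ugen; split; first exact: exists_extension ugen.
have [x freex] := hS.2 p.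
exact: (alg_entropy_spectral_radius R freex hs Gadj Gtr ugen).
Qed.

Theorem theorem1 (R : realType) (F : fieldType) (n : nat) (G : matrix_group F n)
    (hG : listed_group R G)
    (S : surface R) (g b : nat) (hb : (1 <= b)%N) (hS : surface_of_type S g b)
    (f : mapping_class S)
    (p : S) (hp : boundary p)
    (m : nat) (s : 'I_m -> pi1 R p) (hs : generates s) :
  bijective (char_pullback (G := G) (mapping_class_pi1 hp f)) /\
  forall (N : nat) (u : 'I_N -> char_ring G), algebra_generators u ->
    (exists h : poly_map N N,
       extends_along u (char_pullback (mapping_class_pi1 hp f)) h) /\
    forall h : poly_map N N,
      extends_along u (char_pullback (mapping_class_pi1 hp f)) h ->
      alg_entropy_on R h (range (affine_embedding u)) =
      spectral_radius R s (mapping_class_pi1 hp f).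
Proof.
(* The bounds on N leave sizes k.+2, k.+3 or k.+1, convertible to those for which the trace families
   are stated. *)
case: hG => [[|[|k]]//|[|[|k]]//|[|[|k]]//|[|[|k]]//|[|[|[|k]]]//|[|[|[|k]]]//|[|[|k]]//||[|k]//] *.
- apply: (alg_entropy_mapping_class hS) => //; last exact: has_trace_family_SL.
  by apply: selfadjoint_real; exact: SL_group_tr.
- apply: (@alg_entropy_mapping_class R (complex R) _ (SL_group (complex R) k.+2) S g b) => //;
    last exact: (@has_trace_family_SL (complex R)).
  apply: selfadjoint_complex => A; first exact: SL_group_tr.
  by rewrite /= det_map_mx => ->; rewrite rmorph1.
- apply: (alg_entropy_mapping_class hS) => //; last exact: has_trace_family_GL.
  by apply: selfadjoint_real; exact: GL_group_tr.
- apply: (@alg_entropy_mapping_class R (complex R) _ (GL_group (complex R) k.+2) S g b) => //;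
    last exact: (@has_trace_family_GL (complex R)).
  apply: selfadjoint_complex => A; first exact: GL_group_tr.
  by rewrite /= map_unitmx.
- apply: (alg_entropy_mapping_class hS) => //.
    by apply: selfadjoint_real; exact: O_group_tr.
  move=> I; have [K [iota [T [Psi [D [e [c [a h]]]]]]]] := has_trace_family_SO R k I.
  exists K, iota, T, Psi, D, e, c, a; apply: trace_family_sub h.
  by move=> A [].
- apply: (alg_entropy_mapping_class hS) => //; last exact: has_trace_family_SO.
  by apply: selfadjoint_real; exact: SO_group_tr.
- apply: (alg_entropy_mapping_class hS) => //.
    by apply: selfadjoint_real; exact: U_group_tr.
  move=> I; have [K [iota [T [Psi [D [e [c [a h]]]]]]]] := has_trace_family_SU R k I.
  exists K, iota, T, Psi, D, e, c, a; apply: trace_family_sub h.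
  by move=> A [Z [uZ _] <-]; exists Z.
- apply: (alg_entropy_mapping_class hS) => //; last exact: (has_trace_family_SU R 0).
  by apply: selfadjoint_real; exact: SU_group_tr.
- apply: (alg_entropy_mapping_class hS) => //; last exact: has_trace_family_Sp.
  by apply: selfadjoint_real; exact: Sp_group_tr.
Qed.
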